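(* For each $M \in \mathbb{N}$ let $N_M \in \overline{\mathbb{N}}$ and $z_M = (x_M, y_M) \in I_{N_M} \times I_M$, and suppose that for some $a \in [0,\infty]$ and $u \in (0,1]$, $$\lim_{M \to \infty} \frac{\min\{ x_M^2 , (N_M - x_M)^2 \}}{M} = a, \qquad \lim_{M \to \infty} \frac{y_M}{M} = u, \qquad \lim_{M \to \infty} \frac{M}{N_M^2} = 0 .$$ Consider the finite-capacity $(N_M, M, z_M)$ model with lifetime $\lambda$. Let $\xi$ (Darling--Mandelbrot with parameter $1/2$) and $\tau$ (positive $1/2$-stable) be independent random variables with the distributions specified in the context. Then, under $\mathbb{P}^{N_M,M}_{z_M}$, as $M \to \infty$, $$\frac{\lambda}{M} \ \overset{d}{\longrightarrow}\ \min(u, a\tau) + (1+\xi)\,\mathbf{1}\{ a \tau < u \},$$ and $$\lim_{M \to \infty} \frac{\mathbb{E}^{N_M,M}_{z_M} \lambda}{M} = g(a,u),$$ where $$g(a,u) := u + (4 - 2u - 2a)\,\overline{\Phi}(\sqrt{a/u}) + \sqrt{\frac{2au}{\pi}}\, e^{-a/(2u)} .$$ In particular, if $a = 0$ the two limits are equal to $1 + \xi$ and $2 = 1 + \mathbb{E}\xi$, respectively, while for $a = \infty$ they are both $u$.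
   Context: Notation: $\mathbb{N}=\{1,2,\dots\}$, $\overline{\mathbb{N}} = \mathbb{N}\cup\{\infty\}$, $\mathbb{Z}_+=\{0,1,2,\dots\}$. For $N\in\mathbb{N}$, $I_N = \{0,1,\dots,N\}$ with boundary $\partial I_N=\{0,N\}$; $I_\infty=\mathbb{Z}_+$ with boundary $\partial I_\infty=\{0\}$. The interior is $I_N^\circ = I_N\setminus\partial I_N$; always $N\ge 2$. Arithmetic over $\overline{\mathbb{N}}$ is by limits, e.g. $1/\infty=0$; in particular $N_M=\infty$ is allowed. Finite-capacity $(N,M,z)$ model ($N\in\overline{\mathbb{N}}$, $M\in\mathbb{N}$, $z\in I_N\times I_M$): the Markov chain $\zeta_n=(X_n,\eta_n)$, $n\in\mathbb{Z}_+$, with $\zeta_0=z$ and transitions: (1) from $(x,i)$ with $x\in I_N^\circ$, $i\ge 1$, move to $(x+1,i-1)$ or $(x-1,i-1)$ with probability $1/2$ each; (2) states $(x,0)$ with $x\in I_N^\circ$ are absorbing; (3) from $(x,i)$ with $x\in\partial I_N$, move with probability 1 to $(y,M)$, where $y\in I_N^\circ$ is the unique interior site with $|y-x|=1$. Its law and expectation are $\mathbb{P}^{N,M}_z$, $\mathbb{E}^{N,M}_z$. The lifetime is $\lambda=\min\{n\in\mathbb{Z}_+: X_n\in I_N^\circ,\ \eta_n=0\}$ ($\min\emptyset=+\infty$). Distributions: let $\mathcal{I}(t) = t\int_0^1 u^{-1/2}e^{ut}\,du$ for $t \in \mathbb{R}$ and $t_0=\inf\{t\in\mathbb{R}: e^t-\mathcal{I}(t)\le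 0\}$ (which is positive). The Darling--Mandelbrot distribution with parameter $1/2$ is the law on $[0,\infty)$ of $\xi$ with $\mathbb{E}[e^{t\xi}] = 1/(e^t-\mathcal{I}(t))$ for $t<t_0$. The positive $1/2$-stable (Lévy) law is that of $\tau$ with density $(2\pi t^3)^{-1/2}e^{-1/(2t)}$, $t>0$. $\overline{\Phi}(s)$ is the standard normal tail probability $\mathbb{P}(Z>s)$, $Z\sim\mathcal{N}(0,1)$. For $a=\infty$, $a\tau=\infty$ and $g(\infty,u)$ is understood as $\lim_{a\to\infty}g(a,u)=u$. *)

(* Defs.v *)
From HB Require Import structures.
From mathcomp Require Import all_boot all_order all_algebra.
From mathcomp Require Import all_classical all_reals all_analysis.

Set Implicit Arguments.
Unset Strict Implicit.
Unset Printing Implicit Defensive.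

Import Order.TTheory GRing.Theory Num.Theory.
Import numFieldNormedType.Exports.

Local Open Scope classical_set_scope.
Local Open Scope ring_scope.

(* [Some n] is the natural number n, [None] is infinity. *)
Definition enat := option nat.

Definition enat2ereal {R : realType} (N : enat) : \bar R :=
  if N is Some n then n%:R%:E else +oo%E.

Definition site (N : enat) (x : nat) : bool :=
  if N is Some n then (x <= n)%N else true.

Definition boundary (N : enat) (x : nat) : bool := (x == 0%N) || (N == Some x).

Definition interior_site (N : enat) (x : nat) : bool :=
  site N x && ~~ boundary N x.

Definition adjacent (x y : nat) : bool := (y == x.+1) || (x == y.+1).

(* Transition probability from (x, i) to (y, j). Sites x > N, at which the
   value is meaningless, are never reached from I_N * I_M. *)
Definition transition {R : realType} (N : enat) (M : nat)
    (z z' : nat * nat) : R :=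
  let: (x, i) := z in let: (y, j) := z' in
  if boundary N x then [&& interior_site N y, adjacent x y & j == M]%:R
  else if (0 < i)%N then (adjacent x y && (j == i.-1))%:R / 2
  else (z' == z)%:R.

(* The Markov property is stated with the conditional probabilities
   multiplied out, so that null histories need no separate treatment. *)
Definition is_chain {R : realType} {d} {T : measurableType d}
    (P : probability T R) (N : enat) (M : nat) (z : nat * nat)
    (zeta : nat -> {RV P >-> (nat * nat)%type}) : Prop :=
  P [set w | zeta 0%N w = z] = 1%E /\
  forall (n : nat) (s : nat -> nat * nat),
    P [set w | forall k, (k <= n.+1)%N -> zeta k w = s k] =
    (P [set w | forall k, (k <= n)%N -> zeta k w = s k]
       * (transition N M (s n) (s n.+1))%:E)%E.

(* The infimum of the empty set is +oo. *)
Definition lifetime {R : realType} {T : Type} (N : enat)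
    (zeta : nat -> T -> nat * nat) (w : T) : \bar R :=
  ereal_inf [set n%:R%:E | n in
    [set n | interior_site N (zeta n w).1 /\ (zeta n w).2 = 0%N]].

(* Convergence of distribution functions at continuity points of the limiting
   one. Values in \bar R are allowed since a lifetime can be infinite. *)
Definition cvg_in_distribution {R : realType}
    {d : nat -> measure_display} {T : forall n, measurableType (d n)}
    (P : forall n, probability (T n) R) (X : forall n, T n -> \bar R)
    {d'} {U : measurableType d'} (Q : probability U R) (Y : U -> \bar R) :=
  forall r : R,
    {for r, continuous (fun s : R => Q [set w | (Y w <= s%:E)%E])} ->
    P n [set w | (X n w <= r%:E)%E] @[n --> \oo] -->
      Q [set w | (Y w <= r%:E)%E].

Definition DM_I {R : realType} (t : R) : R :=
  t * Rintegral lebesgue_measure `]0, 1[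
        (fun v => v `^ (- 2^-1) * expR (v * t)).

Definition DM_t0 {R : realType} : R := inf [set t : R | expR t - DM_I t <= 0].

Definition darling_mandelbrot {R : realType} {d} {T : measurableType d}
    (P : probability T R) (xi : {RV P >-> R}) : Prop :=
  P [set w | 0 <= xi w] = 1%E /\
  forall t : R, t < DM_t0 -> 'M_P xi t = ((expR t - DM_I t)^-1)%:E.

Definition levy_pdf {R : realType} (t : R) : R :=
  if 0 < t then (Num.sqrt (2 * pi * t ^+ 3))^-1 * expR (- (2 * t)^-1) else 0.

Definition levy_distributed {R : realType} {d} {T : measurableType d}
    (P : probability T R) (tau : {RV P >-> R}) : Prop :=
  forall A : set R, measurable A ->
    distribution P tau A = (\int[lebesgue_measure]_(t in A) (levy_pdf t)%:E)%E.

Definition independent {R : realType} {d} {T : measurableType d}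
    (P : probability T R) (X Y : {RV P >-> R}) : Prop :=
  forall A B : set R, measurable A -> measurable B ->
    P (X @^-1` A `&` Y @^-1` B) = (P (X @^-1` A) * P (Y @^-1` B))%E.

Definition Phibar {R : realType} (s : R) : R :=
  fine (normal_prob 0 1 `]s, +oo[).

Definition g_fin {R : realType} (a u : R) : R :=
  u + (4 - 2 * u - 2 * a) * Phibar (Num.sqrt (a / u))
  + Num.sqrt (2 * a * u / pi) * expR (- (a / (2 * u))).

(* Only a >= 0 is meant; the value at -oo is arbitrary. *)
Definition g {R : realType} (a : \bar R) (u : R) : R :=
  match a with
  | r%:E => g_fin r u
  | +oo%E => lim (g_fin r u @[r --> +oo%R])
  | -oo%E => 0
  end.

(* min(u, a tau) + (1 + xi) 1{a tau < u}. If a = +oo, the library's product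
   a * tau is +oo as soon as tau > 0, which holds almost surely. *)
Definition limit_lifetime {R : realType} (a : \bar R) (u xi tau : R) : \bar R :=
  (Order.min u%:E (a * tau%:E)
   + (if a * tau%:E < u%:E then (1 + xi)%:E else 0))%E.

(* Main.v *)
(* The lifetime is controlled through its generating function
   [sum_n r^n P(lifetime > n)], which the refuelling renewals express through
   the survival probabilities of simple random walk started at [x] and at the
   neighbour of a refuelling site. The generating functions of those survival
   probabilities are explicit: with [r (rho^2 + 1) = 2 rho], hitting the
   boundary has the discrete harmonic Laplace transform
   [(rho^x + rho^(N - x)) / (1 + rho^N)], and for [r = exp (- k / M)] its limit
   is [exp (- sqrt (2 k a)) = E (exp (- k a tau))]. Karamata's Tauberian theorem
   (Weierstrass approximation on [0, 1]) turns convergence of the Laplace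
   transforms at the points [exp (- k / M)] into convergence of sums truncated
   at [u M]; it is applied to the excursion from the refuelling site, where the
   limit is a multiple of the image of Lebesgue measure on [s >= 0] under
   [exp (- s^2)], to the first hitting time of the boundary, and finally to the
   lifetime, whose limiting transform is that of the limit law because [1 + xi]
   has transform [exp (- k) / (exp (- k) + k int_0^1 v^(-1/2) exp (- k v) dv)]
   at [k]. At [r = 1] the same formula gives the mean, and the truncated moments
   of [a tau] under the Levy law give [g]. *)
Require Import Defs.
From HB Require Import structures.
From mathcomp Require Import all_boot all_order all_algebra.
From mathcomp Require Import all_classical all_reals all_analysis.
From mathcomp Require Import measurable_realfun.
From mathcomp Require Import zify ring lra.

Set Implicit Arguments.
Unset Strict Implicit.
Unset Printing Implicit Defensive.

Import Order.TTheory GRing.Theory Num.Theory.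
Import numFieldNormedType.Exports.

Local Open Scope classical_set_scope.
Local Open Scope ring_scope.

(** The chain is used only to identify its survival probabilities with a deterministic recursion;
    first-step analysis of that recursion takes the place of the strong Markov property, and the
    renewal decomposition is checked by algebra. The obstacle is a degenerate ratio: an excursion
    from the refuelling site survives [M] steps with probability of order [M^(-1/2)], and the
    denominator of the renewal formula is of that same order, so asymptotics of sums of survival
    probabilities do not settle the limit. The survival probability at the single time [M] is also
    required, and monotonicity extracts it from the sums. Only the points [exp (- k / M)] with
    integer [k] occur because the test functions are polynomials in [exp (- n / M)]. A truncation at
    [u M] is a jump at [exp (- u)], so each use of the Tauberian theorem asks the limit to have no
    atom there; for the lifetime itself this is where continuity points of the limit law enter. The
    condition [M / N_M^2 --> 0] makes the interval much longer than the diffusive scale [sqrt M], so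
    that only the nearer end is felt. *)

(** * Simple random walk killed at the boundary *)

Section RandomWalk.
Variables (R : realType) (N : enat).

(* [P_x(T > n)], [T] the hitting time of the boundary by simple random walk. *)
Fixpoint surv (n x : nat) : R :=
  if boundary N x then 0
  else if n is m.+1 then (surv m x.-1 + surv m x.+1) / 2 else 1.

Definition survsum (r : R) (n x : nat) : R := \sum_(k < n) r ^+ k * surv k x.

Lemma surv_boundary n x : boundary N x -> surv n x = 0.
Proof. by case: n => [|n] /= ->. Qed.

Lemma survS n x : ~~ boundary N x ->
  surv n.+1 x = (surv n x.-1 + surv n x.+1) / 2.
Proof. by move=> /negbTE /= ->. Qed.

Lemma surv0 x : ~~ boundary N x -> surv 0 x = 1.
Proof. by move=> /negbTE /= ->. Qed.

Lemma surv_ge0 n x : 0 <= surv n x.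
Proof.
elim: n x => [|n IH] x /=; case: ifP => // _.
by rewrite divr_ge0// addr_ge0.
Qed.

Lemma surv_nincr n x : surv n.+1 x <= surv n x.
Proof.
elim: n x => [|n IH] x.
  rewrite /=; case: ifP => // _.
  by do 2 case: ifP => _; lra.
case: (boolP (boundary N x)) => bx; first by rewrite !surv_boundary.
by rewrite (survS n.+1 bx) (survS n bx) ler_pM2r ?invr_gt0// lerD.
Qed.

Lemma surv_noninc m n x : (m <= n)%N -> surv n x <= surv m x.
Proof.
move=> /subnK <-; elim: (n - m)%N => // k IH.
by rewrite addSn (le_trans (surv_nincr _ _)).
Qed.

Lemma surv_le1 n x : surv n x <= 1.
Proof.
apply: (le_trans (surv_noninc x (leq0n n))).
by rewrite /=; case: ifP.
Qed.

Lemma survsum_ge0 r n x : 0 <= r -> 0 <= survsum r n x.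
Proof.
by move=> r0; apply: sumr_ge0 => i _; rewrite mulr_ge0 ?exprn_ge0 ?surv_ge0.
Qed.

Lemma survsum_boundary r n x : boundary N x -> survsum r n x = 0.
Proof. by move=> bx; rewrite /survsum big1// => i _; rewrite surv_boundary// mulr0. Qed.

Lemma survsumS r n x : ~~ boundary N x ->
  survsum r n.+1 x = 1 + r * (survsum r n x.-1 + survsum r n x.+1) / 2.
Proof.
move=> bx; rewrite /survsum big_ord_recl expr0 surv0// mulr1; congr +%R.
rewrite -big_split/= mulr_sumr mulr_suml; apply: eq_bigr => i _.
by rewrite /bump /= add1n exprS (negbTE bx); field.
Qed.

Lemma interior_nbr x : site N x -> ~~ boundary N x ->
  [/\ (0 < x)%N, site N x.-1 & site N x.+1].
Proof.
rewrite /site /boundary; case: N => [m|] /=; last first.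
  by rewrite orbF lt0n.
rewrite negb_or => xm /andP[x0 /eqP xNm].
have {}xNm : x <> m by move=> xm'; apply: xNm; rewrite xm'.
by split; [rewrite lt0n|apply: leq_trans (leq_pred _) xm|rewrite ltn_neqAle xm andbT; apply/eqP].
Qed.

(* With [r (rho^2 + 1) = 2 rho], the bounded solution of
   [f x = r (f (x - 1) + f (x + 1)) / 2] equal to 1 on the boundary. *)
Definition harmonic (rho : R) (x : nat) : R :=
  if N is Some m then (rho ^+ x + rho ^+ (m - x)) / (1 + rho ^+ m)
  else rho ^+ x.

Lemma harmonic_boundary rho x : 0 <= rho -> boundary N x -> harmonic rho x = 1.
Proof.
rewrite /boundary /harmonic => rho0; case: N => [m|].
  have h : 1 + rho ^+ m != 0 by rewrite gt_eqF// ltr_pwDl// exprn_ge0.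
  case/orP => [/eqP ->|/eqP[mx]].
    by rewrite expr0 subn0 divff.
  by rewrite -mx subnn expr0 addrC divff.
by rewrite orbF => /eqP ->.
Qed.

Lemma harmonic_ge0 rho x : 0 <= rho -> 0 <= harmonic rho x.
Proof.
move=> rho0; rewrite /harmonic; case: N => [m|]; last exact: exprn_ge0.
by rewrite divr_ge0// addr_ge0// ?exprn_ge0.
Qed.

Lemma harmonic_le1 rho x : 0 <= rho <= 1 -> site N x -> harmonic rho x <= 1.
Proof.
move=> /andP[rho0 rho1]; rewrite /harmonic /site; case: N => [m|] xm; last first.
  by rewrite exprn_ile1.
rewrite ler_pdivrMr ?mul1r ?ltr_pwDl ?exprn_ge0//.
rewrite -{2}(subnKC xm) exprD.
have : rho ^+ x <= 1 by rewrite exprn_ile1.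
have : rho ^+ (m - x) <= 1 by rewrite exprn_ile1.
move: (rho ^+ x) (rho ^+ (m - x)) => a b ha hb.
(* Expanded, this is [a + b <= 1 + a * b], and [a * b] is [rho ^+ m]. *)
have : 0 <= (1 - a) * (1 - b) by rewrite mulr_ge0 ?subr_ge0 //.
by lra.
Qed.

Lemma harmonic_eq r rho x : 0 <= rho -> r * (rho ^+ 2 + 1) = 2 * rho ->
  site N x -> ~~ boundary N x ->
  harmonic rho x = r * (harmonic rho x.-1 + harmonic rho x.+1) / 2.
Proof.
move=> rho0 rr sx bx; have [x0 _ sx1] := interior_nbr sx bx.
have key i : rho ^+ i.+1 = r * (rho ^+ i + rho ^+ i.+2) / 2.
  rewrite (exprS _ i.+1) (exprS _ i).
  have -> : r * (rho ^+ i + rho * (rho * rho ^+ i)) / 2 =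
     (r * (rho ^+ 2 + 1)) * rho ^+ i / 2 by field.
  by rewrite rr; field.
rewrite /harmonic; case: N sx sx1 {bx} => [m|] /= sx sx1; last first.
  by case: x x0 {sx sx1} => // x _; rewrite key.
have h : 1 + rho ^+ m != 0 by rewrite gt_eqF// ltr_pwDl// exprn_ge0.
have -> : (m - x.-1 = (m - x.+1).+2)%N by lia.
have -> : (m - x = (m - x.+1).+1)%N by lia.
case: x x0 sx sx1 => // x _ sx sx1.
by rewrite /= (key x) (key (m - x.+2)%N); field.
Qed.

(** The claimed limit [C] vanishes on the boundary and satisfies the same first-step recursion as
    [survsum]. Each step therefore multiplies the error by [r] and averages it over the two
    neighbours, starting from an error in [[0, 1 / (1 - r)]]. *)
Lemma survsum_harmonic r rho x : 0 < r < 1 -> 0 <= rho <= 1 ->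
  r * (rho ^+ 2 + 1) = 2 * rho -> site N x ->
  survsum r n x @[n --> \oo] --> (1 - harmonic rho x) / (1 - r).
Proof.
move=> /andP[r0 r1] rho01 rr; have /andP[rho0 rho1] := rho01.
pose C x := (1 - harmonic rho x) / (1 - r).
have r1' : 0 < 1 - r by rewrite subr_gt0.
have bnd n : forall x, site N x ->
    0 <= C x - survsum r n x <= r ^+ n / (1 - r).
  elim: n => [|n IH] {}x sx.
    have h0 := harmonic_ge0 x rho0; have h1 := harmonic_le1 rho01 sx.
    rewrite /survsum big_ord0 subr0 /C expr0 ler_pM2r ?invr_gt0//.
    by apply/andP; split; [apply: divr_ge0; lra|lra].
  case: (boolP (boundary N x)) => bx.
    rewrite survsum_boundary// subr0 /C harmonic_boundary// subrr mul0r lexx/=.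
    by rewrite divr_ge0 ?exprn_ge0// ltW.
  have [x0 s1 s2] := interior_nbr sx bx.
  have -> : C x - survsum r n.+1 x =
    r * ((C x.-1 - survsum r n x.-1) + (C x.+1 - survsum r n x.+1)) / 2.
    rewrite survsumS// /C (harmonic_eq rho0 rr)//; field.
    by rewrite gt_eqF.
  have /andP[a1 a2] := IH _ s1; have /andP[b1 b2] := IH _ s2.
  rewrite -mulrA exprS -mulrA ler_pM2l// pmulr_rge0//.
  by apply/andP; split; lra.
move=> sx; apply/cvgrPdist_le => /= e e0.
have : (r ^+ n / (1 - r)) @[n --> \oo] --> 0.
  rewrite -[X in _ --> X](mul0r (1 - r)^-1); apply: cvgM; last exact: cvg_cst.
  by apply: cvg_expr; rewrite ger0_norm ?ltW.
move=> /cvgrPdist_le /(_ e e0); apply: filterS => n.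
have /andP[a b] := bnd n x sx.
by rewrite sub0r normrN !ger0_norm ?(le_trans a b)//; exact: le_trans.
Qed.

End RandomWalk.

(** Reflection of the interval: a walk restarted next to the right end survives like one restarted
    at site 1. *)
Lemma surv_sym (R : realType) m n x : (x <= m)%N ->
  surv R (Some m) n (m - x) = surv R (Some m) n x.
Proof.
have bsym y : (y <= m)%N -> boundary (Some m) (m - y) = boundary (Some m) y.
  rewrite /boundary => ym; apply/orP/orP; rewrite subn_eq0 => -[/eqP|/eqP[]] h.
  - by right; apply/eqP; congr Some; lia.
  - by left; apply/eqP; lia.
  - by right; apply/eqP; congr Some; lia.
  - by left; lia.
elim: n x => [|n IH] x xm; first by rewrite /= bsym.
case: (boolP (boundary (Some m) x)) => bx.
  by rewrite !surv_boundary// bsym.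
have [x0 x1 x2] := interior_nbr (xm : site (Some m) x) bx.
rewrite !survS ?bsym// addrC.
have -> : ((m - x).+1 = m - x.-1)%N by lia.
have -> : ((m - x).-1 = m - x.+1)%N by lia.
by rewrite !IH.
Qed.

(** * The generating function of the lifetime and its renewal equation *)

Section Lifetime.
Variables (R : realType) (N : enat) (M : nat).
Hypothesis N2 : if N is Some m then (2 <= m)%N else true.

(* The interior neighbour of a boundary site [x]. *)
Definition refuel_site (x : nat) : nat := if x == 0%N then 1%N else x.-1.

(* [P_(x, i)(lifetime > n)]. *)
Fixpoint alive (n x i : nat) : R :=
  if boundary N x then
    if n is m.+1 then alive m (refuel_site x) M else 1
  else if i is j.+1 then
    if n is m.+1 then (alive m x.-1 j + alive m x.+1 j) / 2 else 1
  else 0.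

Lemma alive_boundary n x i : boundary N x ->
  alive n.+1 x i = alive n (refuel_site x) M.
Proof. by move=> /= ->. Qed.

Lemma alive_dead n x : ~~ boundary N x -> alive n x 0 = 0.
Proof. by case: n => [|n] /= /negbTE ->. Qed.

Lemma alive_step n x i : ~~ boundary N x ->
  alive n.+1 x i.+1 = (alive n x.-1 i + alive n x.+1 i) / 2.
Proof. by move=> /negbTE /= ->. Qed.

Lemma alive0 x i : boundary N x || (0 < i)%N -> alive 0 x i = 1.
Proof. by move=> /=; case: ifP => //; case: i. Qed.

Lemma alive_ge0 n x i : 0 <= alive n x i.
Proof.
elim: n x i => [|n IH] x i /=; case: ifP => // _; case: i => // i.
by rewrite divr_ge0// addr_ge0.
Qed.

Lemma alive_nincr n x i : alive n.+1 x i <= alive n x i.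
Proof.
elim: n x i => [|n IH] x i.
  have le1 y j : alive 0 y j <= 1 by rewrite /=; case: ifP => // _; case: j.
  case: (boolP (boundary N x)) => bx; first by rewrite (alive0 (x := x)) ?bx// alive_boundary// le1.
  case: i => [|i]; first by rewrite !alive_dead.
  rewrite (alive_step _ _ bx) (alive0 (x := x)) ?orbT//.
  by rewrite ler_pdivrMr// mul1r (lerD (le1 _ _) (le1 _ _)).
case: (boolP (boundary N x)) => bx; first by rewrite (alive_boundary n.+1 _ bx) (alive_boundary n _ bx).
case: i => [|i]; first by rewrite !alive_dead.
by rewrite (alive_step n.+1 _ bx) (alive_step n _ bx) ler_pM2r ?invr_gt0// lerD.
Qed.

Definition alivesum (r : R) n x i : R := \sum_(k < n) r ^+ k * alive k x i.

Lemma alivesum_boundary r n x i : boundary N x ->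
  alivesum r n.+1 x i = 1 + r * alivesum r n (refuel_site x) M.
Proof.
move=> bx; rewrite /alivesum big_ord_recl expr0 alive0 ?bx// mulr1; congr +%R.
by rewrite mulr_sumr; apply: eq_bigr => k _; rewrite lift0 alive_boundary// exprS mulrA.
Qed.

Lemma alivesum_dead r n x : ~~ boundary N x -> alivesum r n x 0 = 0.
Proof. by move=> bx; rewrite /alivesum big1// => k _; rewrite alive_dead// mulr0. Qed.

Lemma alivesum_step r n x i : ~~ boundary N x ->
  alivesum r n.+1 x i.+1 = 1 + r * (alivesum r n x.-1 i + alivesum r n x.+1 i) / 2.
Proof.
move=> bx; rewrite /alivesum big_ord_recl expr0 alive0 ?orbT// mulr1; congr +%R.
rewrite -big_split mulr_sumr mulr_suml; apply: eq_bigr => k _.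
by rewrite lift0 alive_step// exprS /=; field.
Qed.

(* Generating function of the hitting time of the boundary, truncated at [i]. *)
Definition hitsum (r : R) i x : R :=
  1 - (1 - r) * survsum N r i x - r ^+ i * surv R N i x.

Lemma hitsum_boundary r i x : boundary N x -> hitsum r i x = 1.
Proof. by move=> bx; rewrite /hitsum survsum_boundary// surv_boundary// !mulr0 !subr0. Qed.

Lemma hitsum0 r x : ~~ boundary N x -> hitsum r 0 x = 0.
Proof.
by move=> bx; rewrite /hitsum /survsum big_ord0 surv0// mulr0 expr0 mulr1 subr0 subrr.
Qed.

Lemma hitsumS r i x : ~~ boundary N x ->
  hitsum r i.+1 x = r * (hitsum r i x.-1 + hitsum r i x.+1) / 2.
Proof. by move=> bx; rewrite /hitsum survsumS// survS// exprS; field. Qed.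

Lemma hitsum_ge0 r i x : 0 <= r -> 0 <= hitsum r i x.
Proof.
move=> r0; elim: i x => [|i IH] x; case: (boolP (boundary N x)) => bx.
- by rewrite hitsum_boundary.
- by rewrite hitsum0.
- by rewrite hitsum_boundary.
- by rewrite hitsumS// divr_ge0// mulr_ge0// addr_ge0.
Qed.

(** This is [1 - r * hitsum r M 1], the coefficient of the unknown in the renewal equation,
    rearranged as a sum of terms that are nonnegative for [0 <= r <= 1]. At [r = 1] only the
    survival probability remains. *)
Definition refuel_denom (r : R) : R :=
  (1 - r) * (1 + r * survsum N r M 1) + r ^+ M.+1 * surv R N M 1.

(* [sum_n r^n P(lifetime > n)] for the process started on the boundary. *)
Definition refuel_sum (r : R) : R := (1 + r * survsum N r M 1) / refuel_denom r.

(** Decomposition at the first visit to the boundary: the time before it, cut at the fuel supply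
    [i], plus a fresh start on the boundary if the visit happens within [i] steps. *)
Definition lifesum (r : R) x i : R := survsum N r i x + hitsum r i x * refuel_sum r.

(** By reflection both ends restart like site 1, and the equation becomes the linear one that
    [refuel_sum] solves. *)
Lemma lifesum_refuel r x : refuel_denom r != 0 -> site N x -> boundary N x ->
  refuel_sum r = 1 + r * lifesum r (refuel_site x) M.
Proof.
move=> d0 sx bx.
have -> : lifesum r (refuel_site x) M = lifesum r 1 M.
  rewrite /refuel_site; case: eqP => // /eqP x0.
  move: bx; rewrite /boundary (negbTE x0)/= => /eqP Nx.
  have survE n : surv R N n x.-1 = surv R N n 1.
    by rewrite Nx -subn1 surv_sym// lt0n.
  rewrite /lifesum /hitsum survE; congr (_ + (1 - _ * _ - _) * _);
    by apply: eq_bigr => k _; rewrite survE.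
move: d0; rewrite /lifesum /refuel_sum /hitsum /refuel_denom exprS => d0.
by field.
Qed.

(** Both sides obey the same first-step recursion, so the error after [n] terms is at most
    [B * (r ^+ n * alive n x i)]. For [r = 1] the power gives no contraction; instead, the bound is
    a multiple of the general term of a series of nonnegative terms whose partial sums stay below
    [lifesum], hence it tends to 0. *)
Lemma alivesum_lifesum r x i : 0 < r <= 1 -> 0 < refuel_denom r ->
  site N x -> (i <= M)%N ->
  alivesum r n x i @[n --> \oo] --> lifesum r x i.
Proof.
move=> /andP[r0 r1] d0 sx iM.
have s0 : 0 <= refuel_sum r.
  apply: divr_ge0; last exact: ltW.
  by rewrite addr_ge0// mulr_ge0 ?(ltW r0)// survsum_ge0// ltW.
have sE : forall x, site N x -> boundary N x ->
    refuel_sum r = 1 + r * lifesum r (refuel_site x) M.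
  by move=> y; apply: lifesum_refuel; rewrite gt_eqF.
have lb y j : 0 <= lifesum r y j.
  by rewrite addr_ge0 ?survsum_ge0 ?(ltW r0)// mulr_ge0// hitsum_ge0// ltW.
(* A [survsum] of at most [M] terms, each at most 1, plus a [hitsum] of at most 1 times
   [refuel_sum r]. *)
pose B := M%:R + refuel_sum r.
have ub y j : (j <= M)%N -> lifesum r y j <= B.
  move=> jM; rewrite lerD//.
    apply: (@le_trans _ _ j%:R); last by rewrite ler_nat.
    rewrite -[j in leRHS]card_ord -sum1_card natr_sum ler_sum// => k _.
    by rewrite mulr_ile1 ?exprn_ge0 ?surv_ge0 ?exprn_ile1 ?surv_le1// ltW.
  rewrite ler_piMl// /hitsum -addrA gerDl -opprD oppr_le0 addr_ge0//.
    by rewrite mulr_ge0 ?subr_ge0// survsum_ge0// ltW.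
  by rewrite mulr_ge0 ?surv_ge0// exprn_ge0// ltW.
have bnd n : forall x i, site N x -> (i <= M)%N ->
    0 <= lifesum r x i - alivesum r n x i <= B * (r ^+ n * alive n x i).
  elim: n => [|n IH] {}x {}i {}sx {}iM.
    rewrite {1 2}/alivesum !big_ord0 subr0 lb expr0 mul1r andTb.
    case: (boolP (boundary N x || (0 < i)%N)) => [bi|].
      by rewrite alive0// mulr1 ub.
    rewrite negb_or -eqn0Ngt => /andP[bx /eqP ->].
    by rewrite alive_dead// /lifesum hitsum0// /survsum big_ord0 mul0r mulr0 addr0.
  case: (boolP (boundary N x)) => bx.
    have nb : site N (refuel_site x).
      rewrite /refuel_site; case: eqP => [_|x0].
        by case: N N2 => // m /ltnW.
      by case: N sx => // m /= xm; rewrite (leq_trans _ xm)// leq_pred.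
    have /andP[a b] := IH _ _ nb (leqnn M).
    rewrite alivesum_boundary// {1 2}/lifesum survsum_boundary// hitsum_boundary//.
    rewrite add0r mul1r (sE x)// opprD addrACA subrr add0r -mulrBr pmulr_rge0//.
    by rewrite a alive_boundary// exprS -mulrA mulrCA ler_pM2l.
  have [x0 s1 s2] := interior_nbr sx bx.
  case: i iM => [|i] iM.
    rewrite alivesum_dead// alive_dead// /lifesum hitsum0// /survsum big_ord0.
    by rewrite mul0r addr0 subr0 !mulr0 lexx.
  have /andP[a1 b1] := IH _ i s1 (ltnW iM).
  have /andP[a2 b2] := IH _ i s2 (ltnW iM).
  have -> : lifesum r x i.+1 - alivesum r n.+1 x i.+1 =
    r * (((lifesum r x.-1 i - alivesum r n x.-1 i) +
        (lifesum r x.+1 i - alivesum r n x.+1 i)) / 2).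
    by rewrite alivesum_step// /lifesum survsumS// hitsumS//; field.
  rewrite alive_step// exprS -mulrA (mulrCA B) ler_pM2l// pmulr_rge0//.
  by apply/andP; split; lra.
have sbnd n : alivesum r n x i <= lifesum r x i.
  by have /andP[+ _] := bnd n x i sx iM; rewrite subr_ge0.
have cv : cvgn (series (fun k => r ^+ k * alive k x i)).
  apply: nondecreasing_is_cvgn.
    apply/nondecreasing_seqP => n; rewrite /series/= big_nat_recr//= lerDl.
    by rewrite mulr_ge0 ?alive_ge0// exprn_ge0// ltW.
  exists (lifesum r x i) => _ [n _ <-].
  by rewrite /series/= big_mkord; exact: sbnd.
have t0 : B * (r ^+ n * alive n x i) @[n --> \oo] --> 0.
  rewrite -(mulr0 B); apply: cvgMr; exact: cvg_series_cvg_0 cv.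
apply/cvgrPdist_le => /= e e0; move/cvgrPdist_le : t0 => /(_ e e0).
apply: filterS => n; have /andP[a b] := bnd n x i sx iM.
by rewrite sub0r normrN !ger0_norm ?(le_trans a b)//; exact: le_trans.
Qed.

End Lifetime.

(** * From the chain to the recursion for its survival probabilities *)

Lemma measurable_nat2 (A : set (nat * nat)) : measurable A.
Proof.
rewrite (_ : A = \bigcup_i ([set i] `*` [set j | A (i, j)])); last first.
  apply/seteqP; split => [[i j] Aij|[i j] [k _ [/= -> //]]].
  by exists i => //; split.
by apply: bigcup_measurable => i _; exact: measurableX.
Qed.

Definition dead (N : enat) (z : nat * nat) : bool :=
  interior_site N z.1 && (z.2 == 0%N).

Section ChainLaw.
Context {R : realType} {d} {T : measurableType d} (P : probability T R).
Variables (N : enat) (M : nat).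
Variable zeta : nat -> {RV P >-> (nat * nat)%type}.
Hypothesis N2 : if N is Some m then (2 <= m)%N else true.

Let prefix m (s : nat -> nat * nat) := [set w | forall k, (k <= m)%N -> zeta k w = s k].
Let live m n := [set w | forall k, (m <= k <= m + n)%N -> ~~ dead N (zeta k w)].

Lemma measurable_state k (A : set (nat * nat)) : measurable [set w | A (zeta k w)].
Proof.
rewrite -[X in measurable X]setTI.
exact: (measurable_funP (zeta k)) measurableT _ (measurable_nat2 A).
Qed.

Lemma measurable_prefix m s : measurable (prefix m s).
Proof.
rewrite (_ : prefix m s = \bigcap_k [set w | (k <= m)%N -> zeta k w = s k]).
  apply: bigcap_measurable; first by exists 0%N.
  by move=> k _; exact: (measurable_state k (fun z => (k <= m)%N -> z = s k)).
by apply/seteqP; split => w h => [k _|k] /=; exact: h.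
Qed.

Lemma measurable_live m n : measurable (live m n).
Proof.
rewrite (_ : live m n =
    \bigcap_k [set w | (m <= k <= m + n)%N -> ~~ dead N (zeta k w)]).
  apply: bigcap_measurable; first by exists 0%N.
  by move=> k _; exact: (measurable_state k (fun z => (m <= k <= m + n)%N -> ~~ dead N z)).
by apply/seteqP; split => w h => [k _|k] /=; exact: h.
Qed.

Variable z0 : nat * nat.
Hypothesis chain : is_chain N M z0 zeta.

(** Only the values up to time [m + 1] are ever inspected, so the constant [z] may fill all later
    times. *)
Let extend m (s : nat -> nat * nat) z k := if (k <= m)%N then s k else z.

Lemma prefix_extend m s z :
  P (prefix m.+1 (extend m s z)) = (P (prefix m s) * (transition N M (s m) z)%:E)%E.
Proof.
have [_ /(_ m (extend m s z))] := chain.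
rewrite /extend leqnn ltnn => ->; congr (P _ * _)%E.
by apply/seteqP; split => w h k km; have := h k km; rewrite km.
Qed.

Lemma prefix_extend_sub m s z : prefix m.+1 (extend m s z) `<=` prefix m s.
Proof. by move=> w h k km; have := h k (leqW km); rewrite /extend km. Qed.

Lemma interior_siteN x : site N x -> interior_site N x = ~~ boundary N x.
Proof. by rewrite /interior_site => ->. Qed.

Lemma live_extend m n s z : ~~ dead N (s m) ->
  prefix m.+1 (extend m s z) `&` live m n.+1 =
  prefix m.+1 (extend m s z) `&` live m.+1 n.
Proof.
move=> sm; apply/seteqP; split => w [h1 h2]; split => // k /andP[k1 k2].
  by apply: h2; rewrite (ltnW k1) addnS -addSn.
case: (ltnP m k) => mk; first by apply: h2; rewrite mk addSn -addnS.
have -> : k = m by apply/eqP; rewrite eqn_leq mk.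
by rewrite h1// /extend leqnn.
Qed.

Lemma prob_sub_full (A B C : set T) : measurable A -> measurable B ->
  measurable C -> B `<=` A -> P B = P A -> P (A `&` C) = P (B `&` C).
Proof.
move=> mA mB mC BA PBA.
have PAB : P (A `\` B) = 0%E.
  rewrite measureD//; last by rewrite ltey_eq fin_num_measure.
  rewrite [A `&` B]setIidr// [X in (_ - X)%E]PBA subee//.
  exact: fin_num_measure.
have -> : A `&` C = (B `&` C) `|` ((A `\` B) `&` C).
  apply/seteqP; split => w [].
    by move=> Aw Cw; have [Bw|nBw] := pselect (B w); [left|right].
  - by move=> [/BA].
  - by move=> [[]].
have mD : measurable (A `\` B) by exact: measurableD.
rewrite measureU0//; [exact: measurableI|exact: measurableI|].
apply: (@subset_measure0 _ _ _ P _ (A `\` B)) => //.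
exact: measurableI.
Qed.

Lemma live_succ m n s z : ~~ dead N (s m) -> transition N M (s m) z = 1 :> R ->
  P (prefix m s `&` live m n.+1) =
  P (prefix m.+1 (extend m s z) `&` live m.+1 n).
Proof.
move=> sm t1; rewrite -live_extend//; apply: prob_sub_full.
- exact: measurable_prefix.
- exact: measurable_prefix.
- exact: measurable_live.
- exact: prefix_extend_sub.
- by rewrite prefix_extend t1 mule1.
Qed.

(** The two disjoint extensions have mass one half each, so together they exhaust the history up to
    a null set. *)
Lemma live_succ2 m n s z1 z2 : ~~ dead N (s m) -> z1 != z2 ->
  transition N M (s m) z1 = 2^-1 :> R -> transition N M (s m) z2 = 2^-1 :> R ->
  P (prefix m s `&` live m n.+1) =
  (P (prefix m.+1 (extend m s z1) `&` live m.+1 n) +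
   P (prefix m.+1 (extend m s z2) `&` live m.+1 n))%E.
Proof.
move=> sm z12 t1 t2; rewrite -!live_extend//.
set A1 := prefix m.+1 (extend m s z1); set A2 := prefix m.+1 (extend m s z2).
have A12 : A1 `&` A2 = set0.
  apply/seteqP; split => // w [] /(_ _ (leqnn _)) h1 /(_ _ (leqnn _)).
  by rewrite h1 /extend ltnn => /eqP; rewrite (negbTE z12).
have mA1 : measurable A1 by exact: measurable_prefix.
have mA2 : measurable A2 by exact: measurable_prefix.
have mL : measurable (live m n.+1) by exact: measurable_live.
have -> : P (prefix m s `&` live m n.+1) = P ((A1 `|` A2) `&` live m n.+1).
  apply: prob_sub_full => //; first exact: measurable_prefix.
  - exact: measurableU.
  - by move=> w [|]; exact: prefix_extend_sub.
  - transitivity (P A1 + P A2)%E; first exact: measureU.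
    rewrite /A1 /A2 !prefix_extend t1 t2.
    rewrite -ge0_muleDr ?lee_fin ?invr_ge0//= -EFinD.
    by rewrite (_ : 2^-1 + 2^-1 = 1) ?mule1//; field.
rewrite setIUl measureU//; [exact: measurableI|exact: measurableI|].
by rewrite setIACA A12 set0I.
Qed.

(** Induction on [n] with the time [m] and the history [s] arbitrary: one application of the Markov
    property lengthens the history by a step, and the cases dead, boundary and interior match the
    branches of [alive]. *)
Lemma prob_live n m s : site N (s m).1 ->
  P (prefix m s `&` live m n) = (P (prefix m s) * (alive R N M n (s m).1 (s m).2)%:E)%E.
Proof.
have dead0 k m' s' : dead N (s' m') -> P (prefix m' s' `&` live m' k) = 0%E.
  move=> dz; rewrite (_ : _ `&` _ = set0) ?measure0//.
  apply/seteqP; split => // w [h1 h2].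
  by have := h2 m'; rewrite h1// dz leqnn leq_addr => /(_ isT).
elim: n m s => [|n IH] m s sm.
  case: (boolP (dead N (s m))) => dz.
    rewrite dead0//; move: dz; rewrite /dead interior_siteN// => /andP[bx /eqP ->].
    by rewrite alive_dead// mule0.
  rewrite alive0; last first.
    by move: dz; rewrite /dead interior_siteN// negb_and negbK lt0n.
  rewrite mule1; congr (P _); apply: setIidl => w h k.
  by rewrite addn0 -eqn_leq => /eqP <-; rewrite h.
case: (boolP (dead N (s m))) => dz.
  rewrite dead0//; move: dz; rewrite /dead interior_siteN// => /andP[bx /eqP ->].
  by rewrite alive_dead// mule0.
have em z : extend m s z m.+1 = z by rewrite /extend ltnn.
case sE: (s m) => [x i]; move: sm; rewrite sE /= => sx.
case: (boolP (boundary N x)) => bx.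
  have t1 : transition N M (s m) (refuel_site x, M) = 1 :> R.
    rewrite /transition sE bx /refuel_site eqxx andbT.
    suff -> : interior_site N (if x == 0%N then 1%N else x.-1) && Defs.adjacent x (if x == 0%N then 1%N else x.-1) by [].
    rewrite /Defs.adjacent /interior_site /site /boundary; move: bx; rewrite /boundary.
    case: eqP => [->|/eqP x0] /=.
      by move=> _; case: N N2 => [[|[|n']]|].  
    move=> /eqP Nx; move: N2; rewrite Nx => x2.
    have x3 : (x.-1 != 0)%N by lia.
    rewrite (negbTE x3) /= leq_pred /=; apply/andP; split; last by lia.
    by apply/eqP => -[]; lia.
  rewrite (live_succ n dz t1) IH !em/=.
    by rewrite prefix_extend t1 mule1.
  (* That the successor lies in [I_N], as the induction hypothesis requires, is read off from its
     transition probability being nonzero. *)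
  have : transition N M (s m) (refuel_site x, M) != 0 :> R by rewrite t1 oner_neq0.
  by rewrite /transition sE bx /interior_site; case: (site N _) => //=; rewrite eqxx.
have [x0 s1 s2] := interior_nbr sx bx.
have i0 : (0 < i)%N.
  by move: dz; rewrite /dead sE interior_siteN//= bx/= lt0n.
have t1 : transition N M (s m) (x.-1, i.-1) = 2^-1 :> R.
  by rewrite /transition sE (negbTE bx) i0 eqxx /Defs.adjacent (prednK x0) eqxx orbT mul1r.
have t2 : transition N M (s m) (x.+1, i.-1) = 2^-1 :> R.
  by rewrite /transition sE (negbTE bx) i0 eqxx /Defs.adjacent eqxx mul1r.
rewrite (live_succ2 n dz _ t1 t2); last by apply/eqP => -[]; lia.
rewrite !IH ?em// !prefix_extend t1 t2 /=.
case: i i0 {sE dz t1 t2} => // i _ /=.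
have [p ->] : exists p : R, P (prefix m s) = p%:E.
  by exists (fine (P (prefix m s))); rewrite fineK ?fin_num_measure//; exact: measurable_prefix.
by rewrite -!EFinM -EFinD; congr EFin; field.
Qed.

Lemma chain_survival n : site N z0.1 ->
  P [set w | forall k, (k <= n)%N -> ~~ dead N (zeta k w)] =
  (alive R N M n z0.1 z0.2)%:E.
Proof.
move=> sz; have [Pz0 _] := chain.
have mz : measurable [set w | zeta 0%N w = z0] by exact: (measurable_state 0 (fun z => z = z0)).
have p0 : prefix 0 (fun=> z0) = [set w | zeta 0%N w = z0].
  by apply/seteqP; split => w h => [|k]; [exact: h|rewrite leqn0 => /eqP ->].
have := prob_live n (m := 0) (s := fun=> z0) sz.
rewrite p0 Pz0 mul1e => <-.
rewrite -[LHS](_ : P (setT `&` live 0 n) = _); last by rewrite setTI.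
by apply: prob_sub_full => //; [exact: measurable_live|rewrite Pz0 probability_setT].
Qed.

End ChainLaw.

(** * Weierstrass approximation by Bernstein polynomials *)

Section Weierstrass.
Variable R : realType.

(** Uniform continuity handles points closer than [del]; beyond that,
    [2 * B / del ^+ 2 * (x - y) ^+ 2] already exceeds the oscillation [2 * B]. The quadratic form is
    chosen because its binomial expectation is explicit. *)
Lemma continuous_modulus (f : R -> R) (e : R) : continuous f -> 0 < e ->
  exists2 K, 0 <= K & forall x y, 0 <= x <= 1 -> 0 <= y <= 1 ->
    `|f x - f y| <= e + K * (x - y) ^+ 2.
Proof.
move=> cf e0.
have cpt : compact `[0 : R, 1] by exact: segment_compact.
have unif : \forall del \near (0 : R)^'+,
    `[0 : R, 1] `<=` [set x | forall y, `|x - y| < del -> `|f x - f y| <= e].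
  move/compact_near_coveringP : cpt; apply => x _.
  have := cf x; move/cvgrPdist_le => /(_ (e / 2)); rewrite divr_gt0// => /(_ isT).
  move=> [/= r r0 fr].
  have r20 : 0 < r / 2 by rewrite divr_gt0.
  exists (ball x (r / 2), [set del | 0 < del < r / 2]) => /=.
    split; first by exact: nbhsx_ballx.
    by near=> del; apply/andP; split; near: del; [exact: nbhs_right_gt|exact: nbhs_right_lt].
  move=> [x' del] [/= xx' /andP[del0 delr]] y x'y.
  have h1 : `|f x - f x'| <= e / 2.
    by apply: fr => /=; apply: lt_trans xx' _; lra.
  have h2 : `|f x - f y| <= e / 2.
    apply: fr => /=; rewrite -(subrKA x'); apply: le_lt_trans (ler_normD _ _) _.
    have /= : `|x - x'| < r / 2 by [].
    by move: x'y; lra.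
  rewrite -(subrKA (f x)); apply: le_trans (ler_normD _ _) _.
  by rewrite (distrC (f x') (f x)); lra.
have [del [del0 hdel]] : exists del : R, 0 < del /\
    `[0 : R, 1] `<=` [set x | forall y, `|x - y| < del -> `|f x - f y| <= e].
  near (0 : R)^'+ => del; exists del; split.
    by near: del; exact: nbhs_right_gt.
  by near: del.
have [B B0 hB] : exists2 B : R, 0 <= B & forall x, 0 <= x <= 1 -> `|f x| <= B.
  have /compact_bounded [B0 [_ hB]] : compact (f @` `[0 : R, 1]).
    by apply: continuous_compact => //; exact: continuous_subspaceT.
  exists (`|B0| + 1) => // x x01; apply: (hB (`|B0| + 1)).
    by rewrite (le_lt_trans (ler_norm _))// ltrDl.
  by exists x => //=; rewrite in_itv.
have d2 : 0 < del ^+ 2 by rewrite exprn_gt0.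
exists (2 * B / del ^+ 2) => [|x y x01 y01].
  by rewrite divr_ge0 ?mulr_ge0// ltW.
have [xy|xy] := ltP `|x - y| del.
  apply: (le_trans (hdel x _ y xy)) => /=; first by rewrite in_itv.
  by rewrite lerDl mulr_ge0 ?sqr_ge0// divr_ge0 ?mulr_ge0// ltW.
apply: (@le_trans _ _ (2 * B)).
  by rewrite (le_trans (ler_normB _ _))// mulr2n mulrDl mul1r lerD// hB.
apply: (@le_trans _ _ (2 * B / del ^+ 2 * (x - y) ^+ 2)); last by rewrite lerDr ltW.
rewrite -mulrA ler_peMr ?mulr_ge0// mulrC ler_pdivlMr// mul1r.
by rewrite -[leRHS]real_normK ?num_real// lerXn2r// nnegrE ltW.
Unshelve. all: by end_near. Qed.

(* [bernstein n g] evaluated at [x] is the expectation of [g] under the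
   binomial law of parameters [n] and [x]. *)
Fixpoint bernstein (n : nat) (g : nat -> R) : {poly R} :=
  if n is m.+1 then 'X * bernstein m (g \o succn) + (1 - 'X) * bernstein m g
  else (g 0%N)%:P.

Lemma bernsteinS n g x : (bernstein n.+1 g).[x] =
  x * (bernstein n (g \o succn)).[x] + (1 - x) * (bernstein n g).[x].
Proof. by rewrite /= !hornerE. Qed.

Lemma le_bernstein n g h x : 0 <= x <= 1 ->
  (forall k, (k <= n)%N -> g k <= h k) ->
  (bernstein n g).[x] <= (bernstein n h).[x].
Proof.
move=> /andP[x0 x1]; elim: n g h => [|n IH] g h gh.
  by rewrite /= !hornerC gh.
rewrite !bernsteinS lerD// ler_wpM2l ?subr_ge0//.
  by apply: IH => k kn; exact: gh.
by apply: IH => k kn; apply: gh; exact: leqW.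
Qed.

(** The second moment of a binomial variable about [c] is its variance plus the squared bias. The
    centre [c] is general because a success in the first trial moves it to [c - 1] in the
    induction. *)
Lemma bernstein_quadratic n x (b a c : R) :
  (bernstein n (fun k => b + a * (k%:R - c) ^+ 2)).[x] =
  b + a * (n%:R * x * (1 - x) + (n%:R * x - c) ^+ 2).
Proof.
elim: n c => [|n IH] c; first by rewrite /= hornerC; ring.
rewrite bernsteinS IH.
have -> : (fun k => b + a * (k%:R - c) ^+ 2) \o succn =
    (fun k => b + a * (k%:R - (c - 1)) ^+ 2).
  by apply/funext => k /=; rewrite -natr1; ring.
by rewrite IH -natr1; ring.
Qed.

Lemma weierstrass (f : R -> R) (e : R) : continuous f -> 0 < e ->
  exists p : {poly R}, forall x, 0 <= x <= 1 -> `|p.[x] - f x| <= e.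
Proof.
move=> cf e0; have e20 : 0 < e / 2 by rewrite divr_gt0.
have [K K0 hK] := continuous_modulus cf e20.
(* Large enough for [K / n <= e / 2]; the binomial variance contributes at most [K / n] to the
   error. *)
pose n := (Num.truncn (2 * K / e)).+1.
have n0 : (0 : R) < n%:R by rewrite ltr0n.
have nK : K / n%:R <= e / 2.
  rewrite ler_pdivrMr// mulrC -ler_pdivrMr//.
  have := truncnS_gt (2 * K / e); rewrite -/n => /ltW; apply: le_trans.
  by rewrite le_eqVlt; apply/orP; left; apply/eqP; field; rewrite gt_eqF.
exists (bernstein n (fun k => f (k%:R / n%:R))) => x x01.
have hk k : (k <= n)%N ->
    `|f (k%:R / n%:R) - f x| <= e / 2 + K / n%:R ^+ 2 * (k%:R - n%:R * x) ^+ 2.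
  move=> kn; apply: (le_trans (hK _ _ _ x01)).
    by rewrite divr_ge0//= ler_pdivrMr// mul1r ler_nat.
  rewrite lerD2l -mulrA ler_wpM2l// le_eqVlt; apply/orP; left; apply/eqP.
  by field; rewrite gt_eqF.
(* The centre [n%:R * x] makes the bias vanish. The values [s = 1] and [s = -1] give the upper and
   the lower envelope. *)
have bq s : (bernstein n (fun k => (f x + s * (e / 2)) + s * (K / n%:R ^+ 2) *
    (k%:R - n%:R * x) ^+ 2)).[x] = f x + s * (e / 2 + K / n%:R * (x * (1 - x))).
  by rewrite bernstein_quadratic; field; rewrite gt_eqF.
have xx : x * (1 - x) <= 1.
  by move: x01 => /andP[? ?]; rewrite mulr_ile1 ?subr_ge0// gerBl.
have Kx : K / n%:R * (x * (1 - x)) <= e / 2.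
  by apply: le_trans nK; rewrite ler_piMr// divr_ge0// ltW.
rewrite ler_distl; apply/andP; split.
  apply: (@le_trans _ _ (f x + -1 * (e / 2 + K / n%:R * (x * (1 - x))))); first by lra.
  rewrite -bq; apply: le_bernstein => // k /hk; rewrite ler_distl => /andP[+ _]; lra.
apply: (@le_trans _ _ (f x + 1 * (e / 2 + K / n%:R * (x * (1 - x))))); last by lra.
rewrite -bq; apply: le_bernstein => // k /hk; rewrite ler_distl => /andP[_]; lra.
Qed.

End Weierstrass.

(** * Domination for real-valued integrals *)

Section IntegralToolbox.
Context {d} {U : measurableType d} {R : realType}.
Variable mu : {measure set U -> \bar R}.

Lemma le_integrableR (f g : U -> R) : measurable_fun setT f ->
  (forall t, `|f t| <= g t) -> mu.-integrable setT (EFin \o g) ->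
  mu.-integrable setT (EFin \o f).
Proof.
move=> mf fg; apply: le_integrable => //; first exact/measurable_EFinP.
by move=> t _; rewrite /= lee_fin (le_trans (fg t))// ler_norm.
Qed.

Lemma Rdominated_convergence (f_ : nat -> U -> R) (f g : U -> R) :
  (forall n, measurable_fun setT (f_ n)) -> measurable_fun setT f ->
  {ae mu, forall t, f_ n t @[n --> \oo] --> f t} ->
  mu.-integrable setT (EFin \o g) -> (forall n t, `|f_ n t| <= g t) ->
  \int[mu]_t f_ n t @[n --> \oo] --> \int[mu]_t f t.
Proof.
move=> mf_ mf cf ig fg.
have mf_' n : measurable_fun setT (EFin \o f_ n) by exact/measurable_EFinP.
have mf' : measurable_fun setT (EFin \o f) by exact/measurable_EFinP.
have cf' : {ae mu, forall t, setT t -> (EFin \o f_ n) t @[n --> \oo] --> (EFin \o f) t}.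
  by move: cf; apply: filterS => t cft _; apply: cvg_EFin => //; exact: nearW.
have fg' : {ae mu, forall t n, setT t -> (`|(EFin \o f_ n) t| <= (EFin \o g) t)%E}.
  by apply: aeW => t n _; rewrite /= lee_fin.
have [itf _] := dominated_convergence measurableT mf_' mf' cf' ig fg'.
rewrite -(fineK (integrable_fin_num measurableT itf)) => h.
exact: fine_cvg h.
Qed.

End IntegralToolbox.

(** * Karamata's Tauberian theorem *)

Section Karamata.
Context {d} {U : measurableType d} {R : realType}.
Variable mu : {measure set U -> \bar R}.
Variables (Z : U -> R) (w S : nat -> nat -> R).
Hypothesis mZ : measurable_fun setT Z.
Hypothesis Z01 : forall t, 0 <= Z t <= 1.
Hypothesis iZ : mu.-integrable setT (EFin \o Z).
Hypothesis w0 : forall M n, 0 <= w M n.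

Let z (M n : nat) : R := expR (- (n%:R / M%:R)).

Hypothesis wS : forall k M, (0 < k)%N -> (0 < M)%N ->
  series (fun n => w M n * z M n ^+ k) @ \oo --> S k M.
Hypothesis SZ : forall k, (0 < k)%N -> S k M @[M --> \oo] --> \int[mu]_t (Z t ^+ k).

(** The measure [mu] may be infinite and only [Z] is integrable; the extra factor [Z t] keeps the
    functional finite for every bounded [f]. Correspondingly, only powers [k > 0] are assumed to
    converge. *)
Let L (f : R -> R) : R := \int[mu]_t (Z t * f (Z t)).

Let z01 M n : 0 <= z M n <= 1.
Proof. by rewrite /z expR_ge0/= -expR0 ler_expR oppr_le0 divr_ge0. Qed.

Lemma bounded01 (f : R -> R) : continuous f ->
  exists2 B, 0 <= B & forall x, 0 <= x <= 1 -> `|f x| <= B.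
Proof.
move=> cf; have [K K0 hK] := continuous_modulus cf (@ltr01 R).
exists (`|f 0| + (1 + K)) => [|x x01]; first by rewrite !addr_ge0.
rewrite -[f x](subrK (f 0)) (le_trans (ler_normD _ _))// addrC lerD2l.
rewrite (le_trans (hK x 0 x01 _)) ?lexx ?ler01// lerD2l subr0 ler_piMr//.
by move: x01 => /andP[? ?]; rewrite exprn_ile1.
Qed.

Lemma integrable_comp_Z (f : R -> R) : continuous f ->
  mu.-integrable setT (EFin \o (fun t => Z t * f (Z t))).
Proof.
move=> cf; have [B B0 hB] := bounded01 cf.
apply: (@le_integrableR _ _ _ _ _ (fun t => B * Z t)).
- apply: measurable_funM => //; apply: measurableT_comp => //.
  exact: continuous_measurable_fun.
- move=> t; have /andP[t0 _] := Z01 t.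
  by rewrite normrM (ger0_norm t0) mulrC ler_wpM2r// hB.
- exact: (integrableZl measurableT B iZ).
Qed.

Let horner_continuous (p : {poly R}) : continuous (horner p).
Proof. exact: continuous_horner. Qed.

Let sum_functional (a : nat -> R) m : exists Sp : nat -> R,
  (forall M, (0 < M)%N ->
    series (fun n => w M n * (\sum_(i < m) a i * z M n ^+ i.+1)) @ \oo --> Sp M) /\
  Sp M @[M --> \oo] --> \int[mu]_t (\sum_(i < m) a i * Z t ^+ i.+1).
Proof.
have itS k : mu.-integrable setT (EFin \o (fun t => Z t ^+ k.+1)).
  have := @integrable_comp_Z (fun x => x ^+ k) (@exprn_continuous _ k).
  by under eq_fun do rewrite -exprS.
elim: m => [|m [Sp [IH1 IH2]]].
  exists (fun=> 0); split.
    move=> M M0; under eq_fun do rewrite big_ord0 mulr0.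
    rewrite /series/=; under eq_fun do rewrite big1//.
    exact: cvg_cst.
  under eq_Rintegral do rewrite big_ord0.
  by rewrite Rintegral_cst// mul0r; exact: cvg_cst.
exists (fun M => Sp M + a m * S m.+1 M); split.
  move=> M M0.
  rewrite (_ : series _ = series (fun n => w M n * (\sum_(i < m) a i * z M n ^+ i.+1)) +
      (fun n => a m * series (fun n => w M n * z M n ^+ m.+1) n)).
    by apply: cvgD; [exact: IH1|apply: cvgMr; exact: wS].
  apply/funext => n /=; rewrite /series/= fctE mulr_sumr -big_split/=.
  by apply: eq_bigr => i _; rewrite big_ord_recr/= mulrDr; congr +%R; rewrite mulrCA.
under eq_Rintegral do rewrite big_ord_recr/=.
have its : mu.-integrable setT (EFin \o (fun t => \sum_(i < m) a i * Z t ^+ i.+1)).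
  elim: m {IH1 IH2 Sp} => [|m IH].
    by under eq_fun do rewrite big_ord0; exact: integrable0.
  under eq_fun do rewrite big_ord_recr/=.
  exact: (integrableD measurableT IH (integrableZl measurableT (a m) (itS m))).
rewrite RintegralD//; last exact: (integrableZl measurableT (a m) (itS m)).
rewrite RintegralZl//.
by apply: cvgD => //; apply: cvgMr; exact: SZ.
Qed.

Lemma poly_functional (p : {poly R}) : exists Sp : nat -> R,
  (forall M, (0 < M)%N ->
    series (fun n => w M n * (z M n * p.[z M n])) @ \oo --> Sp M) /\
  Sp M @[M --> \oo] --> L (horner p).
Proof.
have pE (x : R) : x * p.[x] = \sum_(i < size p) p`_i * x ^+ i.+1.
  by rewrite horner_coef mulr_sumr; apply: eq_bigr => i _; rewrite exprS mulrCA.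
have [Sp [h1 h2]] := sum_functional (fun i => p`_i) (size p).
exists Sp; split => [M M0|].
  by under eq_fun do rewrite pE; exact: h1.
by rewrite /L; under eq_Rintegral do rewrite pE.
Qed.

Lemma le_functional (f g : R -> R) (e : R) : continuous f -> continuous g ->
  (forall x, 0 <= x <= 1 -> f x <= g x + e) -> L f <= L g + e * \int[mu]_t Z t.
Proof.
move=> cf cg fg; rewrite -RintegralZl// -RintegralD//; last 2 first.
- exact: integrable_comp_Z.
- exact: (integrableZl measurableT e iZ).
apply: le_Rintegral => //.
- exact: integrable_comp_Z.
- exact: (integrableD measurableT (integrable_comp_Z cg) (integrableZl measurableT e iZ)).
- move=> t _; have /andP[t0 _] := Z01 t.
  by rewrite (mulrC e) -mulrDr ler_wpM2l// fg.
Qed.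

(* [f] is approximated from the required side by a polynomial, so that partial
   sums compare with full sums. *)
Lemma upper_functional (f : R -> R) (e : R) : continuous f -> 0 < e ->
  (forall x, 0 <= x <= 1 -> 0 <= f x) ->
  \forall M \near \oo, forall K,
    \sum_(n < K) w M n * (z M n * f (z M n)) <= L f + e.
Proof.
move=> cf e0 f0; set I := \int[mu]_t Z t.
have I0 : 0 <= I by apply: Rintegral_ge0 => t _; have /andP[] := Z01 t.
(* Moving the polynomial to one side of [f] costs up to [h + h] pointwise, hence
   [2 * h * I <= e / 2] in the functional; the added 1 keeps the denominator positive. *)
pose h := e / (4 * (I + 1)).
have h0 : 0 < h by rewrite divr_gt0// mulr_gt0// ltr_wpDl.
have [p hp] := weierstrass cf h0.
have [Sp [Sp1 Sp2]] := poly_functional (p + h%:P).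
have hLf : L (horner (p + h%:P)) <= L f + e / 2.
  apply: (@le_trans _ _ (L f + (h + h) * I)).
    apply: (@le_functional (horner (p + h%:P)) f (h + h)) => //.
    move=> x /hp; rewrite hornerD hornerC ler_distl => /andP[_]; lra.
  rewrite lerD2l /h -mulrDl mulrAC ler_pdivrMr ?mulr_gt0 ?ltr_wpDl//; nra.
have e20 : 0 < e / 2 by rewrite divr_gt0.
near=> M => K.
have M0 : (0 < M)%N by near: M; exists 1%N.
have S1 : Sp M <= L (horner (p + h%:P)) + e / 2.
  by near: M; move/cvgrPdist_le : Sp2 => /(_ _ e20); apply: filterS => M;
     rewrite ler_distlC => /andP[].
have fp n : f (z M n) <= (p + h%:P).[z M n].
  have := hp _ (z01 M n); rewrite hornerD hornerC ler_distl => /andP[+ _]; lra.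
apply: (@le_trans _ _ (Sp M)); last by move: S1 hLf; lra.
apply: (@le_trans _ _ (series (fun n => w M n * (z M n * (p + h%:P).[z M n])) K)).
  rewrite /series/= big_mkord ler_sum// => n _.
  by rewrite ler_wpM2l// ler_wpM2l//; have /andP[] := z01 M n.
rewrite -(cvg_lim _ (Sp1 M M0))//; apply: nondecreasing_cvgn_le; last first.
  by apply/cvg_ex; exists (Sp M); exact: Sp1.
apply/nondecreasing_seqP => n; rewrite /series/= big_nat_recr//= lerDl.
have /andP[? ?] := z01 M n.
by rewrite !mulr_ge0// (le_trans _ (fp n))// f0// z01.
Unshelve. all: by end_near. Qed.

(** From [K] on the polynomial minorant lies below [f = 0], so its later terms are nonpositive and
    its full sum is at most its partial sum. The bound is uniform in [K] because the cut will depend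
    on [M]. *)
Lemma lower_functional (f : R -> R) (e : R) : continuous f -> 0 < e ->
  \forall M \near \oo, forall K, (forall n, (K <= n)%N -> f (z M n) = 0) ->
    L f - e <= \sum_(n < K) w M n * (z M n * f (z M n)).
Proof.
move=> cf e0; set I := \int[mu]_t Z t.
have I0 : 0 <= I by apply: Rintegral_ge0 => t _; have /andP[] := Z01 t.
pose h := e / (4 * (I + 1)).
have h0 : 0 < h by rewrite divr_gt0// mulr_gt0// ltr_wpDl.
have [p hp] := weierstrass cf h0.
have [Sp [Sp1 Sp2]] := poly_functional (p - h%:P).
have hLf : L f <= L (horner (p - h%:P)) + e / 2.
  apply: (@le_trans _ _ (L (horner (p - h%:P)) + (h + h) * I)).
    apply: (@le_functional f (horner (p - h%:P)) (h + h)) => //.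
    move=> x /hp; rewrite hornerD hornerN hornerC ler_distl => /andP[+ _]; lra.
  rewrite lerD2l /h -mulrDl mulrAC ler_pdivrMr ?mulr_gt0 ?ltr_wpDl//; nra.
have e20 : 0 < e / 2 by rewrite divr_gt0.
near=> M => K fK.
have M0 : (0 < M)%N by near: M; exists 1%N.
have S1 : L (horner (p - h%:P)) - e / 2 <= Sp M.
  by near: M; move/cvgrPdist_le : Sp2 => /(_ _ e20); apply: filterS => M;
     rewrite ler_distlC => /andP[].
have fp n : (p - h%:P).[z M n] <= f (z M n).
  have := hp _ (z01 M n); rewrite hornerD hornerN hornerC ler_distl => /andP[_]; lra.
apply: (@le_trans _ _ (Sp M)); first by move: S1 hLf; lra.
pose s := series (fun n => w M n * (z M n * (p - h%:P).[z M n])).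
apply: (@le_trans _ _ (s K)); last first.
  rewrite /s /series/= big_mkord ler_sum// => n _.
  by rewrite ler_wpM2l// ler_wpM2l//; have /andP[] := z01 M n.
rewrite -(cvg_lim _ (Sp1 M M0))//; apply: limr_le.
  by apply/cvg_ex; exists (Sp M); exact: Sp1.
near=> n'; have Kn : (K <= n')%N by near: n'; exists K.
rewrite -(subnKC Kn); elim: (n' - K)%N => [|j]; first by rewrite addn0.
apply: le_trans; rewrite addnS /series/= big_nat_recr//= gerDl.
rewrite mulr_ge0_le0// mulr_ge0_le0//; first by have /andP[] := z01 M (K + j).
by rewrite (le_trans (fp _))// fK// leq_addr.
Unshelve. all: by end_near. Qed.

Definition ramp (a h x : R) : R := Num.min 1 (Num.max 0 ((x - a) / h)).

Lemma ramp01 a h x : 0 <= ramp a h x <= 1.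
Proof. by rewrite /ramp le_min ler01 le_max lexx ge_min lexx. Qed.

Lemma ramp_eq0 a h x : 0 < h -> x <= a -> ramp a h x = 0.
Proof.
move=> h0 xa; have : (x - a) / h <= 0 by rewrite ler_pdivrMr// mul0r subr_le0.
by move=> /max_l; rewrite /ramp => ->; rewrite min_r.
Qed.

Lemma ramp_eq1 a h x : 0 < h -> a + h <= x -> ramp a h x = 1.
Proof.
move=> h0 xa; have h1 : 1 <= (x - a) / h by rewrite ler_pdivlMr// mul1r lerBrDl.
by rewrite /ramp max_r ?(le_trans ler01 h1)// min_l.
Qed.

Lemma ramp_continuous a h : continuous (ramp a h).
Proof.
move=> x; apply: (@continuous_min _ _ (cst 1) (fun x => Num.max 0 ((x - a) / h))).
  exact: cvg_cst.
apply: (@continuous_max _ _ (cst 0) (fun x => (x - a) / h)); first exact: cvg_cst.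
by apply: cvgM; [apply: cvgB; [exact: cvg_id|exact: cvg_cst]|exact: cvg_cst].
Qed.

Variables (y : nat -> nat) (u : R) (psi : R -> R).
Hypothesis y_u : ((y M)%:R / M%:R : R) @[M --> \oo] --> u.
Hypothesis Zu : mu (Z @^-1` [set expR (- u)]) = 0%E.
Hypothesis cpsi : continuous psi.
Hypothesis psi0 : forall x, 0 <= x <= 1 -> 0 <= psi x.

Let c := expR (- u).
(** Division by [x] cancels the factor [Z t] in [L]. Replacing [x] by [Num.max x c0] keeps the
    function continuous at 0 and changes nothing where the ramp is nonzero, provided [c0 <= a]. *)
Let ftest (c0 a h : R) (x : R) : R := psi x * ramp a h x / Num.max x c0.

Let ftest_cont c0 a h : 0 < c0 -> continuous (ftest c0 a h).
Proof.
move=> c00 x; apply: cvgM; first by apply: cvgM; [exact: cpsi|exact: ramp_continuous].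
apply: cvgV; first by rewrite gt_eqF// lt_max c00 orbT.
by apply: (@continuous_max _ _ id (cst c0)); [exact: cvg_id|exact: cvg_cst].
Qed.

Let ftestE c0 a h x : 0 < h -> 0 < c0 -> c0 <= a ->
  x * ftest c0 a h x = psi x * ramp a h x.
Proof.
move=> h0 c00 c0a; rewrite /ftest; have [xa|xa] := leP x a.
  by rewrite (ramp_eq0 h0 xa) !mulr0 mul0r mulr0.
have xc : c0 < x by apply: le_lt_trans xa.
by rewrite max_l ?ltW// mulrC divfK// gt_eqF// (lt_trans c00).
Qed.

Let ftest_lim (a h : nat -> R) :
  (forall j, 0 < h j) -> (forall j, c / 3 <= a j) ->
  {ae mu, forall t, ramp (a j) (h j) (Z t) @[j --> \oo] --> ((c <= Z t)%R%:R : R)} ->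
  L (ftest (c / 3) (a j) (h j)) @[j --> \oo] --> \int[mu]_t (psi (Z t) * (c <= Z t)%R%:R).
Proof.
move=> h0 ca ae; have [B B0 hB] := bounded01 cpsi.
have c0 : 0 < c by exact: expR_gt0.
have c30 : 0 < c / 3 by rewrite divr_gt0.
have -> : (fun j => L (ftest (c / 3) (a j) (h j))) =
    fun j => \int[mu]_t (psi (Z t) * ramp (a j) (h j) (Z t)).
  by apply/funext => j; apply: eq_Rintegral => t _; rewrite ftestE.
have mp : measurable_fun setT (psi \o Z).
  by apply: measurableT_comp => //; exact: continuous_measurable_fun.
(* The ramps vanish below [a j >= c / 3], so where they do not, the bound [B] on [psi] is at most
   [B * (3 / c) * Z t]. *)
apply: (@Rdominated_convergence _ _ _ _ _ _ (fun t => B * (3 / c) * Z t)).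
- move=> j; apply: measurable_funM => //.
  apply: measurableT_comp mZ; apply: continuous_measurable_fun; exact: ramp_continuous.
- apply: measurable_funM => //.
  apply: (@measurableT_comp _ _ _ _ _ _ (fun b : bool => b%:R : R) _ (fun t => c <= Z t)) => //.
  exact: measurable_fun_ler.
- by move: ae; apply: filterS => t; exact: cvgMr.
- exact: (integrableZl measurableT _ iZ).
- move=> j t; have /andP[t0 t1] := Z01 t; have /andP[r0 r1] := ramp01 (a j) (h j) (Z t).
  rewrite normrM (ger0_norm r0); have [ta|ta] := leP (Z t) (a j).
    by rewrite ramp_eq0// mulr0 mulr_ge0// mulr_ge0// divr_ge0// ltW.
  rewrite -mulrA; apply: ler_pM => //; first exact: hB.
  apply: le_trans r1 _; rewrite mulrAC ler_pdivlMr// mul1r.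
  have := le_lt_trans (ca j) ta; lra.
Qed.

(** The condition [n <= y M] cuts at [z M (y M)], which tends to [c]. For fixed [j] and large [M]
    the cut is enclosed between a ramp rising on [[c - 2 h, c - h]] and one rising on
    [[c + h, c + 2 h]]. As [h] tends to 0 the two limits differ only by the mass of [Z = c], which
    [Zu] excludes. *)
Theorem karamata :
  \sum_(n < (y M).+1) w M n * psi (z M n) @[M --> \oo] -->
  \int[mu]_t (psi (Z t) * (c <= Z t)%R%:R).
Proof.
have c0 : 0 < c by exact: expR_gt0.
(* With [h j <= c / 3] even the left ramp starts at [c - 2 * h j >= c / 3], the threshold used in
   [ftest]. *)
pose h (j : nat) := c / 3 * (j.+1%:R)^-1.
have h0 j : 0 < h j by rewrite mulr_gt0 ?divr_gt0// invr_gt0 ltr0n.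
have hc j : h j <= c / 3.
  by rewrite ler_piMr ?divr_ge0 ?(ltW c0)// invf_le1 ?ltr0n// ler1n.
have hlim : h j @[j --> \oo] --> 0.
  rewrite -(mulr0 (c / 3)); apply: cvgMr; exact: cvg_harmonic.
have up : L (ftest (c / 3) (c - 2 * h j) (h j)) @[j --> \oo] -->
    \int[mu]_t (psi (Z t) * (c <= Z t)%R%:R).
  apply: ftest_lim => // [j|]; first by have := hc j; lra.
  apply: aeW => t; have [cz|cz] := leP c (Z t).
    rewrite (_ : (fun _ => _) = cst 1); first exact: cvg_cst.
    by apply/funext => j; rewrite ramp_eq1//; have := h0 j; lra.
  apply: cvg_near_cst; have : 0 < (c - Z t) / 2 by rewrite divr_gt0// subr_gt0.
  move/cvgrPdist_le : hlim => /[apply]; apply: filterS => j.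
  rewrite sub0r normrN (ger0_norm (ltW (h0 j))) => hj.
  by rewrite ramp_eq0//; lra.
have dn : L (ftest (c / 3) (c + h j) (h j)) @[j --> \oo] -->
    \int[mu]_t (psi (Z t) * (c <= Z t)%R%:R).
  apply: ftest_lim => // [j|]; first by have := h0 j; lra.
  have : {ae mu, forall t, Z t <> c}.
    exists (Z @^-1` [set c]); split => //; last by move=> t /= /contrapT.
    by rewrite -[X in measurable X]setTI; apply: mZ.
  apply: filterS => t Ztc; have [zc|cz] := leP (Z t) c.
    have -> : (c <= Z t) = false by apply/negP => cz; apply: Ztc; apply/eqP; rewrite eq_le zc.
    rewrite (_ : (fun _ => _) = cst 0); first exact: cvg_cst.
    by apply/funext => j; rewrite ramp_eq0//; have := h0 j; lra.
  rewrite ltW//; apply: cvg_near_cst.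
  have : 0 < (Z t - c) / 2 by rewrite divr_gt0// subr_gt0.
  move/cvgrPdist_le : hlim => /[apply]; apply: filterS => j.
  rewrite sub0r normrN (ger0_norm (ltW (h0 j))) => hj.
  by rewrite ramp_eq1//; lra.
have zy : z M (y M) @[M --> \oo] --> c.
  exact: cvg_comp (cvgN y_u) (@continuous_expR R (- u)).
have zle M m n : (0 < M)%N -> (m <= n)%N -> z M n <= z M m.
  by move=> M0 mn; rewrite /z ler_expR lerN2 ler_pM2r ?invr_gt0 ?ltr0n// ler_nat.
have ftest_ge0 j a x : 0 <= x <= 1 -> 0 <= ftest (c / 3) a (h j) x.
  move=> x01; rewrite /ftest divr_ge0//; last by rewrite le_max (divr_ge0 (ltW c0))// orbT.
  by rewrite mulr_ge0 ?psi0//; have /andP[] := ramp01 a (h j) x.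
have cont j a : continuous (ftest (c / 3) a (h j)).
  by apply: ftest_cont; rewrite divr_gt0.
apply/cvgrPdist_le => /= e e0; have e20 : 0 < e / 2 by rewrite divr_gt0.
have [j [upj dnj]] : exists j,
   L (ftest (c / 3) (c - 2 * h j) (h j)) <= \int[mu]_t (psi (Z t) * (c <= Z t)%R%:R) + e / 2 /\
   \int[mu]_t (psi (Z t) * (c <= Z t)%R%:R) - e / 2 <= L (ftest (c / 3) (c + h j) (h j)).
  near \oo => j; exists j; split; near: j.
    move/cvgrPdist_le : up => /(_ _ e20); apply: filterS => j.
    by rewrite ler_distlC => /andP[].
  move/cvgrPdist_le : dn => /(_ _ e20); apply: filterS => j.
  by rewrite ler_distlC => /andP[].
near=> M.
have M0 : (0 < M)%N by near: M; exists 1%N.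
have zh : `|c - z M (y M)| <= h j.
  by near: M; move/cvgrPdist_le : zy; apply; exact: h0.
move: zh; rewrite ler_distlC => /andP[zh1 zh2].
rewrite ler_distlC; apply/andP; split.
  apply: (@le_trans _ _ (L (ftest (c / 3) (c + h j) (h j)) - e / 2)); first by lra.
  apply: (@le_trans _ _ (\sum_(n < (y M).+1) w M n *
      (z M n * ftest (c / 3) (c + h j) (h j) (z M n)))).
    have : forall n, ((y M).+1 <= n)%N -> ftest (c / 3) (c + h j) (h j) (z M n) = 0.
      move=> n yn; rewrite /ftest ramp_eq0 ?mulr0 ?mul0r//.
      by rewrite (le_trans (zle _ _ _ M0 (ltnW yn))).
    (* The cut is generalized before [M] is released, since the eventual bounds hold for all cuts
       simultaneously. *)
    move: ((y M).+1); near: M.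
    exact: (@lower_functional (ftest (c / 3) (c + h j) (h j)) (e / 2)).
  apply: ler_sum => n _; rewrite ler_wpM2l// ftestE ?divr_gt0//; last first.
    by have := h0 j; lra.
  by rewrite ler_piMr ?psi0//; have /andP[] := ramp01 (c + h j) (h j) (z M n).
apply: (@le_trans _ _ (L (ftest (c / 3) (c - 2 * h j) (h j)) + e / 2)); last by lra.
apply: (@le_trans _ _ (\sum_(n < (y M).+1) w M n *
      (z M n * ftest (c / 3) (c - 2 * h j) (h j) (z M n)))).
  apply: ler_sum => n _; rewrite ler_wpM2l// ftestE ?divr_gt0//; last first.
    by have := hc j; lra.
  rewrite ramp_eq1 ?mulr1//.
  have yn : (n <= y M)%N by rewrite -ltnS.
  have := zle M n (y M) M0 yn; lra.
move: ((y M).+1); near: M.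
apply: (@upper_functional (ftest (c / 3) (c - 2 * h j) (h j)) (e / 2)) => //.
by move=> x; exact: ftest_ge0.
Unshelve. all: by end_near. Qed.

End Karamata.

(** * Asymptotics of the discount factor and of the decay rate *)

Section WalkAsymptotics.
Variable R : realType.

Lemma cvg_near_eqn (f g : nat -> R) (F : set_system R) :
  (\forall M \near \oo, f M = g M) -> f M @[M --> \oo] --> F -> g M @[M --> \oo] --> F.
Proof. by move=> fg; apply: cvg_trans; apply: near_eq_cvg; exact: fg. Qed.

Definition disc (k M : nat) : R := expR (- (k%:R / M%:R)).

(** The smaller root of [r * (rho ^+ 2 + 1) = 2 * rho], so that its powers stay bounded. *)
Definition decay (r : R) : R := (1 - Num.sqrt (1 - r ^+ 2)) / r.

Lemma disc_gt0 k M : 0 < disc k M. Proof. exact: expR_gt0. Qed.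

Lemma disc_lt1 k M : (0 < k)%N -> (0 < M)%N -> disc k M < 1.
Proof. by move=> k0 M0; rewrite /disc -[ltRHS]expR0 ltr_expR oppr_lt0 divr_gt0 ?ltr0n. Qed.

Lemma disc_le1 k M : disc k M <= 1.
Proof. by rewrite /disc -[leRHS]expR0 ler_expR oppr_le0 divr_ge0. Qed.

Lemma discX k M n : expR (- (n%:R / M%:R)) ^+ k = disc k M ^+ n.
Proof. by rewrite /disc -!expRM_natl; congr expR; ring. Qed.

Lemma decay_spec r : 0 < r < 1 ->
  [/\ 0 < decay r, decay r <= 1 & r * (decay r ^+ 2 + 1) = 2 * decay r].
Proof.
move=> /andP[r0 r1].
have r21 : 0 <= 1 - r ^+ 2 by rewrite subr_ge0 expr_le1// ltW.
set q := Num.sqrt (1 - r ^+ 2).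
have qq : q ^+ 2 = 1 - r ^+ 2 by rewrite sqr_sqrtr.
have q0 : 0 <= q by exact: sqrtr_ge0.
have q1 : q < 1 by rewrite -(@ltr_pXn2r _ 2)// ?nnegrE// qq expr1n; nra.
split.
- by rewrite divr_gt0// subr_gt0.
- by rewrite /decay -/q ler_pdivrMr// mul1r; nra.
- rewrite /decay -/q; have -> : ((1 - q) / r) ^+ 2 + 1 = 2 * ((1 - q) / r) / r.
    have -> : ((1 - q) / r) ^+ 2 + 1 = (1 - 2 * q + q ^+ 2 + r ^+ 2) / r ^+ 2.
      by field; rewrite gt_eqF.
    by rewrite qq; field; rewrite gt_eqF.
  by field; rewrite gt_eqF.
Qed.

Lemma cvg_natr_div (c : R) : c / n%:R @[n --> \oo] --> (0 : R).
Proof.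
rewrite -(mulr0 c); apply: cvgMr; apply/gtr0_cvgV0; last exact: cvgr_idn.
by exists 1%N => // n; rewrite /= ltr0n.
Qed.

Lemma cvg_disc k : disc k M @[M --> \oo] --> (1 : R).
Proof.
rewrite -expR0 -oppr0.
exact: cvg_comp (cvgN (cvg_natr_div k%:R)) (@continuous_expR R (- 0)).
Qed.

(** The inequality [1 + x <= exp x], at [- k / M] and at [k / M], gives the two sides of the
    squeeze. *)
Lemma cvg_disc_rate k : M%:R * (1 - disc k M) @[M --> \oo] --> (k%:R : R).
Proof.
apply: (@squeeze_cvgr _ _ _ _ (fun M => k%:R / (1 + k%:R / M%:R)) (fun=> k%:R)).
- near=> M; have M0 : (0 : R) < M%:R by rewrite ltr0n; near: M; exists 1%N.
  have kM : 0 <= k%:R / M%:R :> R by rewrite divr_ge0.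
  apply/andP; split; last first.
    rewrite mulrC -ler_pdivlMr// lerBlDr -lerBlDl.
    exact: expR_ge1Dx.
  have h : disc k M <= (1 + k%:R / M%:R)^-1.
    by rewrite /disc expRN lef_pV2 ?posrE ?expR_gt0 ?ltr_pwDl// expR_ge1Dx.
  rewrite [leRHS]mulrC -ler_pdivrMr// lerBrDr -lerBrDl (le_trans h)//.
  rewrite le_eqVlt; apply/orP; left; apply/eqP; field.
  by rewrite gt_eqF//= gt_eqF// addrC ltr_wpDl.
- suff : k%:R / (1 + k%:R / M%:R) @[M --> \oo] --> (k%:R / (1 + 0) : R) by rewrite addr0 divr1.
  apply: cvgM; first exact: cvg_cst.
  apply: cvgV; first by rewrite addr0 oner_neq0.
  by apply: cvgD; [exact: cvg_cst|exact: cvg_natr_div].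
- exact: cvg_cst.
Unshelve. all: by end_near. Qed.

Lemma cvg_sqrt_natV : (Num.sqrt M%:R)^-1 @[M --> \oo] --> (0 : R).
Proof.
rewrite -(sqrtr0 R) .
have -> : (fun M => (Num.sqrt M%:R)^-1) = (fun M => Num.sqrt (1 / M%:R)) :> (nat -> R).
  by apply/funext => M; rewrite mul1r sqrtrV.
exact: cvg_comp (cvg_natr_div 1) (@sqrt_continuous R 0).
Qed.

Lemma sqrt_mulV M : (0 < M)%N -> Num.sqrt (M%:R : R) = M%:R * (Num.sqrt M%:R)^-1.
Proof.
move=> M0; have h : Num.sqrt (M%:R : R) != 0 by rewrite sqrtr_eq0 -ltNge ltr0n.
by rewrite -{2}(@sqr_sqrtr _ M%:R)// expr2 mulfK.
Qed.

(** [1 - decay r = (sqrt (1 - r^2) - (1 - r)) / r]. The root is of order [M^(-1/2)], with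
    [disc k M ^+ 2 = disc (2 * k) M] supplying its constant, while [1 - r] is of order [1 / M]. *)
Lemma cvg_decay_rate k : (0 < k)%N ->
  Num.sqrt M%:R * (1 - decay (disc k M)) @[M --> \oo] --> Num.sqrt (2 * k%:R : R).
Proof.
move=> k0.
have h1 : Num.sqrt M%:R * (1 - disc k M) @[M --> \oo] --> (0 : R).
  rewrite -(mulr0 (k%:R)).
  apply: (cvg_near_eqn _ (cvgM (@cvg_disc_rate k) cvg_sqrt_natV)).
  near=> M; have M0 : (0 < M)%N by near: M; exists 1%N.
  by rewrite /= [in RHS](sqrt_mulV M0) mulrAC.
have h2 : Num.sqrt M%:R * Num.sqrt (1 - disc k M ^+ 2) @[M --> \oo] --> Num.sqrt (2 * k%:R : R).
  under eq_fun do rewrite -sqrtrM//.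
  have dE M : disc k M ^+ 2 = disc (2 * k) M.
    by rewrite /disc -expRM_natl; congr expR; rewrite natrM; ring.
  under eq_fun do rewrite dE.
  by have := cvg_comp _ _ (@cvg_disc_rate (2 * k)) (@sqrt_continuous R _); rewrite natrM; apply.
rewrite -[X in _ --> X](subr0 (Num.sqrt (2 * k%:R))) -[X in _ --> X]mulr1 -[X in _ * X]invr1.
apply: (cvg_near_eqn _ (cvgM (cvgB h2 h1) (cvgV (@oner_neq0 R) (@cvg_disc k)))); near=> M.
rewrite /decay !fctE /=; field.
by rewrite gt_eqF// disc_gt0.
Unshelve. all: by end_near. Qed.

Let lrate k M := Num.sqrt M%:R * - ln (decay (disc k M)).

Lemma cvg_decay k : (0 < k)%N -> decay (disc k M) @[M --> \oo] --> (1 : R).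
Proof.
move=> k0; rewrite -(subr0 (1 : R)) -[X in _ - X](mulr0 (Num.sqrt (2 * k%:R))).
apply: (cvg_near_eqn _ (cvgB (cvg_cst (1:R)) (cvgM (cvg_decay_rate k0) cvg_sqrt_natV))); near=> M.
have M0 : (0 < M)%N by near: M; exists 1%N.
have h : Num.sqrt (M%:R : R) != 0 by rewrite sqrtr_eq0 -ltNge ltr0n.
by rewrite !fctE /= mulrAC divff// mul1r opprB addrC subrK.
Unshelve. all: by end_near. Qed.

(** Squeeze by [1 - rho <= - ln rho <= 1 / rho - 1]. The logarithm is what turns [rho ^+ x] into an
    exponential of [x / sqrt M]. *)
Lemma cvg_lrate k : (0 < k)%N -> lrate k M @[M --> \oo] --> Num.sqrt (2 * k%:R : R).
Proof.
move=> k0.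
apply: (@squeeze_cvgr _ _ _ _ (fun M => Num.sqrt M%:R * (1 - decay (disc k M)))
  (fun M => Num.sqrt M%:R * (1 - decay (disc k M)) / decay (disc k M))).
- near=> M; have M0 : (0 < M)%N by near: M; exists 1%N.
  have [d0 d1 _] : [/\ 0 < decay (disc k M), decay (disc k M) <= 1 &
      disc k M * (decay (disc k M) ^+ 2 + 1) = 2 * decay (disc k M)].
    by apply: decay_spec; rewrite disc_gt0 disc_lt1.
  rewrite /lrate -mulrA; apply/andP; split; rewrite ler_wpM2l ?sqrtr_ge0//.
    have := @le_ln1Dx R (decay (disc k M) - 1); rewrite [1 + _]addrC subrK => h.
    by rewrite lerNr opprB h//; lra.
  have := @le_ln1Dx R ((decay (disc k M))^-1 - 1); rewrite [1 + _]addrC subrK lnV ?posrE// => h.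
  rewrite mulrBl mul1r divff ?gt_eqF//; apply: h.
  by rewrite ltrBrDl subrr invr_gt0.
- exact: cvg_decay_rate.
- rewrite -[X in _ --> X]divr1; apply: cvgM; first exact: cvg_decay_rate.
  by apply: cvgV; [exact: oner_neq0|exact: cvg_decay].
Unshelve. all: by end_near. Qed.

Lemma decay_expn k M j : (0 < k)%N -> (0 < M)%N ->
  decay (disc k M) ^+ j = expR (- (j%:R / Num.sqrt M%:R * lrate k M)).
Proof.
move=> k0 M0; have [d0 _ _] : [/\ 0 < decay (disc k M), decay (disc k M) <= 1 &
      disc k M * (decay (disc k M) ^+ 2 + 1) = 2 * decay (disc k M)].
  by apply: decay_spec; rewrite disc_gt0 disc_lt1.
have h : Num.sqrt (M%:R : R) != 0 by rewrite sqrtr_eq0 -ltNge ltr0n.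
rewrite -{1}(@lnK _ (decay _)) ?posrE// -expRM_natl; congr expR.
by rewrite /lrate mulrN mulrN opprK mulrA divfK.
Qed.

Lemma cvg_decay_expn k (X : nat -> nat) (b : R) : (0 < k)%N ->
  (X M)%:R / Num.sqrt M%:R @[M --> \oo] --> b ->
  decay (disc k M) ^+ X M @[M --> \oo] --> expR (- (b * Num.sqrt (2 * k%:R))).
Proof.
move=> k0 Xb.
apply: (cvg_near_eqn _ (cvg_comp _ _ (cvgN (cvgM Xb (cvg_lrate k0))) (@continuous_expR R _))).
near=> M.
by rewrite decay_expn//; near: M; exists 1%N.
Unshelve. all: by end_near. Qed.

Lemma cvg_decay_expny k (X : nat -> nat) : (0 < k)%N ->
  ((X M)%:R / Num.sqrt M%:R : R) @[M --> \oo] --> +oo%R ->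
  decay (disc k M) ^+ X M @[M --> \oo] --> (0 : R).
Proof.
move=> k0 Xy.
have s0 : 0 < Num.sqrt (2 * k%:R : R) by rewrite sqrtr_gt0 mulr_gt0// ltr0n.
have h : (X M)%:R / Num.sqrt M%:R * lrate k M @[M --> \oo] --> +oo%R.
  have s20 : 0 < Num.sqrt (2 * k%:R : R) / 2 by rewrite divr_gt0.
  apply/cvgryPge => A; near=> M.
  have hX : `|A| / (Num.sqrt (2 * k%:R) / 2) <= (X M)%:R / Num.sqrt M%:R.
    by near: M; move/cvgryPge : Xy; exact.
  have hL : Num.sqrt (2 * k%:R) / 2 <= lrate k M.
    near: M; move/cvgrPdist_le : (cvg_lrate k0) => /(_ _ s20); apply: filterS => M.
    by rewrite ler_distlC => /andP[+ _] => hM; lra.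
  apply: (le_trans (ler_norm A)); rewrite -(divfK (lt0r_neq0 s20) `|A|).
  by apply: ler_pM => //; exact: divr_ge0 (normr_ge0 _) (ltW s20).
have h2 : expR (- ((X M)%:R / Num.sqrt M%:R * lrate k M)) @[M --> \oo] --> (0 : R).
  exact: (cvg_comp _ (fun x => expR (- x)) h (@cvgr_expR R)).
apply: (cvg_near_eqn _ h2); near=> M.
by rewrite decay_expn//; near: M; exists 1%N.
Unshelve. all: by end_near. Qed.

(** * Limit of the Laplace transform of the hitting time of the boundary *)

Section Harmonic.
Variables (N : nat -> enat) (x : nat -> nat) (k : nat).
Hypothesis k0 : (0 < k)%N.
Hypothesis hN : forall M, (0 < M)%N -> if N M is Some n then (2 <= n)%N else true.
Hypothesis hx : forall M, (0 < M)%N -> site (N M) (x M).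
Hypothesis lim_N : (if N M is Some n then M%:R / n%:R ^+ 2 else 0) @[M --> \oo] --> (0 : R).

Let rho M := decay (disc k M).
Let rhoN M : R := if N M is Some n then rho M ^+ n else 0.

Let rho01 M : (0 < M)%N -> 0 < rho M <= 1.
Proof.
move=> M0; have d01 : 0 < disc k M < 1 by rewrite disc_gt0 disc_lt1.
by have [r0 r1 _] := decay_spec d01; rewrite /rho r0 r1.
Qed.

Let rhoN_ge0 M : (0 < M)%N -> 0 <= rhoN M.
Proof.
move=> /rho01/andP[r0 _]; rewrite /rhoN; case: (N M) => // n.
by rewrite exprn_ge0// ltW.
Qed.

(** [rho ^+ n] is [exp (- t)] with [t] of order [n / sqrt M], and [exp (- t) <= 1 / t] bounds it by
    a multiple of [sqrt (M / n^2)]. *)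
Let cvg_rhoN : rhoN M @[M --> \oo] --> (0 : R).
Proof.
have s0 : 0 < Num.sqrt (2 * k%:R : R) by rewrite sqrtr_gt0 mulr_gt0// ltr0n.
have s20 : 0 < Num.sqrt (2 * k%:R : R) / 2 by rewrite divr_gt0.
pose e M : R := if N M is Some n then M%:R / n%:R ^+ 2 else 0.
apply: (@squeeze_cvgr _ _ _ _ (fun=> 0) (fun M => Num.sqrt (e M) / (Num.sqrt (2 * k%:R) / 2))).
- near=> M; have M0 : (0 < M)%N by near: M; exists 1%N.
  rewrite rhoN_ge0//=; have hL : Num.sqrt (2 * k%:R) / 2 <= lrate k M.
    near: M; move/cvgrPdist_le : (cvg_lrate k0) => /(_ _ s20); apply: filterS => M.
    by rewrite ler_distlC => /andP[+ _] => hM; lra.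
  have := hN M0; rewrite /rhoN /e; case: (N M) => [n n2|_]; last first.
    by rewrite divr_ge0 ?sqrtr_ge0// ltW.
  have n0 : (0 : R) < n%:R by rewrite ltr0n; lia.
  have M0' : (0 : R) < Num.sqrt M%:R by rewrite sqrtr_gt0 ltr0n.
  rewrite /rho decay_expn// [Num.sqrt (M%:R / _)]sqrtrM// sqrtrV ?sqr_ge0// sqrtr_sqr ger0_norm//.
  have t0 : 0 < n%:R / Num.sqrt M%:R * (Num.sqrt (2 * k%:R) / 2) :> R.
    by rewrite mulr_gt0// divr_gt0.
  apply: (@le_trans _ _ (n%:R / Num.sqrt M%:R * (Num.sqrt (2 * k%:R) / 2) : R)^-1); last first.
    rewrite le_eqVlt; apply/orP; left; apply/eqP; field.
    by rewrite !gt_eqF.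
  rewrite expRN lef_pV2 ?posrE ?expR_gt0//.
  apply: (@le_trans _ _ (n%:R / Num.sqrt M%:R * lrate k M : R)).
    by rewrite ler_wpM2l// divr_ge0// ltW.
  by apply: le_trans (expR_ge1Dx _); rewrite lerDr.
- exact: cvg_cst.
- rewrite -(mul0r (Num.sqrt (2 * k%:R) / 2)^-1) -{1}(sqrtr0 R).
  by apply: cvgMl; exact: cvg_comp lim_N (@sqrt_continuous R 0).
Unshelve. all: by end_near. Qed.

Lemma cvg_harmonic1 :
  Num.sqrt M%:R * (1 - harmonic (N M) (rho M) 1) @[M --> \oo] --> Num.sqrt (2 * k%:R : R).
Proof.
have hr := cvg_decay k0; have hs := cvg_decay_rate k0.
apply: (@squeeze_cvgr _ _ _ _
  (fun M => Num.sqrt M%:R * (1 - rho M) * ((1 - rhoN M / rho M) / (1 + rhoN M)))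
  (fun M => Num.sqrt M%:R * (1 - rho M))) => //.
- near=> M; have M0 : (0 < M)%N by near: M; exists 1%N.
  have /andP[r0 r1] := rho01 M0; have s0 := rhoN_ge0 M0.
  have := hN M0; move: s0; rewrite /rhoN /harmonic; case: (N M) => [n|].
    move=> s0 n2.
    have n1 : rho M ^+ n = rho M * rho M ^+ (n - 1) by rewrite -exprS; congr (_ ^+ _); lia.
    have q0 : 0 <= rho M ^+ (n - 1) by rewrite exprn_ge0// ltW.
    have s1 : 1 + rho M ^+ n != 0 by rewrite gt_eqF// ltr_pwDl.
    (* The factor [1 - rho] carries the whole rate; the remaining quotient tends to 1 because the
       power over the full length of the interval vanishes. *)
    have -> : 1 - (rho M ^+ 1 + rho M ^+ (n - 1)) / (1 + rho M ^+ n) =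
      (1 - rho M) * ((1 - rho M ^+ (n - 1)) / (1 + rho M ^+ n)).
      by move: s1; rewrite n1 expr1 => s1; field.
    have -> : rho M ^+ n / rho M = rho M ^+ (n - 1) by rewrite n1 mulrC mulKf// gt_eqF.
    rewrite [X in _ <= X <= _]mulrA lexx/= ler_piMr ?mulr_ge0 ?sqrtr_ge0 ?subr_ge0//.
    rewrite ler_pdivrMr ?ltr_pwDl//; lra.
  by move=> _ _; rewrite mul0r subr0 addr0 divr1 mulr1 expr1 lexx.
- rewrite -[X in _ --> X](mulr1); apply: cvgM => //.
  suff : (1 - rhoN M / rho M) / (1 + rhoN M) @[M --> \oo] --> ((1 - 0 / 1) / (1 + 0) : R).
    by rewrite mul0r subr0 addr0 divr1.
  apply: cvgM; last first.
    apply: cvgV; first by rewrite addr0 oner_neq0.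
    by apply: cvgD => //; exact: cvg_cst.
  apply: cvgB; first exact: cvg_cst.
  by apply: cvgM => //; apply: cvgV => //; exact: oner_neq0.
Unshelve. all: by end_near. Qed.

Let m M := if N M is Some n then minn (x M) (n - x M) else x M.

(** The nearer end dominates: the distance to the other one is at least [n / 2], so its power is at
    most [sqrt (rho ^+ n)], which tends to 0. *)
Let cvg_harmonic_of l : rho M ^+ m M @[M --> \oo] --> (l : R) ->
  harmonic (N M) (rho M) (x M) @[M --> \oo] --> l.
Proof.
move=> hl.
apply: (@squeeze_cvgr _ _ _ _ (fun M => rho M ^+ m M / (1 + rhoN M))
  (fun M => rho M ^+ m M + Num.sqrt (rhoN M))).
- near=> M; have M0 : (0 < M)%N by near: M; exists 1%N.
  have /andP[r0 r1] := rho01 M0; have s0 := rhoN_ge0 M0.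
  have := hx M0; move: s0; rewrite /rhoN /harmonic /m; case: (N M) => [n s0 /= xn|_ _]; last first.
    by rewrite addr0 divr1 lexx sqrtr0 addr0 lexx.
  have -> : rho M ^+ x M + rho M ^+ (n - x M) =
    rho M ^+ minn (x M) (n - x M) + rho M ^+ (n - minn (x M) (n - x M)).
    case: (leqP (x M) (n - x M)) => h; first by [].
    by rewrite addrC; congr (_ + _ ^+ _); lia.
  have mn : (2 * minn (x M) (n - x M) <= n)%N by lia.
  move: (minn _ _) mn => j jn.
  have a0 : 0 <= rho M ^+ j by rewrite exprn_ge0// ltW.
  have b0 : 0 <= rho M ^+ (n - j) by rewrite exprn_ge0// ltW.
  have d1 : 1 <= 1 + rho M ^+ n by rewrite lerDl.
  have d0 : 0 < 1 + rho M ^+ n by apply: lt_le_trans d1.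
  rewrite ler_pM2r ?invr_gt0// lerDl b0/=.
  apply: (@le_trans _ _ (rho M ^+ j + rho M ^+ (n - j))).
    by rewrite ler_pdivrMr// ler_peMr// addr_ge0.
  rewrite lerD2l -(@ger0_norm _ (rho M ^+ (n - j)))// -sqrtr_sqr ler_sqrt//.
  by rewrite -exprM ler_wiXn2l// ?ltW//; lia.
- suff : rho M ^+ m M / (1 + rhoN M) @[M --> \oo] --> (l / (1 + 0) : R) by rewrite addr0 divr1.
  apply: cvgM => //.
  apply: cvgV; first by rewrite addr0 oner_neq0.
  by apply: cvgD => //; exact: cvg_cst.
- rewrite -[X in _ --> X]addr0; apply: cvgD => //.
  by rewrite -{1}(sqrtr0 R); exact: cvg_comp cvg_rhoN (@sqrt_continuous R 0).
Unshelve. all: by end_near. Qed.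

Lemma cvg_harmonic_fin (a : R) : (m M)%:R ^+ 2 / M%:R @[M --> \oo] --> a ->
  harmonic (N M) (rho M) (x M) @[M --> \oo] --> expR (- (Num.sqrt (2 * k%:R * a))).
Proof.
move=> ma; apply: cvg_harmonic_of.
rewrite mulrC sqrtrM.
  apply: cvg_decay_expn => //.
  have -> : (fun M => (m M)%:R / Num.sqrt M%:R) = (fun M => Num.sqrt ((m M)%:R ^+ 2 / M%:R)) :> (nat -> R).
    by apply/funext => M; rewrite sqrtrM ?sqr_ge0// sqrtr_sqr ger0_norm// sqrtrV.
  exact: cvg_comp ma (@sqrt_continuous R a).
have : (\forall M \near \oo, 0 <= (m M)%:R ^+ 2 / M%:R :> R).
  by apply: nearW => M; rewrite divr_ge0// sqr_ge0.
by move=> h; rewrite -(cvg_lim _ ma)//; apply: limr_ge => //; apply/cvg_ex; exists a.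
Qed.

Lemma cvg_harmonic_y : ((m M)%:R ^+ 2 / M%:R : R) @[M --> \oo] --> +oo%R ->
  harmonic (N M) (rho M) (x M) @[M --> \oo] --> (0 : R).
Proof.
move=> ma; apply: cvg_harmonic_of; apply: cvg_decay_expny => //.
apply/cvgryPge => A; move/cvgryPge : ma => /(_ (A ^+ 2)); apply: filterS => M.
rewrite -ler_sqrt ?divr_ge0 ?sqr_ge0// sqrtr_sqr => /(le_trans (ler_norm _)).
by rewrite sqrtrM ?sqr_ge0// sqrtr_sqr ger0_norm// sqrtrV.
Qed.

End Harmonic.

End WalkAsymptotics.

(** * Fundamental theorem of calculus up to a singular left endpoint *)

Section FTCopen.
Variable R : realType.
Notation mu := (@lebesgue_measure R).
Variables (f F : R -> R) (l : R).
Hypothesis f0 : forall x : R, 0 < x -> 0 <= f x.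
Hypothesis cf : forall x : R, 0 < x -> {for x, continuous f}.
Hypothesis dF : forall x : R, 0 < x -> is_derive x 1 F (f x).
Hypothesis F0 : F x @[x --> 0^'+] --> l.

Let mf : measurable_fun (`]0%R, +oo[%classic : set R) f.
Proof.
apply: open_continuous_measurable_fun => // x; rewrite inE/= in_itv/= andbT.
exact: cf.
Qed.

(** The integrand need not be continuous at 0, so []0, b]] is exhausted by the segments
    [[b / (n + 2), b]] and nonnegativity gives monotone convergence. *)
Lemma FTC_oc b : 0 < b -> (\int[mu]_(x in `]0%R, b]) (f x)%:E = (F b - l)%:E)%E.
Proof.
move=> b0; pose a n : R := b / n.+2%:R.
have a0 n : 0 < a n by rewrite divr_gt0.
have ab n : a n < b by rewrite ltr_pdivrMr// ltr_pMr// ltr1n.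
have acvg : a n @[n --> \oo] --> (0 : R).
  have := @cvg_natr_div R b; rewrite -(cvg_shiftn 2).
  by under eq_fun do rewrite addn2.
have FE n : (\int[mu]_(x in `[a n, b]) (f x)%:E = (F b - F (a n))%:E)%E.
  rewrite EFinB; apply: continuous_FTC2 => //.
  - apply: continuous_in_subspaceT => x; rewrite inE/= in_itv/= => /andP[ax _].
    by apply: cf; apply: lt_le_trans ax.
  - have cF x : 0 < x -> {for x, continuous F}.
      move=> x0; apply: differentiable_continuous; apply/derivable1_diffP.
      by have [] := dF x0.
    split.
    + move=> x; rewrite in_itv/= => /andP[ax _].
      by have [] := dF (lt_trans (a0 n) ax).
    + by apply: cvg_at_right_filter; exact: cF.
    + by apply: cvg_at_left_filter; exact: cF.
  - move=> x; rewrite in_itv/= => /andP[ax _].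
    by rewrite derive1E; have [_ ->] := dF (lt_trans (a0 n) ax).
have UE : \bigcup_n [set` `[a n, b]] = [set` `]0, b]].
  apply/seteqP; split => x /=.
    by move=> [n _] /=; rewrite !in_itv/= => /andP[ax ->]; rewrite (lt_le_trans (a0 n)).
  rewrite in_itv/= => /andP[x0 xb].
  near \oo => n; exists n => //=; rewrite in_itv/= xb andbT; near: n.
  move/cvgrPdist_le : acvg => /(_ x x0); apply: filterS => n.
  by rewrite sub0r normrN ger0_norm// ltW.
have lim1 : (\int[mu]_(x in `[a n, b]) (f x)%:E @[n --> \oo] -->
    \int[mu]_(x in `]0%R, b]) (f x)%:E)%E.
  rewrite -UE; apply: ge0_nondecreasing_set_cvg_integral => //.
  - move=> m n mn; apply/subsetPset => x /=; rewrite !in_itv/= => /andP[ax ->].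
    rewrite andbT (le_trans _ ax)// ler_pM2l// lef_pV2 ?posrE ?ltr0n// ler_nat; lia.
  - move=> n; apply/measurable_EFinP; apply: measurable_funS mf => // x /=.
    by rewrite !in_itv/= andbT => /andP[ax _]; apply: lt_le_trans ax.
  - move=> n x /=; rewrite in_itv/= lee_fin => /andP[ax _].
    by apply: f0; apply: lt_le_trans ax.
have lim2 : (\int[mu]_(x in `[a n, b]) (f x)%:E @[n --> \oo] --> (F b - l)%:E)%E.
  under eq_fun do rewrite FE.
  apply: cvg_EFin; first exact: nearW.
  apply: cvgB; first exact: cvg_cst.
  by move/cvg_at_rightP : F0; apply; split.
by apply: (cvg_unique _ lim1 lim2); exact: ereal_hausdorff.
Unshelve. all: by end_near. Qed.

Lemma FTC_oy L : F x @[x --> +oo%R] --> L ->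
  (\int[mu]_(x in `]0%R, +oo[) (f x)%:E = (L - l)%:E)%E.
Proof.
move=> FL.
have UE : \bigcup_n [set` `]0, (n.+1%:R : R)]] = [set` `]0, +oo[].
  apply/seteqP; split => x /=; first by move=> [n _] /=; rewrite !in_itv/= => /andP[->].
  rewrite in_itv/= andbT => x0; exists (Num.truncn x) => //=.
  by rewrite in_itv/= x0 ltW// truncnS_gt.
have lim1 : (\int[mu]_(x in `]0%R, n.+1%:R]) (f x)%:E @[n --> \oo] -->
    \int[mu]_(x in `]0%R, +oo[) (f x)%:E)%E.
  rewrite -UE; apply: ge0_nondecreasing_set_cvg_integral => //.
  - move=> m n mn; apply/subsetPset => x /=; rewrite !in_itv/= => /andP[-> xm].
    by rewrite (le_trans xm)// ler_nat.
  - move=> n; apply/measurable_EFinP; apply: measurable_funS mf => // x /=.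
    by rewrite !in_itv/= andbT => /andP[].
  - by move=> n x /=; rewrite in_itv/= lee_fin => /andP[ax _]; exact: f0.
have lim2 : (\int[mu]_(x in `]0%R, n.+1%:R]) (f x)%:E @[n --> \oo] --> (L - l)%:E)%E.
  under eq_fun do rewrite FTC_oc//.
  apply: cvg_EFin; first exact: nearW.
  apply: cvgB; last exact: cvg_cst.
  have : (n.+1%:R : R) @[n --> \oo] --> +oo%R.
    by have := @cvgr_idn R; rewrite -(cvg_shiftS (fun n => n%:R : R)).
  by move=> h; exact: (cvg_comp _ _ h FL).
by apply: (cvg_unique _ lim1 lim2); exact: ereal_hausdorff.
Qed.

End FTCopen.

(** * Derivative and limits of the Gaussian tail *)

Section NormalTail.
Variable R : realType.
Notation mu := (@lebesgue_measure R).

Let phi : R -> R := normal_pdf 0 1.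

Lemma normal_pdf01E x : phi x = (Num.sqrt (2 * pi))^-1 * expR (- (x ^+ 2 / 2)).
Proof.
rewrite /phi normal_pdfE ?oner_neq0// /normal_peak /normal_fun expr1n mul1r subr0.
by rewrite mulr_natl mulNr.
Qed.

(** The identity regarded as a random variable under the normal law, which makes [Phibar] a
    complementary distribution function. *)
Let idR : measurableTypeR R -> R := idfun.

HB.instance Definition _ :=
  @isMeasurableFun.Build _ _ _ _ idR (@measurable_id _ _ setT).

Let normal_ccdf x : ccdf (idR : {RV (normal_prob 0 1) >-> R}) x = (Phibar x)%:E.
Proof. by rewrite /Phibar fineK// fin_num_measure. Qed.

Lemma PhibarE x : Phibar x = 1 - \int[mu]_(t in `]-oo, x]) phi t.
Proof.
apply: EFin_inj; rewrite -normal_ccdf ccdf_1_cdf EFinB; congr (_ - _)%E.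
rewrite /Rintegral fineK// /cdf /distribution.
exact: (@fin_num_measure _ _ _ (normal_prob 0 1)).
Qed.

Lemma is_derive_Phibar (x : R) : is_derive x 1 (@Phibar R) (- phi x).
Proof.
have [d1 d2] : derivable (fun x : R => \int[mu]_(t in `]-oo, x]) phi t) x 1 /\
    derive1 (fun x : R => \int[mu]_(t in `]-oo, x]) phi t) x = phi x.
  apply: (@continuous_FTC1 _ phi -oo%O x (x + 1)); rewrite ?ltrDl//.
    apply: (@integrableS _ _ _ _ setT) => //.
    exact: integrable_normal_pdf.
    by rewrite ltNyr.
  exact: (@continuous_normal_pdf R 0 1 (oner_neq0 R) x).
have -> : @Phibar R = (fun x => 1 - \int[mu]_(t in `]-oo, x]) phi t).
  by apply/funext => y; exact: PhibarE.
rewrite -[- phi x]sub0r; apply: is_deriveB; split; [exact: d1|by rewrite -derive1E].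
Qed.

Lemma cvg_Phibary : Phibar x @[x --> +oo%R] --> (0 : R).
Proof.
have := cvg_ccdfy0 (idR : {RV (normal_prob 0 1) >-> R}).
by rewrite (funext normal_ccdf : ccdf _ = _) => /fine_cvg.
Qed.

Lemma cvg_PhibarNy : Phibar x @[x --> -oo%R] --> (1 : R).
Proof.
have := cvg_ccdfNy1 (idR : {RV (normal_prob 0 1) >-> R}).
by rewrite (funext normal_ccdf : ccdf _ = _) => /fine_cvg.
Qed.

End NormalTail.

(** * Laplace transform and truncated moments of the Levy density *)

Section LevyIntegrals.
Variable R : realType.
Notation mu := (@lebesgue_measure R).

(* The Levy density tilted by [exp (- b^2 t / 2)]: up to the factor [exp b],
   the first passage density of a Brownian motion with drift [b]. *)
Definition tilted_levy (b t : R) : R := levy_pdf t * expR (- (b ^+ 2 * t / 2)).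

Let h (b t : R) : R := (1 - b * t) / Num.sqrt t.
(** Up to the factor [exp (- b)], the inverse Gaussian distribution function, that is, the law of
    the first passage to 1 of a Brownian motion with drift [b]. It is the antiderivative of
    [tilted_levy b] that vanishes at 0. *)
Let A (b t : R) : R := expR (- b) * Phibar (h b t) + expR b * Phibar (h (- b) t).

Lemma levy_pdfE (t : R) : 0 < t -> levy_pdf t =
  (Num.sqrt (2 * pi))^-1 * (t * Num.sqrt t)^-1 * expR (- (2 * t)^-1).
Proof.
move=> t0; rewrite /levy_pdf t0 sqrtrM ?mulr_ge0 ?pi_ge0// -invfM; congr ((_ * _)^-1 * _).
by rewrite exprS sqrtrM ?(ltW t0)// sqrtr_sqr (ger0_norm (ltW t0)) mulrC.
Qed.

Let is_derive_h (b x : R) : 0 < x ->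
  is_derive x 1 (h b) (- (1 + b * x) / (2 * (x * Num.sqrt x))).
Proof.
move=> x0; have s0 : 0 < Num.sqrt x by rewrite sqrtr_gt0.
have ds : is_derive x 1 Num.sqrt (2 * Num.sqrt x)^-1 by exact: is_derive1_sqrt.
have dV := is_deriveV (lt0r_neq0 s0) ds.
have dn : is_derive x 1 (fun t : R => 1 - b * t) (- b).
  rewrite -[- b]sub0r; apply: is_deriveB.
  by have := is_deriveZ b (is_derive_id x (1 : R)); rewrite /GRing.scale /= mulr1.
apply: (is_derive_eq (is_deriveM dn dV)); rewrite /GRing.scale /=.
have xx : x = Num.sqrt x ^+ 2 by rewrite sqr_sqrtr// ltW.
move: s0 xx; move: (Num.sqrt x) => s s0 ->.
by field; rewrite gt_eqF.
Qed.

(** Completing the square: [(1 - b x)^2 / (2 x) = 1 / (2 x) - b + b^2 x / 2], and the prefactor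
    [exp (- b)] removes the middle term. The result is even in [b], which lets the two halves of [A]
    combine. *)
Let phi_h (b x : R) : 0 < x -> expR (- b) * normal_pdf 0 1 (h b x) =
  (Num.sqrt (2 * pi))^-1 * (expR (- (2 * x)^-1) * expR (- (b ^+ 2 * x / 2))).
Proof.
move=> x0; rewrite normal_pdf01E mulrCA -!expRD; congr (_ * expR _).
rewrite /h expr_div_n sqr_sqrtr ?ltW//; field.
by rewrite gt_eqF.
Qed.

Let is_derive_A (b x : R) : 0 < x -> is_derive x 1 (A b) (tilted_levy b x).
Proof.
move=> x0; have s0 : 0 < Num.sqrt x by rewrite sqrtr_gt0.
have d1 := is_derive1_comp (is_derive_Phibar (h b x)) (is_derive_h b x0).
have d2 := is_derive1_comp (is_derive_Phibar (h (- b) x)) (is_derive_h (- b) x0).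
apply: (is_derive_eq (is_deriveD (is_deriveZ (expR (- b)) d1) (is_deriveZ (expR b) d2))).
have p1 := phi_h b x0; have p2 := phi_h (- b) x0; rewrite opprK sqrrN in p2.
rewrite /GRing.scale /= !mulNr !mulrN !mulrA p1 p2 /tilted_levy levy_pdfE//.
by field; rewrite !gt_eqF// sqrtr_gt0 mulr_gt0// pi_gt0.
Qed.

Let cvg_sqrt0 : Num.sqrt x @[x --> (0 : R)^'+] --> (0 : R).
Proof. by rewrite -{2}(sqrtr0 R); apply: cvg_at_right_filter; exact: sqrt_continuous. Qed.

Let cvg_h0 b : h b x @[x --> (0 : R)^'+] --> +oo%R.
Proof.
apply/cvgryPge => B; have e0 : 0 < (2 * (`|B| + 1))^-1.
  by rewrite invr_gt0 mulr_gt0// ltr_wpDl.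
have cb : b * x @[x --> (0 : R)^'+] --> (0 : R).
  by have := cvg_at_right_filter (@mulrl_continuous R b 0); rewrite mulr0.
have e20 : (0 : R) < 2^-1 by [].
near=> x.
have x0 : 0 < x by near: x; exact: nbhs_right_gt.
have s0 : 0 < Num.sqrt x by rewrite sqrtr_gt0.
have bx : b * x <= 2^-1.
  near: x; move/cvgrPdist_le : cb => /(_ _ e20); apply: filterS => x.
  by rewrite sub0r normrN => /(le_trans (ler_norm _)).
have sx : Num.sqrt x <= (2 * (`|B| + 1))^-1.
  near: x; move/cvgrPdist_le : cvg_sqrt0 => /(_ _ e0); apply: filterS => x.
  by rewrite sub0r normrN => /(le_trans (ler_norm _)).
rewrite /h ler_pdivlMr//; apply: (@le_trans _ _ (2^-1 : R)); last by lra.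
apply: (@le_trans _ _ ((`|B| + 1) * (2 * (`|B| + 1))^-1 : R)).
  apply: (@le_trans _ _ ((`|B| + 1) * Num.sqrt x)).
    by rewrite ler_pM2r// (le_trans (ler_norm _))// lerDl.
  by rewrite ler_wpM2l// addr_ge0.
by rewrite invfM mulrCA divff ?mulr1// gt_eqF// ltr_wpDl.
Unshelve. all: by end_near. Qed.

Let cvg_hy (b : R) : 0 < b -> h b x @[x --> +oo%R] --> -oo%R.
Proof.
move=> b0; apply/cvgrNyPle => B; near=> x.
have x1 : 1 <= x by near: x; apply: nbhs_pinfty_ge; exact: num_real.
have xB : ((1 + `|B|) / b) ^+ 2 <= x by near: x; apply: nbhs_pinfty_ge; exact: num_real.
have x0 : 0 < x by apply: lt_le_trans x1.
have s1 : 1 <= Num.sqrt x by rewrite -(sqrtr1 R) ler_sqrt.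
have sB : (1 + `|B|) / b <= Num.sqrt x.
  by rewrite -[leLHS]ger0_norm ?divr_ge0 ?addr_ge0 ?(ltW b0)// -sqrtr_sqr ler_sqrt// ltW.
have s0 : 0 < Num.sqrt x by apply: lt_le_trans s1.
rewrite /h ler_pdivrMr//; have xx : x = Num.sqrt x ^+ 2 by rewrite sqr_sqrtr// ltW.
rewrite {1}xx; rewrite ler_pdivrMr// in sB.
have hB : - `|B| <= B by have := ler_norm (- B); rewrite normrN; lra.
have := ler_wpM2r (ltW s0) hB; nra.
Unshelve. all: by end_near. Qed.

Let cvg_hNy (b : R) : 0 < b -> h (- b) x @[x --> +oo%R] --> +oo%R.
Proof.
move=> b0; apply/cvgryPge => B; near=> x.
have x0 : 0 < x by near: x; apply: nbhs_pinfty_gt; exact: num_real.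
have xB : (`|B| / b) ^+ 2 <= x by near: x; apply: nbhs_pinfty_ge; exact: num_real.
have sB : `|B| / b <= Num.sqrt x.
  by rewrite -[leLHS]ger0_norm ?divr_ge0 ?(ltW b0)// -sqrtr_sqr ler_sqrt// ltW.
have s0 : 0 < Num.sqrt x by rewrite sqrtr_gt0.
rewrite /h ler_pdivlMr//; have xx : x = Num.sqrt x ^+ 2 by rewrite sqr_sqrtr// ltW.
rewrite {2}xx; rewrite ler_pdivrMr// in sB.
have := ler_wpM2r (ltW s0) (ler_norm B); nra.
Unshelve. all: by end_near. Qed.

Let cvg_A0 b : A b x @[x --> (0 : R)^'+] --> (0 : R).
Proof.
have H c : Phibar (h c x) @[x --> (0 : R)^'+] --> (0 : R).
  exact: (cvg_comp _ _ (@cvg_h0 c) (@cvg_Phibary R)).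
suff : A b x @[x --> (0 : R)^'+] --> expR (- b) * 0 + expR b * 0 by rewrite !mulr0 addr0.
by apply: cvgD; apply: cvgMr.
Qed.

Let cvg_Ay (b : R) : 0 < b -> A b x @[x --> +oo%R] --> expR (- b).
Proof.
move=> b0.
have H1 : Phibar (h b x) @[x --> +oo%R] --> (1 : R).
  exact: (cvg_comp _ _ (cvg_hy b0) (@cvg_PhibarNy R)).
have H2 : Phibar (h (- b) x) @[x --> +oo%R] --> (0 : R).
  exact: (cvg_comp _ _ (cvg_hNy b0) (@cvg_Phibary R)).
suff : A b x @[x --> +oo%R] --> expR (- b) * 1 + expR b * 0 by rewrite mulr0 addr0 mulr1.
by apply: cvgD; apply: cvgMr.
Qed.

Lemma levy_pdf_ge0 (t : R) : 0 <= levy_pdf t.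
Proof.
by rewrite /levy_pdf; case: ifP => // _; rewrite mulr_ge0 ?expR_ge0// invr_ge0 sqrtr_ge0.
Qed.

Lemma continuous_levy_pdf (x : R) : 0 < x -> {for x, continuous levy_pdf}.
Proof.
move=> x0; have s0 : 0 < Num.sqrt x by rewrite sqrtr_gt0.
have : {for x, continuous (fun t : R =>
    (Num.sqrt (2 * pi))^-1 * (t * Num.sqrt t)^-1 * expR (- (2 * t)^-1))}.
  apply: cvgM.
    apply: cvgM; first exact: cvg_cst.
    apply: cvgV; first by rewrite gt_eqF// mulr_gt0.
    by apply: cvgM; [exact: cvg_id|exact: sqrt_continuous].
  have e : - (2 * t)^-1 @[t --> x] --> - (2 * x)^-1.
    apply: cvgN; apply: cvgV; first by rewrite gt_eqF// mulr_gt0.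
    by apply: cvgM; [exact: cvg_cst|exact: cvg_id].
  exact: (cvg_comp _ _ e (@continuous_expR R _)).
rewrite /prop_for /continuous_at -levy_pdfE//; apply: cvg_trans; apply: near_eq_cvg.
near=> t; rewrite levy_pdfE//; near: t.
exact: lt_nbhsr.
Unshelve. all: by end_near. Qed.

Let continuous_tilted (b x : R) : 0 < x -> {for x, continuous (tilted_levy b)}.
Proof.
move=> x0; apply: cvgM; first exact: continuous_levy_pdf.
have e : - (b ^+ 2 * t / 2) @[t --> x] --> - (b ^+ 2 * x / 2).
  apply: cvgN; apply: cvgM; last exact: cvg_cst.
  by apply: cvgM; [exact: cvg_cst|exact: cvg_id].
exact: (cvg_comp _ _ e (@continuous_expR R _)).
Qed.

Let tilted_ge0 (b x : R) : 0 < x -> 0 <= tilted_levy b x.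
Proof. by move=> _; rewrite mulr_ge0 ?levy_pdf_ge0 ?expR_ge0. Qed.

Lemma levy_laplace (b : R) : 0 < b ->
  (\int[mu]_(t in `]0%R, +oo[) (levy_pdf t * expR (- (b ^+ 2 * t / 2)))%:E =
   (expR (- b))%:E)%E.
Proof.
move=> b0; rewrite -[expR (- b)]subr0.
exact: (FTC_oy (@tilted_ge0 b) (@continuous_tilted b) (@is_derive_A b) (@cvg_A0 b) (cvg_Ay b0)).
Qed.

Lemma levy_cdf (w : R) : 0 < w ->
  (\int[mu]_(t in `]0%R, w]) (levy_pdf t)%:E = (2 * Phibar (Num.sqrt w)^-1)%:E)%E.
Proof.
move=> w0.
have := FTC_oc (@tilted_ge0 0) (@continuous_tilted 0) (@is_derive_A 0) (@cvg_A0 0) w0.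
rewrite /A /h oppr0 mul0r !subr0 div1r expR0 !mul1r addr0 -mulr2n mulr_natl => <-.
by apply: eq_integral => t _; rewrite /tilted_levy expr0n/= !mul0r oppr0 expR0 mulr1.
Qed.

(** Antiderivative of [t * levy_pdf t]. Differentiating [sqrt t] gives this integrand,
    differentiating the exponential gives [levy_pdf t], and the [Phibar] term cancels the latter. *)
Let B (t : R) : R := Num.sqrt (2 / pi) * (Num.sqrt t * expR (- (2 * t)^-1)) -
  2 * Phibar (h 0 t).

Let is_derive_B (x : R) : 0 < x -> is_derive x 1 B (x * levy_pdf x).
Proof.
move=> x0; have s0 : 0 < Num.sqrt x by rewrite sqrtr_gt0.
have d1 := is_derive1_comp (is_derive_Phibar (h 0 x)) (is_derive_h 0 x0).
have ds : is_derive x 1 Num.sqrt (2 * Num.sqrt x)^-1 by exact: is_derive1_sqrt.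
have d2x : is_derive x 1 (fun t : R => 2 * t) 2.
  by have := is_deriveZ 2 (is_derive_id x (1 : R)); rewrite /GRing.scale /= mulr1.
have x20 : 2 * x != 0 by rewrite gt_eqF// mulr_gt0.
have dN : is_derive x 1 (fun t : R => - (2 * t)^-1) (- (- (2 * x) ^- 2 *: 2)).
  exact: is_deriveN (is_deriveV x20 d2x).
have de := @is_derive1_comp R expR (fun t => - (2 * t)^-1) x _ _ (is_derive_expR _) dN.
apply: (is_derive_eq (is_deriveB (is_deriveZ (Num.sqrt (2 / pi)) (is_deriveM ds de))
   (is_deriveZ 2 d1))).
have p1 := phi_h 0 x0; rewrite oppr0 expR0 mul1r expr0n /= !mul0r oppr0 expR0 mulr1 in p1.
rewrite /GRing.scale /= !mulNr !mulrN !mulrA p1 levy_pdfE//.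
have -> : Num.sqrt (2 / pi) = 2 * (Num.sqrt (2 * pi))^-1 :> R.
  move: (pi) (@pi_gt0 R) => p p0.
  apply/eqP; rewrite -(@eqrXn2 _ 2) ?sqrtr_ge0 ?mulr_ge0 ?invr_ge0 ?sqrtr_ge0//.
  rewrite exprMn exprVn !sqr_sqrtr ?divr_ge0 ?mulr_ge0 ?ltW//; apply/eqP; field.
  by rewrite gt_eqF.
have q0 : Num.sqrt (2 * pi) != 0 :> R by rewrite gt_eqF// sqrtr_gt0 mulr_gt0// pi_gt0.
have xx : x = Num.sqrt x ^+ 2 by rewrite sqr_sqrtr// ltW.
move: s0 xx; move: (Num.sqrt x) => s s0 xx; move: (expR _) => e.
by rewrite xx; field; rewrite q0/= gt_eqF.
Qed.

Let cvg_B0 : B x @[x --> (0 : R)^'+] --> (0 : R).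
Proof.
have H : Phibar (h 0 x) @[x --> (0 : R)^'+] --> (0 : R).
  exact: (cvg_comp _ _ (@cvg_h0 0) (@cvg_Phibary R)).
suff : B x @[x --> (0 : R)^'+] --> Num.sqrt (2 / pi) * 0 - 2 * 0 by rewrite !mulr0 subr0.
apply: cvgB; last exact: cvgMr.
apply: cvgMr; apply: (@squeeze_cvgr _ _ _ _ (fun=> 0) Num.sqrt).
- near=> x; have x0 : 0 < x by near: x; exact: nbhs_right_gt.
  rewrite mulr_ge0 ?sqrtr_ge0 ?expR_ge0//= ler_piMr ?sqrtr_ge0//.
  by rewrite -[leRHS]expR0 ler_expR oppr_le0 invr_ge0 mulr_ge0// ltW.
- exact: cvg_cst.
- exact: cvg_sqrt0.
Unshelve. all: by end_near. Qed.

Lemma levy_moment (w : R) : 0 < w ->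
  (\int[mu]_(t in `]0%R, w]) (t * levy_pdf t)%:E =
   (Num.sqrt (2 * w / pi) * expR (- (2 * w)^-1) - 2 * Phibar (Num.sqrt w)^-1)%:E)%E.
Proof.
move=> w0.
have f0 (x : R) : 0 < x -> 0 <= x * levy_pdf x.
  by move=> x0; rewrite mulr_ge0 ?levy_pdf_ge0// ltW.
have cf (x : R) : 0 < x -> {for x, continuous (fun t : R => t * levy_pdf t)}.
  by move=> x0; apply: cvgM; [exact: cvg_id|exact: continuous_levy_pdf].
rewrite (FTC_oc f0 cf is_derive_B cvg_B0 w0) /B /h mul0r !subr0 div1r mulrA.
by rewrite -sqrtrM ?divr_ge0 ?pi_ge0// mulrAC.
Qed.

End LevyIntegrals.

(** * Gaussian powers and the inverse square root kernel *)

Section SquareRootKernel.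
Variable R : realType.
Notation mu := (@lebesgue_measure R).

Lemma gauss_power_integral k : (0 < k)%N ->
  (\int[mu]_s (expR (- s ^+ 2) ^+ k)%:E = (Num.sqrt (pi / k%:R))%:E)%E.
Proof.
move=> k0; have kR0 : (0 : R) < k%:R by rewrite ltr0n.
(* The integrand is proportional to a centred normal density of variance [1 / (2 k)]. *)
pose sg : R := Num.sqrt (2 * k%:R)^-1.
have sg2 : sg ^+ 2 = (2 * k%:R)^-1 by rewrite sqr_sqrtr// invr_ge0 mulr_ge0.
have sg0 : sg != 0 by rewrite gt_eqF// sqrtr_gt0 invr_gt0 mulr_gt0.
have q0 : 0 < Num.sqrt (pi / k%:R) :> R by rewrite sqrtr_gt0 divr_gt0// pi_gt0.
have pdfE s : normal_pdf 0 sg s = (Num.sqrt (pi / k%:R))^-1 * expR (- s ^+ 2) ^+ k.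
  rewrite normal_pdfE// /normal_peak /normal_fun sg2 subr0 -expRM_natl.
  congr ((Num.sqrt _)^-1 * expR _).
    by move: (pi) => p; field; rewrite gt_eqF.
  by field; rewrite gt_eqF.
have := @integral_normal_pdf R 0 sg.
under eq_integral do rewrite pdfE EFinM.
rewrite ge0_integralZl_EFin//; last first.
  apply/measurable_EFinP; apply: measurable_funX; exact: measurable_gauss_fun.
move=> h.
have -> : (Num.sqrt (pi / k%:R))%:E = ((Num.sqrt (pi / k%:R))%:E * 1)%E :> \bar R by rewrite mule1.
by rewrite -h muleA -EFinM divff ?mul1e// gt_eqF.
Qed.

Lemma continuous_gaussian (t : R) : continuous (fun s : R => expR (t * s ^+ 2)).
Proof.
move=> x.
have e : t * s ^+ 2 @[s --> x] --> t * x ^+ 2 by apply: cvgMr; exact: exprn_continuous.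
exact: (cvg_comp _ _ e (@continuous_expR R _)).
Qed.

Let f (t v : R) : R := v `^ (- 2^-1) * expR (v * t).
Let H (t x : R) : R := \int[mu]_(s in `[0, x]) expR (t * s ^+ 2).

Let is_derive_H (t x : R) : 0 < x -> is_derive x 1 (H t) (expR (t * x ^+ 2)).
Proof.
move=> x0.
have [] := @continuous_FTC1_closed R (fun s => expR (t * s ^+ 2)) 0 x (x + 1).
- by rewrite ltrDl.
- apply: continuous_compact_integrable; first exact: segment_compact.
  by apply: continuous_subspaceT; exact: continuous_gaussian.
- by [].
- exact: continuous_gaussian.
by move=> d1 d2; split; [exact: d1|rewrite -derive1E].
Qed.

Let fE (t v : R) : 0 < v -> f t v = (Num.sqrt v)^-1 * expR (t * Num.sqrt v ^+ 2).
Proof.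
by move=> v0; rewrite /f powRN powR12_sqrt ?ltW// sqr_sqrtr ?ltW// (mulrC v).
Qed.

(** The substitution [v = s^2], carried out through the antiderivative [2 * H t (sqrt v)] because
    the kernel is singular at 0. *)
Lemma integral_sqrt_kernel (t : R) :
  (\int[mu]_(v in `]0%R, 1%R[) (f t v)%:E =
   (2 * \int[mu]_(s in `[0, 1]) expR (t * s ^+ 2))%:E)%E.
Proof.
pose F v := 2 * H t (Num.sqrt v).
have f0 (v : R) : 0 < v -> 0 <= f t v by move=> _; rewrite mulr_ge0 ?powR_ge0 ?expR_ge0.
have cf (v : R) : 0 < v -> {for v, continuous (f t)}.
  move=> v0; have cp : {for v, continuous (fun x : R => x `^ (- 2^-1))}.
    apply: differentiable_continuous; apply/derivable1_diffP.
    by have [] := is_derive1_powR (- 2^-1) v0.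
  apply: cvgM; first exact: cp.
  have e : x * t @[x --> v] --> v * t by apply: cvgMl; exact: cvg_id.
  exact: (cvg_comp _ _ e (@continuous_expR R _)).
have dF (v : R) : 0 < v -> is_derive v 1 F (f t v).
  move=> v0; have s0 : 0 < Num.sqrt v by rewrite sqrtr_gt0.
  have ds : is_derive v 1 Num.sqrt (2 * Num.sqrt v)^-1 by exact: is_derive1_sqrt.
  apply: (is_derive_eq (is_deriveZ 2 (is_derive1_comp (is_derive_H t s0) ds))).
  rewrite /GRing.scale /= fE//; field.
  by rewrite gt_eqF.
have F0 : F v @[v --> (0 : R)^'+] --> (0 : R).
  have H0 : H t x @[x --> (0 : R)] --> (0 : R).
    apply: (@parameterized_integral_cvg_left R 0 1 (fun s => expR (t * s ^+ 2))) => //.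
    apply: continuous_compact_integrable; first exact: segment_compact.
    by apply: continuous_subspaceT; exact: continuous_gaussian.
  have s0 : Num.sqrt v @[v --> (0 : R)^'+] --> (0 : R).
    by rewrite -{2}(sqrtr0 R); apply: cvg_at_right_filter; exact: sqrt_continuous.
  suff : F v @[v --> (0 : R)^'+] --> (2 * 0 : R) by rewrite mulr0.
  by apply: cvgMr; exact: (cvg_comp _ _ s0 H0).
rewrite integral_itv_bndo_bndc; last first.
  apply/measurable_EFinP; apply: measurable_funM.
    by apply: measurable_funTS; exact: measurable_powR.
  apply: measurableT_comp => //; apply: measurable_funTS; exact: measurable_funM.
by rewrite (FTC_oc f0 cf dF F0 ltr01) /F sqrtr1 subr0.
Qed.

Lemma half_gauss_power_integral k : (0 < k)%N ->
  (\int[mu]_s ((expR (- s ^+ 2) * (0 <= s)%R%:R) ^+ k)%:E = (Num.sqrt (pi / k%:R) / 2)%:E)%E.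
Proof.
move=> k0; have := gauss_power_integral k0.
rewrite ge0_symfun_integralT; last 3 first.
- by move=> s; rewrite exprn_ge0// expR_ge0.
- move=> x; have e : expR (- s ^+ 2) @[s --> x] --> expR (- x ^+ 2) by exact: continuous_gauss_fun.
  exact: (cvg_comp _ _ e (@exprn_continuous R k _)).
- by move=> s /=; rewrite sqrrN.
move=> h; have {}h : (\int[mu]_(x in [set x | (0 <= x)%R]) (expR (- x ^+ 2) ^+ k)%:E =
    (Num.sqrt (pi / k%:R) / 2)%:E)%E.
  rewrite [in RHS]mulrC EFinM -h muleA -EFinM mulVf ?mul1e//.
rewrite -h [in RHS]integral_mkcond; apply: eq_integral => s _.
rewrite patchE; case: ifPn => [|/negP]; rewrite inE/= => s0.
  by rewrite s0 mulr1.
by move/negP : s0 => /negbTE ->; rewrite mulr0 expr0n eqn0Ngt k0.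
Qed.

End SquareRootKernel.

(** * Survival of an excursion from the refuelling site *)

Section ReturnTime.
Variables (R : realType) (N : nat -> enat).
Notation mu := (@lebesgue_measure R).
Hypothesis hN : forall M, (0 < M)%N -> if N M is Some n then (2 <= n)%N else true.
Hypothesis lim_N : (if N M is Some n then M%:R / n%:R ^+ 2 else 0) @[M --> \oo] --> (0 : R).

(** The sum of the survival probabilities up to [v M] is asymptotic to [C * sqrt (v M)]. Dividing
    the weights by [C * sqrt M] thus turns them, under [n = s^2 M], into Lebesgue measure on
    [s >= 0] exactly. *)
Let C : R := 2 * Num.sqrt (2 / pi).
Let Z (s : R) : R := expR (- s ^+ 2) * (0 <= s)%R%:R.
Let w (M n : nat) : R := surv R (N M) n 1 / (C * Num.sqrt M%:R).
Let S (k M : nat) : R :=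
  (1 - harmonic (N M) (decay (disc R k M)) 1) / (1 - disc R k M) / (C * Num.sqrt M%:R).

Let C0 : 0 < C. Proof. by rewrite mulr_gt0// sqrtr_gt0 divr_gt0// pi_gt0. Qed.

Let mZ : measurable_fun [set: measurableTypeR R] Z.
Proof.
apply: measurable_funM; first exact: measurable_gauss_fun.
apply: (measurableT_comp (f := fun b : bool => b%:R : R)) => //.
apply: (@measurable_fun_ler _ _ _ _ (fun=> 0) idfun) => //; exact: measurable_id.
Qed.

Let Z01 s : 0 <= Z s <= 1.
Proof.
rewrite /Z mulr_ge0 ?expR_ge0//= mulr_ile1 ?expR_ge0//; last by case: (0 <= s).
by rewrite -[leRHS]expR0 ler_expR oppr_le0 sqr_ge0.
Qed.

Let iZ : mu.-integrable setT (EFin \o Z).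
Proof.
have h s : `|Z s| <= gauss_fun s.
  have /andP[z0 _] := Z01 s; rewrite ger0_norm// /Z.
  by rewrite ler_piMr ?expR_ge0//; case: (0 <= s).
exact: (le_integrableR mZ h (@integrableT_gauss R)).
Qed.

Let w0 M n : 0 <= w M n.
Proof. by rewrite divr_ge0 ?surv_ge0// mulr_ge0 ?sqrtr_ge0// ltW. Qed.

Let wS k M : (0 < k)%N -> (0 < M)%N ->
  series (fun n => w M n * expR (- (n%:R / M%:R)) ^+ k) @ \oo --> S k M.
Proof.
move=> k0 M0.
have d01 : 0 < disc R k M < 1 by rewrite disc_gt0 disc_lt1.
have [r0 r1 r2] := decay_spec d01.
have s1 : site (N M) 1 by have := hN M0; case: (N M) => //= n /ltnW.
have r01 : 0 <= decay (disc R k M) <= 1 by rewrite ltW.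
have := survsum_harmonic d01 r01 r2 s1 => h.
apply: (@cvg_near_eqn _ (fun n => survsum (N M) (disc R k M) n 1 * (C * Num.sqrt M%:R)^-1));
  last exact: cvgMl.
apply: nearW => n; rewrite /series/= big_mkord mulr_suml; apply: eq_bigr => i _.
by rewrite discX /w; ring.
Qed.

Let SZ k : (0 < k)%N -> S k M @[M --> \oo] --> \int[mu]_s (Z s ^+ k).
Proof.
move=> k0; have kR0 : (0 : R) < k%:R by rewrite ltr0n.
rewrite /Rintegral half_gauss_power_integral//=.
have -> : Num.sqrt (pi / k%:R) / 2 = Num.sqrt (2 * k%:R) / k%:R / C.
  rewrite /C; have p0 := @pi_gt0 R; move: (pi) p0 => p p0.
  have s2 : Num.sqrt (2 : R) != 0 by rewrite gt_eqF// sqrtr_gt0.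
  have sp : Num.sqrt p != 0 by rewrite gt_eqF// sqrtr_gt0.
  have sk : Num.sqrt (k%:R : R) != 0 by rewrite gt_eqF// sqrtr_gt0.
  rewrite !sqrtrM ?ltW// !sqrtrV ?ltW//.
  have kE : k%:R = Num.sqrt k%:R ^+ 2 :> R by rewrite sqr_sqrtr// ltW.
  move: sk kE; move: (Num.sqrt k%:R) => q q0 ->.
  by field; rewrite q0 sp s2.
have h1 := cvg_harmonic1 k0 hN lim_N.
have h2 := cvgV (lt0r_neq0 kR0) (@cvg_disc_rate R k).
apply: (@cvg_near_eqn _ (fun M => Num.sqrt M%:R *
    (1 - harmonic (N M) (decay (disc R k M)) 1) / (M%:R * (1 - disc R k M)) / C)); last first.
  by apply: cvgMl; apply: cvgM; [exact: h1|exact: h2].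
near=> M.
have M0 : (0 < M)%N by near: M; exists 1%N.
have sM : Num.sqrt M%:R != 0 :> R by rewrite sqrtr_eq0 -ltNge ltr0n.
have d1 : 1 - disc R k M != 0 by rewrite subr_eq0 gt_eqF// disc_lt1.
rewrite /S.
have ME : M%:R = Num.sqrt M%:R ^+ 2 :> R by rewrite sqr_sqrtr.
rewrite {2}ME; field.
by rewrite sM d1 gt_eqF.
Unshelve. all: by end_near. Qed.

(** In the variable [s] the cut [exp (- v) <= Z s] is the segment [[0, sqrt v]], and its only
    possible atom is the single point [sqrt v]. *)
Lemma return_tauberian (y : nat -> nat) (v : R) (psi : R -> R) :
  ((y M)%:R / M%:R : R) @[M --> \oo] --> v -> 0 <= v ->
  continuous psi -> (forall x, 0 <= x <= 1 -> 0 <= psi x) ->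
  (\sum_(n < (y M).+1) surv R (N M) n 1 * psi (expR (- (n%:R / M%:R)))) / Num.sqrt M%:R
    @[M --> \oo] --> C * \int[mu]_(s in `[0, Num.sqrt v]) psi (expR (- s ^+ 2)).
Proof.
move=> yv v0 cpsi psi0.
have Zv : mu (Z @^-1` [set expR (- v)]) = 0%E.
  apply: (@subset_measure0 _ _ _ mu _ [set Num.sqrt v]).
  - by rewrite -[X in measurable X]setTI; exact: mZ.
  - exact: measurable_set1.
  - move=> s /=; rewrite /Z; case: (leP 0 s) => s0; last first.
      by rewrite mulr0 => /esym/eqP; rewrite gt_eqF// expR_gt0.
    by rewrite mulr1 => /expR_inj/oppr_inj <-; rewrite sqrtr_sqr ger0_norm.
  - exact: lebesgue_measure_set1.
have := karamata mZ Z01 iZ w0 wS SZ yv Zv cpsi psi0 => kar.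
have -> : \int[mu]_(s in `[0, Num.sqrt v]) psi (expR (- s ^+ 2)) =
    \int[mu]_s (psi (Z s) * (expR (- v) <= Z s)%R%:R).
  rewrite Rintegral_mkcond; apply: eq_Rintegral => s _.
  rewrite patchE; case: ifPn => [|/negP]; rewrite inE/= in_itv/=.
    move=> /andP[s0 sv]; rewrite /Z s0 mulr1 ler_expR lerN2.
    have : s ^+ 2 <= Num.sqrt v ^+ 2 by rewrite lerXn2r ?nnegrE ?sqrtr_ge0.
    by rewrite sqr_sqrtr// => ->; rewrite mulr1.
  move/negP; rewrite negb_and -!ltNge /Z; case: (ltP s 0) => s0 /=.
    by rewrite mulr0 leNgt expR_gt0 mulr0.
  move=> sv; rewrite mulr1 ler_expR lerN2 leNgt.
  have : Num.sqrt v ^+ 2 < s ^+ 2 by rewrite ltrXn2r ?nnegrE ?sqrtr_ge0.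
  by rewrite sqr_sqrtr// => ->; rewrite mulr0.
apply: (@cvg_near_eqn _ (fun M =>
    C * \sum_(n < (y M).+1) w M n * psi (expR (- (n%:R / M%:R))))); last first.
  by apply: cvgMr; exact: kar.
near=> M.
have M0 : (0 < M)%N by near: M; exists 1%N.
have sM : Num.sqrt M%:R != 0 :> R by rewrite sqrtr_eq0 -ltNge ltr0n.
rewrite mulr_sumr mulr_suml; apply: eq_bigr => i _; rewrite /w; field.
by rewrite sM gt_eqF.
Unshelve. all: by end_near. Qed.

Let cvg_pred : (M.-1%:R / M%:R : R) @[M --> \oo] --> (1 : R).
Proof.
have h : 1 - 1 / M%:R @[M --> \oo] --> (1 - 0 : R).
  by apply: cvgB; [exact: cvg_cst|exact: cvg_natr_div].
rewrite subr0 in h; apply: (cvg_near_eqn _ h); near=> M.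
have M0 : (0 < M)%N by near: M; exists 1%N.
have MR : M%:R != 0 :> R by rewrite pnatr_eq0 -lt0n.
by rewrite -subn1 natrB//; field.
Unshelve. all: by end_near. Qed.

Definition sqrt_kernel (t : R) : R :=
  Rintegral mu `]0%R, 1%R[ (fun v => v `^ (- 2^-1) * expR (v * t)).

Lemma sqrt_kernelE t : sqrt_kernel t = 2 * \int[mu]_(s in `[0, 1]) expR (t * s ^+ 2).
Proof. by rewrite /sqrt_kernel /Rintegral integral_sqrt_kernel. Qed.

Lemma cvg_survsum k : survsum (N M) (disc R k M) M 1 / Num.sqrt M%:R @[M --> \oo] -->
  Num.sqrt (2 / pi) * sqrt_kernel (- k%:R).
Proof.
have psi0 (x : R) : 0 <= x <= 1 -> 0 <= x ^+ k by move=> /andP[? _]; rewrite exprn_ge0.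
(* [survsum] stops at [n < M] whereas the Tauberian sum includes its endpoint, hence the cut at
   [M.-1]. *)
have h := return_tauberian cvg_pred ler01 (@exprn_continuous R k) psi0.
have -> : Num.sqrt (2 / pi) * sqrt_kernel (- k%:R) =
    C * \int[mu]_(s in `[0, Num.sqrt 1]) expR (- s ^+ 2) ^+ k.
  rewrite sqrt_kernelE sqrtr1 /C -mulrA mulrCA; congr (_ * (_ * _)).
  by apply: eq_Rintegral => s _; rewrite -expRM_natl; congr expR; ring.
apply: (cvg_near_eqn _ h); near=> M.
have M0 : (0 < M)%N by near: M; exists 1%N.
rewrite prednK// /survsum; congr (_ / _); apply: eq_bigr => i _.
by rewrite discX mulrC.
Unshelve. all: by end_near. Qed.

Lemma sqrt_kernel0 : sqrt_kernel 0 = 2.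
Proof.
rewrite sqrt_kernelE; under eq_Rintegral do rewrite mul0r expR0.
rewrite Rintegral_cst//= lebesgue_measure_itv/= lte_fin ltr01/= subr0 mul1r mulr1//.
Qed.

Let cvg_surv_count (y : nat -> nat) (v : R) : ((y M)%:R / M%:R : R) @[M --> \oo] --> v -> 0 <= v ->
  (\sum_(n < (y M).+1) surv R (N M) n 1) / Num.sqrt M%:R @[M --> \oo] --> C * Num.sqrt v.
Proof.
move=> yv v0.
have h := @return_tauberian y v (fun=> 1) yv v0 (@cst_continuous _ _ _) (fun _ _ => ler01).
have <- : \int[mu]_(s in `[0, Num.sqrt v]) 1 = Num.sqrt v.
  rewrite Rintegral_cst//= lebesgue_measure_itv/= lte_fin mul1r.
  case: ltP => /=; first by rewrite subr0.
  by move=> s0; apply/eqP; rewrite eq_le sqrtr_ge0 s0.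
apply: (cvg_near_eqn _ h); apply: nearW => M; congr (_ / _).
by apply: eq_bigr => i _; rewrite mulr1.
Qed.

(* Monotone density argument: [surv] is nonincreasing and its partial sums up
   to [v M] are asymptotic to [C * sqrt (v M)]. *)
Lemma cvg_surv : Num.sqrt M%:R * surv R (N M) M 1 @[M --> \oo] --> Num.sqrt (2 / pi : R).
Proof.
have CE : Num.sqrt (2 / pi) = C / 2 by rewrite /C [RHS]mulrAC divff// mul1r.
pose B M n := \sum_(i < n.+1) surv R (N M) i 1.
pose q M := Num.sqrt M%:R * surv R (N M) M 1.
have Badd M n j : B M (n + j)%N - B M n = \sum_(i < j) surv R (N M) (n.+1 + i) 1.
  elim: j => [|j IH]; first by rewrite addn0 subrr big_ord0.
  by rewrite addnS [B M _.+1]big_ord_recr/= -/(B M (n + j)%N) addrAC IH big_ord_recr.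
have id_cvg : (M%:R / M%:R : R) @[M --> \oo] --> (1 : R).
  apply: cvg_near_cst; near=> M; rewrite divff// pnatr_eq0 -lt0n.
  by near: M; exists 1%N.
apply/cvgrPdist_le => /= eta eta0.
(* Relative width of the windows on both sides of [M]. With [e <= 1 / 2], the difference quotients
   of [C * sqrt] at 1 over this width are within [e * C / 2 <= eta / 2] of the derivative [C / 2];
   the other [eta / 2] pays for the convergence. *)
pose e : R := Num.min 2^-1 (eta / C).
have e0 : 0 < e by rewrite lt_min invr_gt0 ltr0n/= divr_gt0.
have e1 : e <= 2^-1 by rewrite ge_min lexx.
have eC : e * C <= eta by rewrite -ler_pdivlMr// ge_min lexx orbT.
pose j M := Num.truncn (e * M%:R).
have jle M : (j M)%:R <= e * M%:R by rewrite truncn_le mulr_ge0// ltW.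
have jM M : (j M <= M)%N.
  rewrite -(ler_nat R) (le_trans (jle M))// ler_piMl//; lra.
have cvg_j : ((j M)%:R / M%:R : R) @[M --> \oo] --> e.
  apply: (@squeeze_cvgr _ _ _ _ (fun M => e - 1 / M%:R) (fun=> e)).
  - near=> M; have M0 : (0 : R) < M%:R by rewrite ltr0n; near: M; exists 1%N.
    rewrite ler_pdivrMr// jle andbT ler_pdivlMr// mulrBl divfK ?gt_eqF//.
    by rewrite lerBlDr natr1 ltW// truncnS_gt.
  - by rewrite -[X in _ --> X]subr0; apply: cvgB; [exact: cvg_cst|exact: cvg_natr_div].
  - exact: cvg_cst.
have cB y v : ((y M)%:R / M%:R : R) @[M --> \oo] --> v -> 0 <= v ->
   B M (y M) / Num.sqrt M%:R @[M --> \oo] --> C * Num.sqrt v by exact: cvg_surv_count.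
have up : (B M M / Num.sqrt M%:R - B M (M - j M)%N / Num.sqrt M%:R) / ((j M)%:R / M%:R) @[M --> \oo] -->
   ((C * Num.sqrt 1 - C * Num.sqrt (1 - e)) / e).
  apply: cvgM; last by apply: cvgV => //; rewrite gt_eqF.
  apply: cvgB; first exact: (cB id).
  apply: cB; last by rewrite subr_ge0 (le_trans e1)// invf_le1// ler1n.
  apply: (cvg_near_eqn _ (cvgB id_cvg cvg_j)); apply: nearW => M.
  by rewrite natrB// mulrBl.
have dn : (B M (M + j M)%N / Num.sqrt M%:R - B M M / Num.sqrt M%:R) / ((j M)%:R / M%:R) @[M --> \oo] -->
   ((C * Num.sqrt (1 + e) - C * Num.sqrt 1) / e).
  apply: cvgM; last by apply: cvgV => //; rewrite gt_eqF.
  apply: cvgB; last exact: (cB id).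
  apply: cB; last by rewrite addr_ge0// ltW.
  apply: (cvg_near_eqn _ (cvgD id_cvg cvg_j)); apply: nearW => M.
  by rewrite natrD mulrDl.
have eta20 : 0 < eta / 2 by rewrite divr_gt0.
have near_pos : \forall M \near \oo, (0 < M)%N by exists 1%N.
move/cvgrPdist_lt : cvg_j => /(_ _ e0) near_j.
move/cvgrPdist_le : up => /(_ _ eta20) near_up.
move/cvgrPdist_le : dn => /(_ _ eta20) near_dn.
apply: filterS (filterI (filterI near_pos near_j) (filterI near_up near_dn)).
move=> M [[M0 +] [+ +]]; rewrite /=.
rewrite !ler_distlC ltr_distlC subrr => /andP[jM0 _] /andP[_ hup] /andP[hdn _].
have MR : (0 : R) < M%:R by rewrite ltr0n.
have sM : 0 < Num.sqrt M%:R :> R by rewrite sqrtr_gt0.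
have qE : (j M)%:R * surv R (N M) M 1 / Num.sqrt M%:R / ((j M)%:R / M%:R) = q M.
  have j0 : (j M)%:R != 0 :> R by apply/eqP => h; move: jM0; rewrite h mul0r ltxx.
  rewrite /q; have ME : M%:R = Num.sqrt M%:R ^+ 2 :> R by rewrite sqr_sqrtr// ltW.
  by rewrite {2}ME; field; rewrite j0 gt_eqF.
(* By monotonicity the average of [surv] over the window before [M] is at least its value at [M],
   and the average over the window after [M] is at most this value. *)
have q_up : q M <= (B M M / Num.sqrt M%:R - B M (M - j M)%N / Num.sqrt M%:R) / ((j M)%:R / M%:R).
  rewrite -qE ler_pM2r ?invr_gt0// -mulrBl ler_pM2r ?invr_gt0//.
  have := Badd M (M - j M)%N (j M); rewrite subnK// => ->; rewrite mulr_natl -[X in _ *+ X]card_ord -sumr_const.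
  apply: ler_sum => i _; apply: surv_noninc.
  by rewrite -[leqRHS](subnK (jM M)) addSnnS leq_add2l.
have q_dn : (B M (M + j M)%N / Num.sqrt M%:R - B M M / Num.sqrt M%:R) / ((j M)%:R / M%:R) <= q M.
  rewrite -qE ler_pM2r ?invr_gt0// -mulrBl ler_pM2r ?invr_gt0//.
  rewrite Badd mulr_natl -[X in _ *+ X]card_ord -sumr_const.
  apply: ler_sum => i _; apply: surv_noninc.
  by rewrite ltnW// leq_addr.
have u1 := le_trans q_up hup; have l1 := le_trans hdn q_dn.
rewrite sqrtr1 mulr1 in u1 l1.
rewrite -/(q M) CE; apply/andP; split.
  apply: le_trans l1; rewrite -subr_ge0.
  have s1 : 1 <= Num.sqrt (1 + e) by rewrite -[leLHS]sqrtr1 ler_sqrt ?addr_ge0 ?lerDl ?ltW.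
  have s2 : Num.sqrt (1 + e) ^+ 2 = 1 + e by rewrite sqr_sqrtr// addr_ge0// ltW.
  move: s1 s2; move: (Num.sqrt (1 + e)) => s s1 s2.
  (* [e = (s - 1) * (s + 1)] removes the small denominator. *)
  have -> : (C * s - C) / e = C / (1 + s).
    have eE : e = (s - 1) * (1 + s) by rewrite -[LHS](addKr 1) -s2; ring.
    have s10 : s - 1 != 0 by apply/eqP => h; move: e0; rewrite eE h mul0r ltxx.
    by rewrite eE; field; rewrite s10/= gt_eqF//; lra.
  have s3 : s <= 1 + e / 2 by nra.
  have h1 : 0 <= C * (1 - e / 2) * (1 + e / 2 - s).
    by rewrite mulr_ge0// ?subr_ge0// mulr_ge0// ?(ltW C0)//; lra.
  have h2 : 0 <= C * e by rewrite mulr_ge0// ltW.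
  have h3 : 0 <= C * e * e by rewrite mulr_ge0// ltW.
  have : C / 2 - C * e / 4 <= C / (1 + s) by rewrite ler_pdivlMr; [nra|lra].
  lra.
apply: (le_trans u1); rewrite -subr_ge0.
have e1' : 0 <= 1 - e by lra.
have s0 : 0 <= Num.sqrt (1 - e) by exact: sqrtr_ge0.
have s2 : Num.sqrt (1 - e) ^+ 2 = 1 - e by rewrite sqr_sqrtr.
move: s0 s2; move: (Num.sqrt (1 - e)) => s s0 s2.
have -> : (C - C * s) / e = C / (1 + s).
  have eE : e = (1 - s) * (1 + s) by rewrite -[LHS]opprK -[in LHS](addKr 1 (- e)) -s2; ring.
  have s10 : 1 - s != 0 by apply/eqP => h; move: e0; rewrite eE h mul0r ltxx.
  by rewrite eE; field; rewrite s10/= gt_eqF//; lra.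
have s3 : 1 - e <= s by nra.
have h1 : 0 <= C * (1 + e) * (s - (1 - e)).
  by rewrite mulr_ge0// ?subr_ge0// mulr_ge0// ?(ltW C0)//; lra.
have h2 : 0 <= C * e * (1 - e) by rewrite mulr_ge0// mulr_ge0// ltW.
have : C / (1 + s) <= C / 2 + C * e / 2 by rewrite ler_pdivrMr; [nra|lra].
lra.
Unshelve. all: by end_near. Qed.

End ReturnTime.

(** * Summation by parts for tail probabilities *)

Section TailSums.
Variable R : realType.

(* Mass function of a random time whose tails are [a n = P(T > n)]. *)
Definition tail_pmf (a : nat -> R) (n : nat) : R :=
  if n is m.+1 then a m - a m.+1 else 1 - a 0%N.

(** Abel summation. For the survival tail of the walk the right-hand side is [hitsum]; for [r = 1]
    it is the distribution function. *)
Lemma sum_tail_pmf (a : nat -> R) (r : R) n :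
  \sum_(i < n.+1) tail_pmf a i * r ^+ i =
  1 - (1 - r) * \sum_(i < n) r ^+ i * a i - r ^+ n * a n.
Proof.
elim: n => [|n IH]; first by rewrite big_ord1 big_ord0 expr0/=; ring.
rewrite big_ord_recr/= IH big_ord_recr/= exprS; ring.
Qed.

Lemma sum_tail_moment (a : nat -> R) n :
  \sum_(i < n.+1) tail_pmf a i * i%:R = \sum_(i < n) a i - n%:R * a n.
Proof.
elim: n => [|n IH]; first by rewrite big_ord1 big_ord0/=; ring.
rewrite big_ord_recr/= IH big_ord_recr/= -natr1; ring.
Qed.

Lemma tail_pmf_ge0 (a : nat -> R) n : (forall n, a n.+1 <= a n) -> a 0%N <= 1 ->
  0 <= tail_pmf a n.
Proof. by move=> adec a1; case: n => [|n] /=; rewrite subr_ge0. Qed.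

Lemma tail_pmf_laplace (a : nat -> R) (r L : R) : 0 < r < 1 ->
  (forall n, 0 <= a n <= 1) -> (\sum_(i < n) r ^+ i * a i) @[n --> \oo] --> L ->
  series (fun n => tail_pmf a n * r ^+ n) @ \oo --> 1 - (1 - r) * L.
Proof.
move=> /andP[r0 r1] a01 aL; rewrite -(cvg_shiftS (series _)).
have h0 : r ^+ n * a n @[n --> \oo] --> (0 : R).
  apply: (@squeeze_cvgr _ _ _ _ (fun=> 0) (fun n => r ^+ n)).
  - apply: nearW => n; have /andP[a0 a1] := a01 n.
    by rewrite mulr_ge0 ?exprn_ge0 ?(ltW r0)//= ler_piMr// exprn_ge0// ltW.
  - exact: cvg_cst.
  - by apply: cvg_expr; rewrite ger0_norm ?ltW.
rewrite -(subr0 (1 - (1 - r) * L)).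
apply: (@cvg_near_eqn _ (fun n => 1 - (1 - r) * (\sum_(i < n) r ^+ i * a i) - r ^+ n * a n)).
  by apply: nearW => n; rewrite -sum_tail_pmf /series/= big_mkord.
by apply: cvgB => //; apply: cvgB; [exact: cvg_cst|exact: cvgMr].
Qed.

End TailSums.

(** * The first hitting time of the boundary, cut at the fuel supply *)

Section HittingLimit.
Variables (R : realType) (N : nat -> enat) (x y : nat -> nat) (u : R).
Hypothesis hx : forall M, (0 < M)%N -> site (N M) (x M).
Hypothesis u0 : 0 <= u.
Hypothesis y_u : ((y M)%:R / M%:R : R) @[M --> \oo] --> u.
Context {d} {U : measurableType d} (Q : probability U R).
Variable Z : U -> R.
Hypothesis mZ : measurable_fun setT Z.
Hypothesis Z01 : forall t, 0 <= Z t <= 1.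
Hypothesis Zu : Q (Z @^-1` [set expR (- u)]) = 0%E.
Hypothesis hZ : forall k, (0 < k)%N ->
  harmonic (N M) (decay (disc R k M)) (x M) @[M --> \oo] --> \int[Q]_t (Z t ^+ k).

Lemma integrable_bounded (f : U -> R) (B : R) : measurable_fun setT f ->
  (forall t, `|f t| <= B) -> Q.-integrable setT (EFin \o f).
Proof.
move=> mf fB; apply: (le_integrableR (g := fun=> B) mf) => //.
exact: finite_measure_integrable_cst.
Qed.

Let iZ : Q.-integrable setT (EFin \o Z).
Proof.
by apply: (@integrable_bounded _ 1) => // t; have /andP[z0 z1] := Z01 t; rewrite ger0_norm.
Qed.

Let tail M n := surv R (N M) n (x M).

Lemma hitting_tauberian (psi : R -> R) : continuous psi ->
  (forall x, 0 <= x <= 1 -> 0 <= psi x) ->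
  \sum_(n < (y M).+1) tail_pmf (tail M) n * psi (expR (- (n%:R / M%:R))) @[M --> \oo] -->
  \int[Q]_t (psi (Z t) * (expR (- u) <= Z t)%R%:R).
Proof.
move=> cpsi psi0.
pose S k M := harmonic (N M) (decay (disc R k M)) (x M).
have w0 M n : 0 <= tail_pmf (tail M) n.
  by apply: tail_pmf_ge0 => [m|]; [exact: surv_nincr|exact: surv_le1].
have wS k M : (0 < k)%N -> (0 < M)%N ->
    series (fun n => tail_pmf (tail M) n * expR (- (n%:R / M%:R)) ^+ k) @ \oo --> S k M.
  move=> k0 M0; have d01 : 0 < disc R k M < 1 by rewrite disc_gt0 disc_lt1.
  have [r0 r1 r2] := decay_spec d01.
  have r01 : 0 <= decay (disc R k M) <= 1 by rewrite ltW.
  under eq_fun do rewrite discX.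
  have -> : S k M = 1 - (1 - disc R k M) * ((1 - S k M) / (1 - disc R k M)).
    have d1 : 1 - disc R k M != 0 by rewrite subr_eq0 gt_eqF//; case/andP: d01.
    by rewrite mulrCA divff// mulr1 opprB addrC subrK.
  apply: tail_pmf_laplace => //; last first.
    exact: (survsum_harmonic d01 r01 r2 (hx M0)).
  by move=> n; rewrite surv_ge0 surv_le1.
exact: (karamata mZ Z01 iZ w0 wS hZ y_u Zu cpsi psi0).
Qed.

Let hit_prob := \int[Q]_t (expR (- u) <= Z t)%R%:R.

Lemma cvg_hitsum k : hitsum (N M) (disc R k M) (y M) (x M) @[M --> \oo] -->
  \int[Q]_t (Z t ^+ k * (expR (- u) <= Z t)%R%:R).
Proof.
have psi0 (z : R) : 0 <= z <= 1 -> 0 <= z ^+ k by move=> /andP[? _]; rewrite exprn_ge0.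
apply: (cvg_near_eqn _ (hitting_tauberian (@exprn_continuous R k) psi0)).
apply: nearW => M; rewrite -[RHS](sum_tail_pmf (tail M)).
by apply: eq_bigr => i _; rewrite discX.
Qed.

Lemma disc0 M : disc R 0 M = 1.
Proof. by rewrite /disc mul0r oppr0 expR0. Qed.

Lemma cvg_surv_hit : surv R (N M) (y M) (x M) @[M --> \oo] --> 1 - hit_prob.
Proof.
have -> : hit_prob = \int[Q]_t (Z t ^+ 0 * (expR (- u) <= Z t)%R%:R).
  by apply: eq_Rintegral => t _; rewrite expr0 mul1r.
apply: (cvg_near_eqn _ (cvgB (cvg_cst (1 : R)) (@cvg_hitsum 0))); apply: nearW => M.
by rewrite fctE /hitsum disc0 subrr mul0r subr0 expr1n mul1r opprB addrC subrK.
Qed.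

(** The left side is the mean of [min (T, y)] over [M], for [T] the hitting time: the part [T <= y]
    is a Tauberian sum with test function [- ln], since [- ln (exp (- n / M)) = n / M], and the part
    [T > y] contributes [y / M] times its probability. *)
Lemma cvg_survsum_hit : survsum (N M) (disc R 0 M) (y M) (x M) / M%:R @[M --> \oo] -->
  \int[Q]_t (- ln (Z t) * (expR (- u) <= Z t)%R%:R) + u * (1 - hit_prob).
Proof.
(* The logarithm is frozen below half the cut level to obtain a test function continuous at 0. *)
pose c := expR (- u) / 2; have c0 : 0 < c by rewrite divr_gt0// expR_gt0.
pose psi (z : R) := - ln (Num.max z c).
have cpsi : continuous psi.
  move=> z; apply: cvgN; have zc : 0 < Num.max z c by rewrite lt_max c0 orbT.
  have e : Num.max t c @[t --> z] --> Num.max z c.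
    by apply: (@continuous_max _ _ id (cst c)); [exact: cvg_id|exact: cvg_cst].
  exact: (cvg_comp _ _ e (continuous_ln zc)).
have c1 : c <= 1.
  have : expR (- u) <= 1 by rewrite -[leRHS]expR0 ler_expR oppr_le0.
  by have := expR_ge0 (- u); rewrite /c; lra.
have psi0 (z : R) : 0 <= z <= 1 -> 0 <= psi z.
  by move=> /andP[_ z1]; rewrite oppr_ge0 ln_le0// ge_max z1.
have -> : \int[Q]_t (- ln (Z t) * (expR (- u) <= Z t)%R%:R) =
    \int[Q]_t (psi (Z t) * (expR (- u) <= Z t)%R%:R).
  apply: eq_Rintegral => t _; case: leP => h; last by rewrite !mulr0.
  by rewrite /psi max_l// (le_trans _ h)// ler_pdivrMr// ler_peMr ?expR_ge0// ler1n.
apply: (cvg_near_eqn _ (cvgD (hitting_tauberian cpsi psi0) (cvgM y_u cvg_surv_hit))).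
have h2 : (y M)%:R / M%:R @[M --> \oo] --> u by exact: y_u.
(* The margin [ln 2] matches the factor 2 in [c]: once [y / M <= u + ln 2], every point of the sum
   lies above [c], where [psi] is the true logarithm. *)
move/cvgrPdist_le : h2 => /(_ (ln 2)).
have l2 : 0 < ln 2 :> R by rewrite ln_gt0// ltr1n.
move=> /(_ l2) near_y; have near_pos : \forall M \near \oo, (0 < M)%N by exists 1%N.
apply: filterS (filterI near_pos near_y) => M [/= M0]; rewrite ler_distlC => /andP[_ yu].
have -> : \sum_(n < (y M).+1) tail_pmf (tail M) n * psi (expR (- (n%:R / M%:R))) =
   \sum_(n < (y M).+1) tail_pmf (tail M) n * n%:R / M%:R.
  apply: eq_bigr => n _; rewrite -mulrA; congr (_ * _).
  rewrite /psi max_l ?expRK ?opprK//.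
  rewrite /c -[X in _ / X <= _](@lnK _ 2) ?posrE// -expRN -expRD ler_expR -opprD lerN2.
  by rewrite (le_trans _ yu)// ler_pM2r ?invr_gt0 ?ltr0n// ler_nat -ltnS.
rewrite -mulr_suml sum_tail_moment /survsum.
have -> : (y M)%:R / M%:R * surv R (N M) (y M) (x M) = (y M)%:R * tail M (y M) / M%:R.
  by rewrite mulrAC.
rewrite -mulrDl subrK; congr (_ / _); apply: eq_bigr => i _.
by rewrite disc0 expr1n mul1r.
Qed.

End HittingLimit.

(** * Limits of the transform and of the mean of the lifetime *)

Section LifetimeLimit.
Variables (R : realType) (N : nat -> enat) (x y : nat -> nat) (u : R).
Hypothesis hN : forall M, (0 < M)%N -> if N M is Some n then (2 <= n)%N else true.
Hypothesis hx : forall M, (0 < M)%N -> site (N M) (x M).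
Hypothesis lim_N : (if N M is Some n then M%:R / n%:R ^+ 2 else 0) @[M --> \oo] --> (0 : R).
Hypothesis u0 : 0 <= u.
Hypothesis y_u : ((y M)%:R / M%:R : R) @[M --> \oo] --> u.
Context {d} {U : measurableType d} (Q : probability U R).
Variable Z : U -> R.
Hypothesis mZ : measurable_fun setT Z.
Hypothesis Z01 : forall t, 0 <= Z t <= 1.
Hypothesis Zu : Q (Z @^-1` [set expR (- u)]) = 0%E.
Hypothesis hZ : forall k, (0 < k)%N ->
  harmonic (N M) (decay (disc R k M)) (x M) @[M --> \oo] --> \int[Q]_t (Z t ^+ k).

Let hit k := \int[Q]_t (Z t ^+ k * (expR (- u) <= Z t)%R%:R).
Let hit_prob := \int[Q]_t (expR (- u) <= Z t)%R%:R.
Let c : R := Num.sqrt (2 / pi).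
Let c0 : 0 < c. Proof. by rewrite sqrtr_gt0 divr_gt0// pi_gt0. Qed.
Let A k M := survsum (N M) (disc R k M) M 1.

(** First term of [refuel_denom]: [1 - r] is of order [k / M] and the sum of survival probabilities
    of order [sqrt M], so [sqrt M] is the normalization shared with the survival term. *)
Let cvg_sqrt_denom k :
  Num.sqrt M%:R * ((1 - disc R k M) * (1 + disc R k M * A k M)) @[M --> \oo] -->
  k%:R * (c * sqrt_kernel (- k%:R)).
Proof.
have h : M%:R * (1 - disc R k M) * ((Num.sqrt M%:R)^-1 + disc R k M * (A k M / Num.sqrt M%:R))
    @[M --> \oo] --> k%:R * (0 + 1 * (c * sqrt_kernel (- k%:R))).
  apply: cvgM; first exact: cvg_disc_rate.
  apply: cvgD; first exact: cvg_sqrt_natV.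
  by apply: cvgM; [exact: cvg_disc|exact: cvg_survsum].
rewrite add0r mul1r in h; apply: (cvg_near_eqn _ h); near=> M.
have M0 : (0 < M)%N by near: M; exists 1%N.
have sM : Num.sqrt M%:R != 0 :> R by rewrite sqrtr_eq0 -ltNge ltr0n.
have ME : M%:R = Num.sqrt M%:R ^+ 2 :> R by rewrite sqr_sqrtr.
by rewrite {1}ME; field.
Unshelve. all: by end_near. Qed.

Let cvg_disc_pow k (z : nat -> nat) (v : R) : ((z M)%:R / M%:R : R) @[M --> \oo] --> v ->
  disc R k M ^+ z M @[M --> \oo] --> expR (- (v * k%:R)).
Proof.
move=> zv.
have e : - ((z M)%:R / M%:R * k%:R) @[M --> \oo] --> - (v * k%:R) by apply: cvgN; exact: cvgMl.
apply: (cvg_near_eqn _ (cvg_comp _ _ e (@continuous_expR R _))); apply: nearW => M.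
by rewrite /disc -expRM_natl; congr expR; ring.
Qed.

Let cvg_succ : (M.+1%:R / M%:R : R) @[M --> \oo] --> (1 : R).
Proof.
have h : 1 + 1 / M%:R @[M --> \oo] --> (1 + 0 : R).
  by apply: cvgD; [exact: cvg_cst|exact: cvg_natr_div].
rewrite addr0 in h; apply: (cvg_near_eqn _ h); near=> M.
have M0 : (0 < M)%N by near: M; exists 1%N.
have MR : M%:R != 0 :> R by rewrite pnatr_eq0 -lt0n.
by rewrite -natr1; field.
Unshelve. all: by end_near. Qed.

Let cvg_sqrt_surv k :
  Num.sqrt M%:R * (disc R k M ^+ M.+1 * surv R (N M) M 1) @[M --> \oo] --> expR (- k%:R) * c.
Proof.
have h : disc R k M ^+ M.+1 * (Num.sqrt M%:R * surv R (N M) M 1) @[M --> \oo] -->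
    expR (- (1 * k%:R)) * c.
  by apply: cvgM; [exact: (@cvg_disc_pow k succn 1 cvg_succ)|exact: cvg_surv].
rewrite mul1r in h; apply: (cvg_near_eqn _ h); apply: nearW => M.
by rewrite mulrCA.
Qed.

(* [exp (- k) / (exp (- k) + k int_0^1 v^(-1/2) exp (- k v) dv)] is the Laplace
   transform at [k] of [1 + xi]. *)
Definition refuel_laplace k : R :=
  expR (- k%:R) / (expR (- k%:R) + k%:R * sqrt_kernel (- k%:R)).

Lemma sqrt_kernel_ge0 (t : R) : 0 <= sqrt_kernel t.
Proof. by apply: Rintegral_ge0 => v _; rewrite mulr_ge0 ?powR_ge0 ?expR_ge0. Qed.

(** The case [k = 0] matters: there [r = 1], the denominator is the survival probability alone, and
    its positivity for large [M] comes from its asymptotics. *)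
Lemma near_refuel_denom k : \forall M \near \oo, 0 < refuel_denom (N M) M (disc R k M).
Proof.
have h := @cvg_sqrt_surv k; have e0 : 0 < expR (- k%:R) * c by rewrite mulr_gt0// expR_gt0.
move/cvgrPdist_lt : h => /(_ _ e0); have near_pos : \forall M \near \oo, (0 < M)%N by exists 1%N.
move=> near_s; apply: filterS (filterI near_pos near_s) => M [/= M0].
rewrite ltr_distlC subrr => /andP[+ _].
have sM : 0 < Num.sqrt M%:R :> R by rewrite sqrtr_gt0 ltr0n.
rewrite pmulr_rgt0// => h; rewrite /refuel_denom ltr_wpDl//.
rewrite mulr_ge0 ?subr_ge0 ?disc_le1// addr_ge0// mulr_ge0 ?survsum_ge0//.
all: exact/ltW/disc_gt0.
Qed.

(** [1 - (1 - r) * refuel_sum] equals [r ^+ M.+1 * surv M 1] over [refuel_denom]. Multiplying both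
    by [sqrt M] gives finite limits, in whose quotient the constant [c] cancels. *)
Let cvg_refuel_laplace k :
  1 - (1 - disc R k M) * refuel_sum (N M) M (disc R k M) @[M --> \oo] --> refuel_laplace k.
Proof.
pose D : R := k%:R * (c * sqrt_kernel (- k%:R)) + expR (- k%:R) * c.
have D0 : 0 < D.
  by rewrite ltr_wpDl// ?mulr_gt0 ?expR_gt0// !mulr_ge0 ?sqrt_kernel_ge0// ltW.
have h : Num.sqrt M%:R * (disc R k M ^+ M.+1 * surv R (N M) M 1) /
    (Num.sqrt M%:R * ((1 - disc R k M) * (1 + disc R k M * A k M)) +
     Num.sqrt M%:R * (disc R k M ^+ M.+1 * surv R (N M) M 1)) @[M --> \oo] -->
    expR (- k%:R) * c / D.
  apply: cvgM; first exact: cvg_sqrt_surv.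
  apply: cvgV; first by rewrite gt_eqF.
  by apply: cvgD; [exact: cvg_sqrt_denom|exact: cvg_sqrt_surv].
have -> : refuel_laplace k = expR (- k%:R) * c / D.
  rewrite /refuel_laplace /D; have := sqrt_kernel_ge0 (- k%:R); move: (sqrt_kernel _) => s s0.
  have e0 := expR_gt0 (- k%:R : R); move: (expR _) e0 => e e0; move: c c0 => q q0.
  have e1 : 0 < e + k%:R * s by rewrite ltr_pwDl// mulr_ge0.
  field; rewrite !gt_eqF//=.
  have -> : k%:R * (q * s) + e * q = q * (e + k%:R * s) by ring.
  by rewrite mulr_gt0.
apply: (cvg_near_eqn _ h); have near_pos : \forall M \near \oo, (0 < M)%N by exists 1%N.
apply: filterS (filterI near_pos (near_refuel_denom k)) => M [/= M0 d0].
have sM : 0 < Num.sqrt M%:R :> R by rewrite sqrtr_gt0 ltr0n.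
rewrite -mulrDr -/(refuel_denom (N M) M (disc R k M)) /refuel_sum -/(A k M).
have -> : disc R k M ^+ M.+1 * surv R (N M) M 1 =
    refuel_denom (N M) M (disc R k M) - (1 - disc R k M) * (1 + disc R k M * A k M).
  by rewrite /refuel_denom addrC addKr.
move: (refuel_denom _ _ _) d0 => D' D'0.
by field; rewrite !gt_eqF.
Qed.

(** The transform splits according to whether the fuel runs out before the boundary is reached, at
    time [y M], or the walk is refuelled first and an independent life from the boundary is
    added. *)
Lemma cvg_lifesum_laplace k :
  1 - (1 - disc R k M) * lifesum (N M) M (disc R k M) (x M) (y M) @[M --> \oo] -->
  expR (- (u * k%:R)) * (1 - hit_prob) + hit k * refuel_laplace k.
Proof.
have h : disc R k M ^+ y M * surv R (N M) (y M) (x M) +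
    hitsum (N M) (disc R k M) (y M) (x M) *
    (1 - (1 - disc R k M) * refuel_sum (N M) M (disc R k M)) @[M --> \oo] -->
  expR (- (u * k%:R)) * (1 - hit_prob) + hit k * refuel_laplace k.
  apply: cvgD; apply: cvgM.
  - exact: cvg_disc_pow.
  - exact: (cvg_surv_hit hx y_u mZ Z01 Zu hZ).
  - exact: (cvg_hitsum hx y_u mZ Z01 Zu hZ).
  - exact: cvg_refuel_laplace.
apply: (cvg_near_eqn _ h); apply: nearW => M.
by rewrite /lifesum /hitsum; ring.
Qed.

(** At [r = 1], [refuel_sum / M] is the quotient of [(1 + A 0 M) / sqrt M], with limit
    [c * sqrt_kernel 0 = 2 c], by [sqrt M * surv M 1], with limit [c]. This is the origin of the
    mean 2 after a refuelling. *)
Lemma cvg_lifesum_mean :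
  lifesum (N M) M 1 (x M) (y M) / M%:R @[M --> \oo] -->
  \int[Q]_t (- ln (Z t) * (expR (- u) <= Z t)%R%:R) + u * (1 - hit_prob) + hit_prob * 2.
Proof.
have hit0 : hit 0 = hit_prob by apply: eq_Rintegral => t _; rewrite expr0 mul1r.
have h : survsum (N M) (disc R 0 M) (y M) (x M) / M%:R +
    hitsum (N M) (disc R 0 M) (y M) (x M) *
    (((Num.sqrt M%:R)^-1 + A 0 M / Num.sqrt M%:R) / (Num.sqrt M%:R * surv R (N M) M 1)) @[M --> \oo] -->
    \int[Q]_t (- ln (Z t) * (expR (- u) <= Z t)%R%:R) + u * (1 - hit_prob) +
    hit 0 * ((0 + c * sqrt_kernel (- 0%:R)) / c).
  apply: cvgD; first exact: (cvg_survsum_hit hx u0 y_u mZ Z01 Zu hZ).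
  apply: cvgM; first exact: (cvg_hitsum hx y_u mZ Z01 Zu hZ).
  apply: cvgM; first by apply: cvgD; [exact: cvg_sqrt_natV|exact: cvg_survsum].
  by apply: cvgV; [rewrite gt_eqF|exact: cvg_surv].
rewrite hit0 oppr0 sqrt_kernel0 add0r mulrAC divff ?gt_eqF// mul1r in h.
apply: (cvg_near_eqn _ h); have near_pos : \forall M \near \oo, (0 < M)%N by exists 1%N.
apply: filterS (filterI near_pos (near_refuel_denom 0)) => M [/= M0].
rewrite /refuel_denom disc0 subrr mul0r add0r expr1n mul1r => s0.
have sM : 0 < Num.sqrt M%:R :> R by rewrite sqrtr_gt0 ltr0n.
have ME : M%:R = Num.sqrt M%:R ^+ 2 :> R by rewrite sqr_sqrtr// ltW.
rewrite /lifesum /refuel_sum /refuel_denom subrr mul0r add0r expr1n !mul1r /A disc0.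
rewrite [RHS]mulrDl; congr (_ + _); rewrite -[RHS]mulrA; congr (_ * _).
by rewrite [X in _ = _ / X]ME; field; rewrite !gt_eqF.
Qed.

End LifetimeLimit.

(** * Expectation of a product under independence *)

Section Independence.
Context {R : realType} {d} {T : measurableType d} (P : probability T R).
Variables (X Y : {RV P >-> R}).

Definition joint (w : T) : R * R := (X w, Y w).

Let measurable_joint : measurable_fun setT joint.
Proof. by apply/measurable_fun_pairP; split; exact: measurable_funP. Qed.

HB.instance Definition _ := @isMeasurableFun.Build _ _ _ _ joint measurable_joint.

(** Independence says that the joint law agrees with the product law on rectangles; uniqueness of
    the product measure and Tonelli do the rest. *)
Lemma independent_integralM (f g : R -> R) : independent X Y ->
  measurable_fun setT f -> measurable_fun setT g ->
  (forall x, 0 <= f x) -> (forall x, 0 <= g x) ->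
  (\int[P]_w (f (X w) * g (Y w))%:E =
   \int[P]_w (f (X w))%:E * \int[P]_w (g (Y w))%:E)%E.
Proof.
move=> ind mf mg f0 g0.
have mfg : measurable_fun setT (fun z : R * R => (f z.1 * g z.2)%:E).
  apply/measurable_EFinP; apply: measurable_funM.
    exact: (measurableT_comp mf measurable_fst).
  exact: (measurableT_comp mg measurable_snd).
have fg0 (z : R * R) : (0 <= (f z.1 * g z.2)%:E)%E by rewrite lee_fin mulr_ge0.
have E1 : (\int[P]_w (f (X w) * g (Y w))%:E =
    \int[distribution P joint]_z (f z.1 * g z.2)%:E)%E.
  by rewrite ge0_integral_distribution.
have E2 : (\int[distribution P joint]_z (f z.1 * g z.2)%:E =
    \int[distribution P X \x distribution P Y]_z (f z.1 * g z.2)%:E)%E.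
  apply: eq_measure_integral => A mA _.
  by apply: esym; apply: product_measure_unique.
rewrite E1 E2 fubini_tonelli1//.
rewrite /fubini_F /=.
have mf' : measurable_fun setT (EFin \o f) by exact/measurable_EFinP.
have mg' : measurable_fun setT (EFin \o g) by exact/measurable_EFinP.
transitivity (\int[distribution P X]_x ((f x)%:E * \int[distribution P Y]_y (g y)%:E))%E.
  apply: eq_integral => x _; under eq_integral do rewrite EFinM.
  by rewrite ge0_integralZl_EFin// => y _; rewrite lee_fin.
rewrite ge0_integralZr//; last 2 first.
- by move=> x _; rewrite lee_fin.
- by apply: integral_ge0 => y _; rewrite lee_fin.
by congr (_ * _)%E; rewrite ge0_integral_distribution// => z; rewrite lee_fin.
Qed.

End Independence.

(** * Laplace transform and mean of the Darling-Mandelbrot law *)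

Section DarlingMandelbrot.
Context {R : realType} {d} {T : measurableType d} (Q : probability T R).
Variable xi : {RV Q >-> R}.
Hypothesis hxi : darling_mandelbrot xi.

(** For [t < 0] the term [DM_I t] is at most 0, so no negative [t] belongs to the set; if the set
    were empty, [inf] would take the default value 0. Every negative argument is therefore
    admissible in the moment generating function. *)
Lemma DM_t0_ge0 : 0 <= DM_t0 :> R.
Proof.
rewrite /DM_t0; have [->|/set0P[t0 ht0]] := eqVneq [set t : R | expR t - DM_I t <= 0] set0.
  by rewrite inf0.
apply: lb_le_inf; first by exists t0.
move=> t /=; have [//|tlt0] := leP 0 t; rewrite leNgt => /negP[].
rewrite subr_gt0 (le_lt_trans _ (expR_gt0 t))// /DM_I mulr_le0_ge0 ?(ltW tlt0)//.
exact: sqrt_kernel_ge0.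
Qed.

Lemma dm_laplace (s : R) : 0 < s ->
  (\int[Q]_w (expR (- s * xi w))%:E = ((expR (- s) + s * sqrt_kernel (- s))^-1)%:E)%E.
Proof.
move=> s0; have [_ /(_ (- s))] := hxi.
rewrite (lt_le_trans _ DM_t0_ge0) ?oppr_lt0// => /(_ isT).
rewrite /mmt_gen_fun unlock /DM_I mulNr opprK => <-.
by apply: eq_integral => w _ /=; rewrite mulrC.
Qed.

(** Equal to [xi] almost surely but nonnegative everywhere, which makes the bounds on [slope] hold
    pointwise. *)
Let xip (w : T) : R := Num.max 0 (xi w).

Lemma dm_ge0 : {ae Q, forall w, 0 <= xi w}.
Proof.
have [P1 _] := hxi.
have m0 : measurable [set w | 0 <= xi w].
  rewrite -[X in measurable X]setTI.
  have -> : [set w | 0 <= xi w] = xi @^-1` `[0, +oo[.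
    by apply/seteqP; split => w /=; rewrite in_itv/= andbT.
  exact: measurable_funP.
exists (~` [set w | 0 <= xi w]); split => //; first exact: measurableC.
by rewrite probability_setC// P1 subee.
Qed.

Lemma sqrt_kernel_bounds (s : R) : 0 < s -> 2 * expR (- s) <= sqrt_kernel (- s) <= 2.
Proof.
move=> s0; rewrite sqrt_kernelE.
have ig (f : R -> R) : continuous f ->
    (@lebesgue_measure R).-integrable `[0, 1] (EFin \o f).
  move=> cf; apply: continuous_compact_integrable; first exact: segment_compact.
  exact: continuous_subspaceT.
have cstE (c : R) : c = \int[@lebesgue_measure R]_(x in `[0, 1]) c.
  by rewrite Rintegral_cst//= lebesgue_measure_itv/= lte_fin ltr01/= subr0 mulr1.
have igc c := ig (fun=> c) (@cst_continuous _ _ c).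
have igg := ig _ (@continuous_gaussian R (- s)).
apply/andP; split.
  rewrite ler_pM2l// [leLHS]cstE; apply: le_Rintegral => // x /=.
  rewrite in_itv/= => /andP[x0 x1].
  by rewrite ler_expR mulNr lerN2 ler_piMr ?exprn_ile1// ltW.
rewrite -[leRHS]mulr1 ler_pM2l// [leRHS]cstE; apply: le_Rintegral => // x /=.
rewrite in_itv/= => /andP[x0 x1].
by rewrite -[leRHS]expR0 ler_expR mulNr oppr_le0 mulr_ge0 ?sqr_ge0// ltW.
Qed.

(** Difference quotient at 0 of the Laplace variable: it lies between 0 and [xip] and converges to
    [xip]. *)
Let slope (n : nat) (w : T) : R := (1 - expR (- n.+1%:R^-1 * xip w)) * n.+1%:R.

Let mxip : measurable_fun setT xip.
Proof. by apply: measurable_maxr => //; exact: measurable_funP. Qed.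

Let xip_ge0 w : 0 <= xip w. Proof. by rewrite /xip le_max lexx. Qed.

Let xip_ae : ae_eq Q setT (EFin \o xip) (EFin \o xi).
Proof. by apply: filterS dm_ge0 => w xi0 _; rewrite /= /xip max_r. Qed.

Let slope_integral n : (\int[Q]_w (slope n w)%:E =
  ((1 - (expR (- n.+1%:R^-1) + n.+1%:R^-1 * sqrt_kernel (- n.+1%:R^-1))^-1) * n.+1%:R)%:E)%E.
Proof.
pose s : R := n.+1%:R^-1; have s0 : 0 < s by rewrite invr_gt0.
pose e (w : T) := expR (- s * xip w).
have me : measurable_fun setT e by apply: measurableT_comp => //; exact: measurable_funM.
have ie : Q.-integrable setT (EFin \o e).
  apply: (@integrable_bounded _ _ _ Q e 1) => // w.
  by rewrite ger0_norm ?expR_ge0// -[leRHS]expR0 ler_expR mulNr oppr_le0 mulr_ge0 ?xip_ge0// ltW.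
have i1 : Q.-integrable setT (EFin \o (fun=> 1 : R)) by exact: finite_measure_integrable_cst.
have intE : (\int[Q]_w (e w)%:E = ((expR (- s) + s * sqrt_kernel (- s))^-1)%:E)%E.
  rewrite -dm_laplace//; apply: ae_eq_integral => //.
  - exact/measurable_EFinP.
  - by apply/measurable_EFinP; apply: measurableT_comp => //; exact: measurable_funM.
  - by apply: filterS dm_ge0 => w xi0 _; rewrite /e /xip max_r.
under eq_integral do rewrite /slope mulrC EFinM.
rewrite integralZl//; last exact: (integrableB measurableT i1 ie).
rewrite (integralB_EFin measurableT i1 ie) intE.
have -> : (\int[Q]_w 1%:E = 1 :> \bar R)%E.
  by rewrite integral_cst// mul1e; exact: probability_setT.
by rewrite -EFinB -EFinM mulrC.
Qed.

(** With [D = exp (- 1 / M)] and [J] the kernel, the expression is [(J - M (1 - D)) / (D + J / M)],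
    whose limit is [2 - 1] over 1. *)
Let slope_cvg1 :
  (1 - (expR (- n.+1%:R^-1) + n.+1%:R^-1 * sqrt_kernel (- n.+1%:R^-1))^-1) * n.+1%:R
  @[n --> \oo] --> (1 : R).
Proof.
pose f (M : nat) : R := (1 - (expR (- M%:R^-1) + M%:R^-1 * sqrt_kernel (- M%:R^-1))^-1) * M%:R.
rewrite (cvg_shiftS f).
have discE M : expR (- M%:R^-1) = disc R 1 M by rewrite /disc div1r.
have cJ : sqrt_kernel (- M%:R^-1) @[M --> \oo] --> (2 : R).
  apply: (@squeeze_cvgr _ _ _ _ (fun M => 2 * disc R 1 M) (fun=> 2)).
  - near=> M; have M0 : (0 : R) < M%:R^-1 by rewrite invr_gt0 ltr0n; near: M; exists 1%N.
    by rewrite -discE; exact: sqrt_kernel_bounds.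
  - by rewrite -[X in _ --> X]mulr1; apply: cvgMr; exact: cvg_disc.
  - exact: cvg_cst.
have cD : disc R 1 M + 1 / M%:R * sqrt_kernel (- M%:R^-1) @[M --> \oo] --> (1 + 0 * 2 : R).
  by apply: cvgD; [exact: cvg_disc|apply: cvgM => //; exact: cvg_natr_div].
have h : (sqrt_kernel (- M%:R^-1) - M%:R * (1 - disc R 1 M)) /
    (disc R 1 M + 1 / M%:R * sqrt_kernel (- M%:R^-1)) @[M --> \oo] --> ((2 - 1%:R) / (1 + 0 * 2) : R).
  apply: cvgM; last by apply: cvgV => //; rewrite mul0r addr0 oner_neq0.
  by apply: cvgB => //; exact: cvg_disc_rate.
have <- : (2 - 1%:R) / (1 + 0 * 2) = 1 :> R by rewrite mul0r addr0 divr1; ring.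
apply: (cvg_near_eqn _ h); near=> M.
have M0 : (0 : R) < M%:R by rewrite ltr0n; near: M; exists 1%N.
have d0 := disc_gt0 R 1 M; have J0 := sqrt_kernel_ge0 (- M%:R^-1 : R).
rewrite /f discE; move: (disc R 1 M) d0 (sqrt_kernel _) J0 => D D0 J J0.
field; rewrite !gt_eqF//=.
by rewrite ltr_wpDr// mulr_gt0.
Unshelve. all: by end_near. Qed.

Let slope_le n w : slope n w <= xip w.
Proof.
rewrite /slope -ler_pdivlMr// lerBlDr -lerBlDl.
apply: le_trans (expR_ge1Dx _); rewrite le_eqVlt; apply/orP; left; apply/eqP; ring.
Qed.

Let slope_ge0 n w : 0 <= slope n w.
Proof.
by rewrite mulr_ge0// subr_ge0 -[leRHS]expR0 ler_expR mulNr oppr_le0 mulr_ge0 ?xip_ge0.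
Qed.

Let mslope n : measurable_fun setT (slope n).
Proof.
apply: measurable_funM => //; apply: measurable_funB => //.
by apply: measurableT_comp => //; exact: measurable_funM.
Qed.

Let slope_cvg w : slope n w @[n --> \oo] --> xip w.
Proof.
have [x0|] := eqVneq (xip w) 0.
  rewrite x0 (_ : (fun n => slope n w) = cst 0); first exact: cvg_cst.
  by apply/funext => n; rewrite /slope x0 mulr0 expR0 subrr mul0r.
move=> xn0; have x0 : 0 < xip w by rewrite lt_neqAle eq_sym xn0 xip_ge0.
apply: (@squeeze_cvgr _ _ _ _ (fun n => xip w / (1 + xip w / n.+1%:R)) (fun=> xip w)).
- apply: nearW => n; rewrite slope_le andbT /slope.
  have y0 : 0 < n.+1%:R^-1 * xip w by rewrite mulr_gt0// invr_gt0.
  have h : expR (- n.+1%:R^-1 * xip w) <= (1 + n.+1%:R^-1 * xip w)^-1.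
    by rewrite mulNr expRN lef_pV2 ?posrE ?expR_gt0 ?addr_gt0// expR_ge1Dx.
  rewrite -ler_pdivrMr// lerBrDr -lerBrDl (le_trans h)//.
  rewrite le_eqVlt; apply/orP; left; apply/eqP; field.
  by rewrite !gt_eqF//= ?ltr_wpDl// addr_gt0.
- suff : xip w / (1 + xip w / n.+1%:R) @[n --> \oo] --> (xip w / (1 + 0) : R).
    by rewrite addr0 divr1.
  apply: cvgM; first exact: cvg_cst.
  apply: cvgV; first by rewrite addr0 oner_neq0.
  apply: cvgD; first exact: cvg_cst.
  by rewrite (cvg_shiftS (fun n => xip w / n%:R)); exact: cvg_natr_div.
- exact: cvg_cst.
Qed.

(** The integrals of the difference quotients tend to 1. Fatou's lemma bounds the mean above by this
    limit, and [slope <= xip] bounds it below. *)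
Lemma dm_expectation : ('E_Q[xi] = 1)%E.
Proof.
rewrite unlock; transitivity (\int[Q]_w (xip w)%:E)%E.
  apply: ae_eq_integral => //; [exact/measurable_EFinP|exact/measurable_EFinP|].
  by apply: filterS xip_ae => w h /h.
have lim1 : (\int[Q]_w (slope n w)%:E @[n --> \oo] --> 1)%E.
  by under eq_fun do rewrite slope_integral; apply: cvg_EFin => //; exact: nearW.
apply/eqP; rewrite eq_le; apply/andP; split.
  have -> : (\int[Q]_w (xip w)%:E = \int[Q]_w limn_einf (fun n => (slope n w)%:E))%E.
    apply: eq_integral => w _.
    have h : ((slope n w)%:E @[n --> \oo] --> (xip w)%:E)%E.
      by apply: cvg_EFin; [exact: nearW|exact: slope_cvg].
    rewrite is_cvg_limn_einfE; first by apply/esym; exact: cvg_lim h.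
    by apply/cvg_ex; exists (xip w)%:E.
  apply: le_trans (fatou _ measurableT _ _) _ => //.
  - by move=> n; exact/measurable_EFinP.
  - by move=> n w _; rewrite lee_fin.
  - rewrite is_cvg_limn_einfE; last by apply/cvg_ex; exists 1%E.
    by rewrite (cvg_lim _ lim1).
rewrite -(cvg_lim _ lim1)//; apply: lime_le; first by apply/cvg_ex; exists 1%E.
apply: nearW => n; apply: ge0_le_integral => //.
- by move=> w _; rewrite lee_fin.
- exact/measurable_EFinP.
- exact/measurable_EFinP.
- by move=> w _; rewrite lee_fin.
Qed.

End DarlingMandelbrot.

(** * Distribution function and mean of the lifetime for fixed [M] *)

Section LifetimeLaw.
Context {R : realType} {d} {T : measurableType d} (P : probability T R).
Variables (N : enat) (M : nat).
Variable zeta : nat -> {RV P >-> (nat * nat)%type}.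
Hypothesis N2 : if N is Some m then (2 <= m)%N else true.
Variable z0 : nat * nat.
Hypothesis chain : is_chain N M z0 zeta.
Hypothesis sz : site N z0.1.

Let survives n := [set w | forall k, (k <= n)%N -> ~~ dead N (zeta k w)].

Let survives_prob n : P (survives n) = (alive R N M n z0.1 z0.2)%:E.
Proof. exact: chain_survival. Qed.

Let msurvives n : measurable (survives n).
Proof.
rewrite (_ : survives n = \bigcap_k [set w | (k <= n)%N -> ~~ dead N (zeta k w)]).
  apply: bigcap_measurable; first by exists 0%N.
  by move=> k _; exact: (measurable_state zeta k (fun z => (k <= n)%N -> ~~ dead N z)).
by apply/seteqP; split => w h => [k _|k] /=; exact: h.
Qed.

Let lifetime_lbP n w : ((n%:R)%:E < lifetime (R := R) N zeta w)%E <-> survives n w.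
Proof.
split.
  move=> h k kn; apply/negP => /andP[d1 /eqP d2]; move: h; rewrite ltNge => /negP; apply.
  apply: (@le_trans _ _ k%:R%:E); last by rewrite lee_fin ler_nat.
  by apply: ereal_inf_lbound; exists k.
move=> h; apply: (@lt_le_trans _ _ n.+1%:R%:E); first by rewrite lte_fin ltr_nat.
apply/ereal_infP => _ [k [d1 d2] <-]; rewrite lee_fin ler_nat ltnNge.
by apply/negP => /h; rewrite /dead d1 d2.
Qed.

Lemma lifetime_ge0 w : (0 <= lifetime (R := R) N zeta w)%E.
Proof. by apply/ereal_infP => _ [k _ <-]; rewrite lee_fin. Qed.

(** The lifetime is an integer or infinite, so exceeding [r * M] is the same as surviving up to its
    integer part. *)
Lemma lifetime_cdf (r : R) : (0 < M)%N -> 0 <= r ->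
  P [set w | (lifetime N zeta w / M%:R%:E <= r%:E)%E] =
  (1 - alive R N M (Num.truncn (r * M%:R)) z0.1 z0.2)%:E.
Proof.
move=> M0 r0; have MR : (0 : R) < M%:R by rewrite ltr0n.
have invE : ((M%:R%:E)^-1 = (M%:R^-1)%:E :> \bar R)%E by rewrite inver gt_eqF.
set n := Num.truncn _.
rewrite (_ : [set w | _] = ~` survives n).
  by rewrite probability_setC// EFinB survives_prob.
have nat_lt w : ((n%:R)%:E < lifetime (R := R) N zeta w)%E <->
    ((r * M%:R)%:E < lifetime N zeta w)%E.
  split; last first.
    by apply: le_lt_trans; rewrite lee_fin truncn_le mulr_ge0// ltW.
  move/lifetime_lbP => h; apply: (@lt_le_trans _ _ n.+1%:R%:E).
    by rewrite lte_fin truncnS_gt.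
  apply/ereal_infP => _ [k [d1 d2] <-]; rewrite lee_fin ler_nat ltnNge.
  by apply/negP => /h; rewrite /dead d1 d2.
apply/seteqP; split => w /=.
  move=> h /lifetime_lbP/nat_lt; rewrite ltNge => /negP; apply.
  by rewrite EFinM -lee_pdivrMr// -invE.
move=> h; rewrite invE lee_pdivrMr// -EFinM leNgt; apply/negP => /nat_lt/lifetime_lbP.
exact: h.
Qed.

(** The lifetime is the sum over [k] of the indicators of surviving up to time [k], also when it is
    infinite; monotone convergence exchanges sum and expectation. *)
Lemma lifetime_mean (L : R) : alivesum N M 1 n z0.1 z0.2 @[n --> \oo] --> L ->
  (\int[P]_w lifetime (R := R) N zeta w = L%:E)%E.
Proof.
move=> cL.
pose f (n : nat) (w : T) : \bar R := (\sum_(k < n) \1_(survives k) w)%:E.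
have mf n : measurable_fun setT (f n).
  by apply/measurable_EFinP; apply: measurable_sum => k; exact: measurable_indic.
have f_int n : (\int[P]_w f n w = (alivesum N M 1 n z0.1 z0.2)%:E)%E.
  rewrite /f; under eq_integral do rewrite -sumEFin.
  have mi (k : 'I_n) : measurable_fun setT (fun w => (\1_(survives k) w)%:E : \bar R).
    by apply/measurable_EFinP; exact: measurable_indic.
  rewrite ge0_integral_sum//.
  rewrite /alivesum -sumEFin; apply: eq_bigr => k _.
  by rewrite integral_indic// setIT expr1n mul1r; exact: survives_prob.
have f_nd w : nondecreasing_seq (f ^~ w).
  apply/nondecreasing_seqP => n; rewrite lee_fin big_ord_recr/= lerDl.
  by rewrite indicE.
have f_cvg w : f n w @[n --> \oo] --> lifetime N zeta w.
  have [[k0 dk0]|nod] := pselect (exists k, dead N (zeta k w)).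
    have exk : exists k, dead N (zeta k w) by exists k0.
    pose m := ex_minn exk.
    have [dm mm] : dead N (zeta m w) /\ forall k, dead N (zeta k w) -> (m <= k)%N.
      by rewrite /m; case: ex_minnP.
    have -> : lifetime (R := R) N zeta w = m%:R%:E.
      apply/eqP; rewrite eq_le; apply/andP; split.
        by apply: ereal_inf_lbound; exists m => //; move/andP: dm => [? /eqP].
      apply/ereal_infP => _ [k [d1 d2] <-]; rewrite lee_fin ler_nat mm//.
      by rewrite /dead d1 d2.
    apply: cvg_near_cst; exists m => // n /= mn; congr EFin.
    have sE k : \1_(survives k) w = (k < m)%N%:R :> R.
      rewrite indicE; congr (_%:R); congr nat_of_bool; apply/idP/idP.
        by rewrite inE => h; rewrite ltnNge; apply/negP => /h; rewrite dm.
      move=> km; rewrite inE => j jk; apply/negP => /mm.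
      by rewrite leqNgt (leq_ltn_trans jk km).
    under eq_bigr do rewrite sE.
    rewrite -(big_mkord xpredT (fun k => (k < m)%N%:R)) (big_cat_nat (n := m))//=.
    rewrite [X in _ + X]big_nat_cond [X in _ + X]big1 ?addr0; last first.
      by move=> k; rewrite andbT => /andP[mk _]; rewrite ltnNge mk.
    rewrite big_mkord (eq_bigr (fun=> 1)) ?sumr_const ?card_ord//.
    by move=> k _; rewrite ltn_ord.
  have -> : lifetime (R := R) N zeta w = +oo%E.
    rewrite /lifetime (_ : [set n | _] = set0) ?image_set0 ?ereal_inf0//.
    apply/seteqP; split => // n [d1 d2]; apply: nod; exists n.
    by rewrite /dead d1 d2.
  rewrite (_ : f ^~ w = fun n => n%:R%:E); last first.
    apply/funext => n; congr EFin; rewrite (eq_bigr (fun=> 1)) ?sumr_const ?card_ord//.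
    move=> k _; rewrite indicE mem_set// => j _.
    by apply/negP => dj; apply: nod; exists j.
  by apply/cvgeryP; exact: cvgr_idn.
have lim1 : (\int[P]_w f n w @[n --> \oo] --> \int[P]_w lifetime (R := R) N zeta w)%E.
  have -> : (\int[P]_w lifetime (R := R) N zeta w = \int[P]_w limn (f ^~ w))%E.
    by apply: eq_integral => w _; apply/esym/cvg_lim => //; exact: f_cvg.
  apply: cvg_monotone_convergence => //.
  by move=> n w _; rewrite lee_fin sumr_ge0// => k _; rewrite indicE.
have lim2 : (\int[P]_w f n w @[n --> \oo] --> L%:E)%E.
  by under eq_fun do rewrite f_int; apply: cvg_EFin => //; exact: nearW.
by apply: (cvg_unique _ lim1 lim2); exact: ereal_hausdorff.
Qed.

End LifetimeLaw.

(** * Expectations of functions of the Levy variable *)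

Section LevyVariable.
Context {R : realType} {d} {T : measurableType d} (Q : probability T R).
Variable tau : {RV Q >-> R}.
Hypothesis htau : levy_distributed tau.
Notation mu := (@lebesgue_measure R).

Lemma levy_pdf_eq0 (t : R) : t <= 0 -> levy_pdf t = 0.
Proof. by rewrite /levy_pdf leNgt => /negbTE ->. Qed.

Lemma measurable_levy_pdf : measurable_fun [set: measurableTypeR R] (@levy_pdf R).
Proof.
have m0 : measurable (`]0%R, +oo[%classic : set (measurableTypeR R)) by [].
have -> : @levy_pdf R = (@levy_pdf R) \_ (`]0%R, +oo[%classic : set (measurableTypeR R)).
  apply/funext => t; rewrite patchE; case: ifPn => //.
  rewrite notin_setE /= in_itv/= andbT => /negP; rewrite -leNgt.
  exact: levy_pdf_eq0.
apply/(measurable_restrictT _ m0); apply: open_continuous_measurable_fun => // x.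
by rewrite inE/= in_itv/= andbT; exact: continuous_levy_pdf.
Qed.

(* [lebesgue_measure] lives on [measurableTypeR R], whose display differs from
   that of the canonical structure on [R]. *)
Let tauR : T -> measurableTypeR R := tau.

Let measurable_tauR : measurable_fun setT tauR.
Proof. exact: (measurable_funP tau). Qed.

HB.instance Definition _ :=
  @isMeasurableFun.Build _ _ T (measurableTypeR R) tauR measurable_tauR.

(** The law of [tau] is dominated by Lebesgue measure; its Radon-Nikodym derivative has the same
    integrals as [levy_pdf] over all measurable sets, hence equals it almost everywhere. *)
Lemma levy_expectation (F : R -> R) (B : R) : measurable_fun setT F ->
  (forall t, 0 <= F t <= B) ->
  (\int[Q]_w (F (tau w))%:E = \int[mu]_(t in `]0%R, +oo[) (F t * levy_pdf t)%:E)%E.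
Proof.
move=> mF F0B.
have mF' : measurable_fun [set: measurableTypeR R] (EFin \o F) by exact/measurable_EFinP.
have F0 t : 0 <= F t by have /andP[] := F0B t.
pose nu := distribution Q tauR.
have dom : nu `<< mu.
  apply/null_content_dominatesP => A mA muA0.
  rewrite [LHS]htau//; apply: null_set_integral => //.
  apply/measurable_EFinP; apply: measurable_funTS; exact: measurable_levy_pdf.
have iF : nu.-integrable setT (EFin \o F).
  apply: (@integrable_bounded _ _ _ nu F B) => // t.
  by have /andP[f0 fB] := F0B t; rewrite ger0_norm.
rewrite -[LHS](@ge0_integral_distribution _ _ _ _ _ Q tauR (EFin \o F))//.
rewrite -(Radon_Nikodym_change_of_variables dom measurableT iF).
transitivity (\int[mu]_t (F t * levy_pdf t)%:E)%E.
  apply: ae_eq_integral => //.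
  - apply: emeasurable_funM; first exact: mF'.
    apply: (measurable_int mu); exact: Radon_Nikodym_integrable.
  - apply/measurable_EFinP; apply: measurable_funM => //; exact: measurable_levy_pdf.
  change (fun t => (F t * levy_pdf t)%:E) with ((EFin \o F) \* (EFin \o @levy_pdf R))%E.
  apply: ae_eqe_mul2l => /=.
  rewrite Radon_NikodymE.
  case: cid => /= h [h1 h2 h3].
  apply: integral_ae_eq => //=.
  + by apply/measurable_EFinP; exact: measurable_levy_pdf.
  + by move=> E E01 mE; rewrite -h3//=; exact: htau.
rewrite [RHS]integral_mkcond; apply: eq_integral => t _.
rewrite patchE; case: ifPn => //.
rewrite notin_setE /= in_itv/= andbT => /negP; rewrite -leNgt => t0.
by rewrite levy_pdf_eq0// mulr0.
Qed.

End LevyVariable.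

Lemma eq_integral_patch {d} {T : measurableType d} {R : realType}
  (m : {measure set T -> \bar R}) (A B : set T) (f g : T -> \bar R) :
  (forall t, A t -> B t -> f t = g t) -> (forall t, A t -> ~ B t -> f t = 0%E) ->
  (forall t, B t -> ~ A t -> g t = 0%E) ->
  (\int[m]_(t in A) f t = \int[m]_(t in B) g t)%E.
Proof.
move=> fg f0 g0; rewrite integral_mkcond [RHS]integral_mkcond.
apply: eq_integral => t _; rewrite !patchE.
have [At|At] := boolP (t \in A); have [Bt|Bt] := boolP (t \in B) => //.
- by apply: fg; exact: set_mem.
- by apply: f0; [exact: set_mem | move=> /mem_set; exact/negP].
- by apply/esym/g0; [exact: set_mem | move=> /mem_set; exact/negP].
Qed.

(** * The variable [exp (- a tau)] and its truncated integrals *)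

Section Discount.
Context {R : realType} {d} {T : measurableType d} (Q : probability T R).
Variable tau : {RV Q >-> R}.
Hypothesis htau : levy_distributed tau.
Notation mu := (@lebesgue_measure R).

(* [exp (- a t)], with value 0 at [a = +oo]. *)
Definition discount (a : \bar R) (t : R) : R :=
  if a is r%:E then expR (- (r * Num.max 0 t)) else 0.

Lemma measurable_discount a : measurable_fun setT (discount a).
Proof.
case: a => [r| |] /=; [|exact: measurable_cst..].
apply: measurableT_comp => //; apply: measurableT_comp => //; apply: measurable_funM => //.
by apply: measurable_maxr => //; exact: measurable_id.
Qed.

(** The maximum with 0 inside [discount] makes this true for every [t], whereas [tau] is positive
    only almost surely. *)
Lemma discount01 (a : \bar R) t : (0 <= a)%E -> 0 <= discount a t <= 1.
Proof.
case: a => [r r0| _|_] /=; rewrite ?lexx ?ler01//.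
rewrite expR_ge0/= -[leRHS]expR0 ler_expR oppr_le0 mulr_ge0//.
by rewrite le_max lexx.
Qed.

Lemma levy_gt0 : {ae Q, forall w, 0 < tau w}.
Proof.
exists (tau @^-1` `]-oo, 0%R]); split.
- by rewrite -[X in measurable X]setTI; exact: measurable_funP.
- have /= := @htau `]-oo, 0%R]%classic; rewrite /distribution /pushforward => -> //.
  apply: integral0_eq => t; rewrite /= in_itv/= => t0.
  by rewrite levy_pdf_eq0.
- by move=> w /= /negP; rewrite -leNgt in_itv.
Qed.

Lemma levy_atom c : Q (tau @^-1` [set c]) = 0%E.
Proof.
have /= := @htau [set c]; rewrite /distribution /pushforward => -> //.
by rewrite integral_set1.
Qed.

Lemma discount_atom (a : \bar R) u : (0 <= a)%E -> 0 < u ->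
  Q ((discount a \o tau) @^-1` [set expR (- u)]) = 0%E.
Proof.
move=> a0 u0.
apply: (@subset_measure0 _ _ _ Q _ (if a is r%:E then tau @^-1` [set u / r] else set0)).
- rewrite -[X in measurable X]setTI.
  by apply: (measurableT_comp (measurable_discount a) (measurable_funP tau)).
- by case: (a).
- case: a a0 => [r r0| _|//] w /=; last first.
    by move/esym/eqP; rewrite gt_eqF// expR_gt0.
  move=> /expR_inj/oppr_inj h.
  have [t0|t0] := leP (tau w) 0.
    by move: h; rewrite max_l// mulr0 => u0'; move: u0; rewrite -u0' ltxx.
  move: h; rewrite max_r ?(ltW t0)// => h; rewrite -h mulrAC divff ?mul1r//.
  by apply/eqP => r00; move: u0; rewrite -h r00 mul0r ltxx.
- by case: (a) => [r| |] //=; exact: levy_atom.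
Qed.

(** The Levy transform at [b = sqrt (2 k r)], for which [b^2 / 2 = k r]; since [b > 0] is required
    there, [r = 0] is treated apart. The value is the limit found for the harmonic function. *)
Lemma discount_power_integral (r : R) k : (0 < k)%N -> 0 <= r ->
  \int[Q]_w (discount r%:E (tau w) ^+ k) = expR (- Num.sqrt (2 * k%:R * r)).
Proof.
move=> k0 r0; have kR : (0 : R) < k%:R by rewrite ltr0n.
have [->|rn0] := eqVneq r 0.
  rewrite mulr0 sqrtr0 oppr0 expR0; under eq_Rintegral do rewrite /= mul0r oppr0 expR0 expr1n.
  rewrite Rintegral_cst// mul1r -[RHS]/(fine 1%E); congr fine; exact: probability_setT.
have rp : 0 < r by rewrite lt_neqAle eq_sym rn0.
have bp : 0 < Num.sqrt (2 * k%:R * r) by rewrite sqrtr_gt0 !mulr_gt0.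
rewrite /Rintegral (@levy_expectation _ _ _ _ _ htau (fun t => discount r%:E t ^+ k) 1).
- have -> : expR (- Num.sqrt (2 * k%:R * r)) = fine (expR (- Num.sqrt (2 * k%:R * r)))%:E by [].
  rewrite -levy_laplace//; congr fine; apply: eq_integral => t.
  rewrite inE/= in_itv/= andbT => t0; rewrite max_r ?(ltW t0)// mulrC -expRM_natl.
  congr (_ * expR _)%:E; rewrite sqr_sqrtr; first by field.
  by rewrite !mulr_ge0.
- by apply: measurable_funX; exact: measurable_discount.
- move=> t; have /andP[z0 z1] := discount01 t (r0 : (0 <= r%:E)%E).
  by rewrite exprn_ge0//= exprn_ile1.
Qed.

Let hit a u w : R := (expR (- u) <= discount a (tau w))%R%:R.

Let hit_le (r u t : R) : 0 < r -> 0 < t ->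
  (expR (- u) <= discount r%:E t) = (t <= u / r).
Proof.
by move=> r0 t0; rewrite /= max_r ?(ltW t0)// ler_expR lerN2 ler_pdivlMr// mulrC.
Qed.

Let measurable_hit a u : measurable_fun setT
  (fun t => (expR (- u) <= discount a t)%R%:R : R).
Proof.
apply: (measurableT_comp (f := fun b : bool => b%:R : R)) => //.
exact: (measurable_fun_ler (measurable_cst _) (measurable_discount a)).
Qed.

Let sqrt_div (r u : R) : 0 < r -> 0 < u -> (Num.sqrt (u / r))^-1 = Num.sqrt (r / u).
Proof. by move=> r0 u0; rewrite -sqrtrV ?divr_ge0 ?(ltW r0) ?(ltW u0)// invf_div. Qed.

Lemma hit_probE (r u : R) : 0 < r -> 0 < u ->
  \int[Q]_w hit r%:E u w = 2 * Phibar (Num.sqrt (r / u)).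
Proof.
move=> r0 u0; have ur0 : 0 < u / r by rewrite divr_gt0.
rewrite /Rintegral (@levy_expectation _ _ _ _ _ htau
  (fun t => (expR (- u) <= discount r%:E t)%R%:R) 1).
- rewrite -sqrt_div// -[RHS]/(fine (2 * Phibar (Num.sqrt (u / r))^-1)%:E) -levy_cdf//.
  congr fine; apply: eq_integral_patch => t; rewrite /= !in_itv/= andbT.
  + by move=> t0 /andP[_ tle]; have := hit_le u r0 t0; rewrite /= => ->; rewrite tle mul1r.
  + by move=> t0; rewrite t0/= => /negP/negbTE tle; have := hit_le u r0 t0;
      rewrite /= => ->; rewrite tle mul0r.
  + by move=> /andP[t0 _] /(_ t0).
- exact: measurable_hit.
- by move=> t; case: (expR (- u) <= discount _ t); rewrite ?lexx ?ler01.
Qed.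

Lemma hit_momentE (r u : R) : 0 < r -> 0 < u ->
  \int[Q]_w (- ln (discount r%:E (tau w)) * hit r%:E u w) =
  Num.sqrt (2 * r * u / pi) * expR (- (r / (2 * u))) - 2 * r * Phibar (Num.sqrt (r / u)).
Proof.
move=> r0 u0; have ur0 : 0 < u / r by rewrite divr_gt0.
rewrite /Rintegral (@levy_expectation _ _ _ _ _ htau
  (fun t => - ln (discount r%:E t) * (expR (- u) <= discount r%:E t)%R%:R) u); last 2 first.
- apply: measurable_funM; last exact: measurable_hit.
  apply: measurableT_comp => //; apply: measurableT_comp => //; exact: measurable_discount.
- move=> t; rewrite /= expRK opprK ler_expR lerN2; have m0 : 0 <= r * Num.max 0 t.
    by rewrite mulr_ge0 ?(ltW r0)// le_max lexx.
  by case: (leP (r * Num.max 0 t) u) => h; rewrite ?mulr1 ?mulr0 ?m0 ?h ?lexx ?(ltW u0).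
have -> : Num.sqrt (2 * r * u / pi) * expR (- (r / (2 * u))) - 2 * r * Phibar (Num.sqrt (r / u)) =
    r * (Num.sqrt (2 * (u / r) / pi) * expR (- (2 * (u / r))^-1) - 2 * Phibar (Num.sqrt (u / r))^-1).
  rewrite sqrt_div// mulrBr; congr (_ - _); last by ring.
  rewrite [RHS]mulrA; congr (_ * expR _); last by field; rewrite !gt_eqF.
  rewrite -{2}(gtr0_norm r0) -sqrtr_sqr -sqrtrM ?sqr_ge0//; congr Num.sqrt.
  by move: (pi) (@pi_gt0 R) => p p0; field; rewrite !gt_eqF.
rewrite -[RHS]/(fine (r * _)%:E) EFinM -levy_moment// -ge0_integralZl_EFin ?ltW//; last 2 first.
- by move=> t; rewrite /= in_itv/= lee_fin => /andP[t0 _]; rewrite mulr_ge0 ?levy_pdf_ge0// ltW.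
- apply/measurable_EFinP; apply: measurable_funTS; apply: measurable_funM => //.
  exact: measurable_levy_pdf.
congr fine; apply: eq_integral_patch => t; rewrite /= !in_itv/= andbT.
- move=> t0 /andP[_ tle]; have := hit_le u r0 t0; rewrite /= => ->; rewrite tle.
  by rewrite max_r ?(ltW t0)// expRK opprK mulr1 -EFinM mulrA.
- move=> t0; rewrite t0/= => /negP/negbTE tle; have := hit_le u r0 t0.
  by rewrite /= => ->; rewrite tle mulr0 mul0r.
- by move=> /andP[t0 _] /(_ t0).
Qed.

End Discount.

(** * Identification of the limiting mean with [g] *)

Section MeanFormula.
Context {R : realType} {d} {T : measurableType d} (Q : probability T R).
Variable tau : {RV Q >-> R}.
Hypothesis htau : levy_distributed tau.

(** [Phibar x + Phibar (- x)] has derivative 0, the density being even, and its limit at infinity is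
    1. *)
Lemma Phibar0 : Phibar 0 = 2^-1 :> R.
Proof.
pose h (x : R) := Phibar x + Phibar (- x).
have dh (x : R) : is_derive x 1 h 0.
  have d2 := @is_derive1_comp R (@Phibar R) -%R x _ _ (is_derive_Phibar _) (is_deriveNid x 1).
  apply: (is_derive_eq (is_deriveD (is_derive_Phibar x) d2)).
  by rewrite !normal_pdf01E sqrrN mulrN1 opprK addrC subrr.
have hcst x : h x = h 0 by exact: is_derive_0_is_cst.
have h1 : h x @[x --> +oo%R] --> (0 + 1 : R).
  apply: cvgD; first exact: cvg_Phibary.
  exact: (cvgNy_compNP _ _).1 (@cvg_PhibarNy R).
have : h 0 = 0 + 1.
  apply: (cvg_unique _ _ h1) => //.
  by rewrite (funext hcst : h = cst (h 0)); exact: cvg_cst.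
by rewrite /h oppr0; lra.
Qed.

Let Z a w := discount a (tau w).
Let hit a u w : R := (expR (- u) <= Z a w)%R%:R.

Let measurable_Z a : measurable_fun setT (Z a).
Proof. by apply: measurableT_comp; [exact: measurable_discount|exact: measurable_funP]. Qed.

Let measurable_hit a u : measurable_fun setT (hit a u).
Proof.
apply: (measurableT_comp (f := fun b : bool => b%:R : R)) => //.
exact: (measurable_fun_ler (measurable_cst _) (measurable_Z a)).
Qed.

Let Rint_cst (k : R) : \int[Q]_w k = k.
Proof. by rewrite Rintegral_cst// -[RHS]mulr1 -[RHS]/(k * fine 1%E); congr (k * fine _); exact: probability_setT. Qed.

(** On the hitting event [Z] lies between [exp (- u)] and 1, so [- ln Z] lies between 0 and [u]. *)
Lemma hit_moment_bounds (r u : R) : 0 < r -> 0 < u ->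
  0 <= \int[Q]_w (- ln (Z r%:E w) * hit r%:E u w) <= u * \int[Q]_w hit r%:E u w.
Proof.
move=> r0 u0.
have Z0 w : 0 < Z r%:E w <= 1.
  have /andP[_ ->] := discount01 (tau w) (ltW r0 : (0 <= r%:E)%E).
  by rewrite expR_gt0.
have bnd w : 0 <= - ln (Z r%:E w) * hit r%:E u w <= u * hit r%:E u w.
  rewrite /hit; case: (leP (expR (- u)) (Z r%:E w)) => h; last by rewrite !mulr0 lexx.
  have /andP[z0 z1] := Z0 w.
  rewrite !mulr1 oppr_ge0 ln_le0//= lerNl -[leLHS]expRK ler_ln ?posrE// expR_gt0//.
have mh := measurable_hit r%:E u.
have ih : Q.-integrable setT (EFin \o hit r%:E u).
  apply: (@integrable_bounded _ _ _ _ _ 1) => // w.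
  by rewrite /hit; case: (expR (- u) <= Z r%:E w); rewrite ?normr1 ?normr0.
rewrite Rintegral_ge0 ?andTb; last by move=> w _; have /andP[] := bnd w.
rewrite -RintegralZl//; apply: le_Rintegral => //.
- apply: (@integrable_bounded _ _ _ _ _ u).
    apply: measurable_funM => //; apply: measurableT_comp => //.
    exact: (measurableT_comp (@measurable_ln R) (measurable_Z _)).
  move=> w; have /andP[b0 b1] := bnd w; rewrite ger0_norm// (le_trans b1)//.
  rewrite ler_piMr ?(ltW u0)// /hit.
  by case: (expR (- u) <= Z r%:E w); rewrite ?lexx ?ler01.
- by apply: (integrableZl measurableT u ih).
- by move=> w _; have /andP[] := bnd w.
Qed.

Lemma mean_g_fin (r u : R) : 0 < r -> 0 < u ->
  \int[Q]_w (- ln (Z r%:E w) * hit r%:E u w) + u * (1 - \int[Q]_w hit r%:E u w)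
  + \int[Q]_w hit r%:E u w * 2 = g_fin r u.
Proof.
move=> r0 u0; rewrite hit_momentE// hit_probE// /g_fin.
by move: (Phibar _) (Num.sqrt (_ * _ / _)) (expR _) => p s e; ring.
Qed.

(** Read through [mean_g_fin], [g_fin] is [m + u (1 - p) + 2 p] with [0 <= m <= u p], where [p] is
    the hitting probability. It thus lies between [u + (2 - u) p] and [u + 2 p], and only [p --> 0]
    has to be shown. *)
Lemma g_infty (u : R) : 0 < u -> g +oo%E u = u.
Proof.
move=> u0; rewrite /g; apply/cvg_lim => //.
pose p (r : R) := 2 * Phibar (Num.sqrt (r / u)).
have p0 : p r @[r --> +oo%R] --> (0 : R).
  rewrite -[X in _ --> X](mulr0 2); apply: cvgM; first exact: cvg_cst.
  have su : Num.sqrt (r / u) @[r --> +oo%R] --> +oo%R.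
    apply/cvgryPge => B; near=> r.
    have Br : u * B ^+ 2 <= r by near: r; apply: nbhs_pinfty_ge; rewrite num_real.
    rewrite (le_trans (ler_norm _))// -sqrtr_sqr ler_sqrt.
      by rewrite ler_pdivlMr// mulrC.
    by rewrite divr_ge0 ?(ltW u0)// (le_trans _ Br)// mulr_ge0 ?(ltW u0)// sqr_ge0.
  exact: (cvg_comp _ _ su (@cvg_Phibary R)).
apply: (@squeeze_cvgr _ _ _ _ (fun r => u + (2 - u) * p r) (fun r => u + 2 * p r)).
- near=> r; have r0 : 0 < r by near: r; apply: nbhs_pinfty_gt; rewrite num_real.
  have /andP[] := hit_moment_bounds r0 u0; rewrite -(mean_g_fin r0 u0) hit_probE// -/(p r).
  by move: (\int[Q]_w _) => m; nra.
- rewrite -[X in _ --> X]addr0 -[X in _ --> _ + X](mulr0 (2 - u)).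
  by apply: cvgD; [exact: cvg_cst|apply: cvgM => //; exact: cvg_cst].
- rewrite -[X in _ --> X]addr0 -[X in _ --> _ + X](mulr0 2).
  by apply: cvgD; [exact: cvg_cst|apply: cvgM => //; exact: cvg_cst].
Unshelve. all: by end_near. Qed.

Lemma g_zero (u : R) : g 0%:E u = 2.
Proof.
rewrite /g/= /g_fin !mul0r !mulr0 sqrtr0 Phibar0 !mul0r sqrtr0 mul0r addr0.
by field.
Qed.

Lemma mean_g a (u : R) : (0 <= a)%E -> 0 < u ->
  \int[Q]_w (- ln (Z a w) * hit a u w) + u * (1 - \int[Q]_w hit a u w)
  + \int[Q]_w hit a u w * 2 = g a u.
Proof.
case: a => [r||//] r0 u0; last first.
  rewrite g_infty//.
  have hE w : hit +oo%E u w = 0 by rewrite /hit/= leNgt expR_gt0.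
  under eq_Rintegral do rewrite hE mulr0; rewrite Rint_cst.
  by under eq_Rintegral do rewrite hE; rewrite Rint_cst; ring.
have [rp|rn0|<-] := ltgtP 0 r.
- exact: mean_g_fin.
- by move: r0; rewrite lee_fin leNgt rn0.
rewrite g_zero.
have ZE w : Z 0%:E w = 1 by rewrite /Z /= mul0r oppr0 expR0.
have hE w : hit 0%:E u w = 1.
  by rewrite /hit ZE -[X in _ <= X]expR0 ler_expR oppr_le0 (ltW u0).
under eq_Rintegral do rewrite hE mulr1 ZE ln1 oppr0; rewrite Rint_cst.
by under eq_Rintegral do rewrite hE; rewrite Rint_cst; ring.
Qed.

End MeanFormula.

Lemma ae_eq_measure {d} {T : measurableType d} {R : realType}
  (m : {measure set T -> \bar R}) (A B : set T) : measurable A -> measurable B ->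
  {ae m, forall w, A w <-> B w} -> m A = m B.
Proof.
move=> mA mB AB; rewrite -(setIT A) -(setIT B) -!integral_indic//.
apply: ae_eq_integral => //.
- by apply/measurable_EFinP; exact: measurable_indic.
- by apply/measurable_EFinP; exact: measurable_indic.
apply: filterS AB => w AB _; rewrite !indicE; suff -> : (w \in A) = (w \in B) by [].
by apply/idP/idP; rewrite !inE => /AB.
Qed.

(** * The law of the limit variable through [exp (- L)] *)

Section LimitLaw.
Context {R : realType} {d} {T : measurableType d} (Q : probability T R).
Variables xi tau : {RV Q >-> R}.
Hypothesis hxi : darling_mandelbrot xi.
Hypothesis htau : levy_distributed tau.
Hypothesis hind : independent xi tau.
Variables (a : \bar R) (u : R).
Hypothesis a0 : (0 <= a)%E.
Hypothesis u0 : 0 < u.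

Let Z w := discount a (tau w).
Let L w : \bar R := limit_lifetime a u (xi w) (tau w).

Let measurable_Z : measurable_fun setT Z.
Proof. by apply: measurableT_comp; [exact: measurable_discount|exact: measurable_funP]. Qed.

Let hit w : R := (expR (- u) <= Z w)%R%:R.

Let measurable_hit_pred : measurable_fun setT (fun w => expR (- u) <= Z w).
Proof. exact: (measurable_fun_ler (measurable_cst _) measurable_Z). Qed.

Let measurable_hit : measurable_fun setT hit.
Proof. exact: (measurableT_comp (f := fun b : bool => b%:R : R)). Qed.

Lemma measurable_limit_lifetime : measurable_fun setT L.
Proof.
have mt : measurable_fun setT (fun w => (a * (tau w)%:E)%E).
  by apply: measurable_funeM; apply/measurable_EFinP; exact: measurable_funP.
apply: emeasurable_funD.
  by apply: measurable_mine => //; exact: measurable_cst.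
apply: measurable_fun_ifT; last exact: measurable_cst.
- by apply: measurable_fun_lte => //; exact: measurable_cst.
- apply/measurable_EFinP; apply: measurable_funD; first exact: measurable_cst.
  exact: measurable_funP.
Qed.

(* [exp (- L)] up to a null set. *)
Definition discounted_life w : R :=
  if expR (- u) <= Z w then Z w * (expR (-1) * expR (- Num.max 0 (xi w)))
  else expR (- u).

Let W := discounted_life.

Lemma measurable_discounted_life : measurable_fun setT W.
Proof.
apply: measurable_fun_ifT => //.
apply: measurable_funM; first exact: measurable_Z.
apply: measurable_funM; first exact: measurable_cst.
apply: measurableT_comp => //; apply: measurableT_comp => //.
by apply: measurable_maxr; [exact: measurable_cst|exact: measurable_funP].
Qed.

Let expRN01 (s : R) : 0 <= s -> 0 <= expR (- s) <= 1.
Proof. by move=> s0; rewrite expR_ge0/= -[leRHS]expR0 ler_expR oppr_le0. Qed.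

Lemma discounted_life01 w : 0 <= W w <= 1.
Proof.
rewrite /W /discounted_life; case: ifP => _; last exact: expRN01 (ltW u0).
have /andP[z0 z1] := discount01 (tau w) a0.
have /andP[f0 f1] := expRN01 ler01.
have m0 : 0 <= Num.max 0 (xi w) by rewrite le_max lexx.
have /andP[e0 e1] := expRN01 m0.
by rewrite !mulr_ge0//= mulr_ile1// ?mulr_ge0// mulr_ile1.
Qed.

(** The limit variable tests [a * tau < u] strictly and [discounted_life] tests it weakly; the two
    agree off the null event [Z = exp (- u)]. The null events [tau <= 0] and [xi < 0] are discarded
    as well. *)
Lemma limit_lifetimeE :
  {ae Q, forall w, exists2 s : R, 0 <= s & L w = s%:E /\ W w = expR (- s)}.
Proof.
have atom : {ae Q, forall w, Z w <> expR (- u)}.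
  exists ((discount a \o tau) @^-1` [set expR (- u)]); split.
  - by rewrite -[X in measurable X]setTI; exact: measurable_Z.
  - exact: discount_atom.
  - by move=> w /= /contrapT.
apply: filterS3 (levy_gt0 htau) (dm_ge0 hxi) atom => w t0 x0 zu.
rewrite /L /W /discounted_life /limit_lifetime /Z; move: zu; rewrite /Z.
case: (a) a0 => [r r0|_ _|//]; last first.
  rewrite gt0_mulye ?lte_fin//= lt_geF ?expR_gt0//.
  by exists u; rewrite ?(ltW u0)// min_l ?leey// adde0.
rewrite /= (max_r (ltW t0)) (max_r x0) ler_expR lerN2 => zu.
rewrite -EFinM lte_fin; have r0' : 0 <= r by move: r0; rewrite lee_fin.
have [rt|rt] := leP (r * tau w) u.
  have rtu : r * tau w < u.
    by rewrite lt_neqAle rt andbT; apply/eqP => e; apply: zu; rewrite e.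
  exists (r * tau w + (1 + xi w)); first by rewrite !addr_ge0// mulr_ge0// ltW.
  rewrite rtu min_r; last by rewrite lee_fin.
  by split; rewrite // !opprD !expRD.
exists u; first exact: ltW.
by rewrite ltNge (ltW rt)/= min_l ?adde0// lee_fin ltW.
Qed.

Lemma limit_lifetime_cdf (r : R) :
  Q [set w | (L w <= r%:E)%E] = Q [set w | expR (- r) <= W w].
Proof.
apply: ae_eq_measure.
- rewrite -[X in measurable X]setTI; apply: measurable_lee => //.
  exact: measurable_limit_lifetime.
- rewrite -[X in measurable X]setTI; apply: measurable_fun_le => //.
  exact: measurable_discounted_life.
apply: filterS limit_lifetimeE => w [s s0 [Lw Ww]] /=; rewrite Lw Ww.
by rewrite lee_fin ler_expR lerN2.
Qed.

Lemma limit_lifetime_neg (r : R) : r < 0 -> Q [set w | (L w <= r%:E)%E] = 0%E.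
Proof.
move=> r0; rewrite limit_lifetime_cdf (_ : [set w | _] = set0) ?measure0//.
apply/seteqP; split => w //=; have /andP[_ w1] := discounted_life01 w.
move=> /le_trans /(_ w1); rewrite -[leRHS]expR0 ler_expR oppr_le0.
by rewrite leNgt r0.
Qed.

(** An atom of [W] at [exp (- r)] would be a jump of the limiting distribution function at [r]: all
    values at [s < r] would stay below the value at [r] by at least its mass. *)
Lemma discounted_life_atom (r : R) :
  {for r, continuous (fun s : R => Q [set w | (L w <= s%:E)%E])} ->
  Q (W @^-1` [set expR (- r)]) = 0%E.
Proof.
move=> cr; set A := W @^-1` _.
have mA : measurable A.
  by rewrite -[A]setTI; exact: measurable_discounted_life.
have mle s : measurable [set w | expR (- s) <= W w].
  rewrite -[X in measurable X]setTI; apply: measurable_fun_le => //.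
  exact: measurable_discounted_life.
pose F s := fine (Q [set w | (L w <= s%:E)%E]).
have FE s : Q [set w | expR (- s) <= W w] = (F s)%:E.
  by rewrite /F limit_lifetime_cdf fineK// fin_num_measure.
have cF : F s @[s --> r] --> F r.
  apply: fine_cvg; rewrite /F fineK; first exact: cr.
  by rewrite limit_lifetime_cdf fin_num_measure.
have QA : Q A = (fine (Q A))%:E by rewrite fineK// fin_num_measure.
have jump s : s < r -> F s + fine (Q A) <= F r.
  move=> sr; rewrite -lee_fin EFinD -!FE -QA -measureU//; last first.
    apply/seteqP; split => w //= -[+ Aw]; rewrite (Aw : W w = _).
    by rewrite ler_expR lerN2 leNgt sr.
  apply: le_measure; rewrite ?inE//; first exact: measurableU.
  move=> w /= [|Aw]; last by rewrite (Aw : W w = _).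
  apply: le_trans; by rewrite ler_expR lerN2 ltW.
have [//|c0] := leP (fine (Q A)) 0.
  by move=> c0; rewrite QA; congr EFin; apply/eqP; rewrite eq_le c0 fine_ge0.
exfalso.
have cFl : F s @[s --> r^'-] --> F r by exact: cvg_at_left_filter.
have /cvgrPdist_lt /(_ _ c0) near_F := cFl.
have near_lt : \forall s \near r^'-, s < r by exact: nbhs_left_lt.
have : \forall s \near r^'-, False.
  apply: filterS2 near_lt near_F => s sr.
  rewrite ltr_norml => /andP[_]; have := jump s sr; lra.
by move=> /filter_ex[].
Qed.

Let integrable_hit k : Q.-integrable setT (EFin \o (fun w => Z w ^+ k * hit w)).
Proof.
apply: (@integrable_bounded _ _ _ _ _ 1).
  by apply: measurable_funM => //; exact: measurable_funX.
move=> w; have /andP[z0 z1] := discount01 (tau w) a0.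
rewrite ger0_norm ?mulr_ge0 ?exprn_ge0// mulr_ile1 ?exprn_ge0 ?exprn_ile1//.
by rewrite /hit; case: (expR (- u) <= Z w); rewrite ?lexx ?ler01.
Qed.

(** On the hitting event [W ^+ k] is a function of [tau] times the factor [X], which depends only on
    [xi]. Independence separates them and [X] integrates to [refuel_laplace], giving the limit of
    the lifetime transforms. *)
Lemma discounted_life_moment k : (0 < k)%N ->
  \int[Q]_w (W w ^+ k) = expR (- (u * k%:R)) * (1 - \int[Q]_w hit w) +
    \int[Q]_w (Z w ^+ k * hit w) * refuel_laplace R k.
Proof.
move=> k0.
pose X w := expR (- k%:R) * expR (- k%:R * Num.max 0 (xi w)).
have kR : (0 : R) <= k%:R by exact: ler0n.
have X01 w : 0 <= X w <= 1.
  have m0 : 0 <= Num.max 0 (xi w) by rewrite le_max lexx.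
  have /andP[f0 f1] := expRN01 kR; have /andP[e0 e1] := expRN01 (mulr_ge0 kR m0).
  by rewrite /X mulNr mulr_ge0//= mulr_ile1.
have mX : measurable_fun setT X.
  apply: measurable_funM; first exact: measurable_cst.
  apply: measurableT_comp => //; apply: measurable_funM; first exact: measurable_cst.
  by apply: measurable_maxr; [exact: measurable_cst|exact: measurable_funP].
have hit01 w : 0 <= hit w <= 1.
  by rewrite /hit; case: (expR (- u) <= Z w); rewrite ?lexx ?ler01.
have WE w : W w ^+ k = expR (- (u * k%:R)) * (1 - hit w) + Z w ^+ k * hit w * X w.
  rewrite /W /discounted_life /hit; case: ifP => _.
    rewrite subrr mulr0 add0r mulr1 !exprMn; congr (_ * (_ * _)).
      by rewrite -expRM_natl mulrN1.
    by rewrite -expRM_natl mulrN mulNr.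
  by rewrite subr0 mulr0 mul0r addr0 mulr1 -expRM_natl mulrN mulrC.
have int_hit : Q.-integrable setT (EFin \o hit).
  apply: (@integrable_bounded _ _ _ _ _ 1) => // w.
  by have /andP[h0 h1] := hit01 w; rewrite ger0_norm.
under eq_Rintegral do rewrite WE.
rewrite RintegralD//; first last.
- apply: (@integrable_bounded _ _ _ _ _ 1).
    apply: measurable_funM => //; apply: measurable_funM => //.
    exact: measurable_funX.
  move=> w; have /andP[z0 z1] := discount01 (tau w) a0.
  have /andP[h0 h1] := hit01 w; have /andP[x0 x1] := X01 w.
  have zk0 : 0 <= Z w ^+ k by rewrite exprn_ge0.
  have zh0 : 0 <= Z w ^+ k * hit w by rewrite mulr_ge0.
  have zh1 : Z w ^+ k * hit w <= 1 by rewrite mulr_ile1// exprn_ile1.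
  by rewrite ger0_norm ?mulr_ge0// mulr_ile1.
- apply: (@integrable_bounded _ _ _ _ _ 1).
    by apply: measurable_funM => //; exact: measurable_funB.
  move=> w; have /andP[h0 h1] := hit01 w.
  have /andP[e0 e1] := expRN01 (mulr_ge0 (ltW u0) kR).
  have g0 : 0 <= 1 - hit w by rewrite subr_ge0.
  by rewrite ger0_norm ?mulr_ge0// mulr_ile1// gerBl.
congr (_ + _).
  rewrite RintegralZl//; last first.
    apply: (@integrable_bounded _ _ _ _ _ 1); first exact: measurable_funB.
    by move=> w; have /andP[h0 h1] := hit01 w; rewrite ger0_norm ?subr_ge0// gerBl.
  rewrite RintegralB//; last exact: finite_measure_integrable_cst.
  rewrite Rintegral_cst// mul1r; congr (_ * (_ - _)).
  by rewrite -[RHS]/(fine 1%E); congr fine; exact: probability_setT.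
pose f (s : R) := expR (- k%:R) * expR (- k%:R * Num.max 0 s).
pose h (t : R) := discount a t ^+ k * (expR (- u) <= discount a t)%R%:R.
have mf : measurable_fun setT f.
  apply: measurable_funM; first exact: measurable_cst.
  apply: measurableT_comp => //; apply: measurable_funM; first exact: measurable_cst.
  by apply: measurable_maxr; [exact: measurable_cst|exact: measurable_id].
have mh : measurable_fun setT h.
  apply: measurable_funM; first by apply: measurable_funX; exact: measurable_discount.
  apply: (measurableT_comp (f := fun b : bool => b%:R : R)) => //.
  exact: (measurable_fun_ler (measurable_cst _) (measurable_discount a)).
have f0 s : 0 <= f s by rewrite mulr_ge0 ?expR_ge0.
have h0 s : 0 <= h s by rewrite mulr_ge0 ?exprn_ge0//; have /andP[] := discount01 s a0.
have fE : (\int[Q]_w (f (xi w))%:E = (refuel_laplace R k)%:E)%E.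
  transitivity (\int[Q]_w ((expR (- k%:R))%:E * (expR (- k%:R * xi w))%:E))%E.
    apply: ae_eq_integral => //.
    - by apply/measurable_EFinP; apply: measurableT_comp => //; exact: measurable_funP.
    - apply: measurable_funeM; apply/measurable_EFinP; apply: measurableT_comp => //.
      by apply: measurable_funM; [exact: measurable_cst|exact: measurable_funP].
    - by apply: filterS (dm_ge0 hxi) => w x0 _; rewrite /f max_r// EFinM.
  rewrite ge0_integralZl_EFin ?expR_ge0//.
  - by rewrite dm_laplace ?ltr0n// -EFinM.
  - apply/measurable_EFinP; apply: measurableT_comp => //.
    by apply: measurable_funM; [exact: measurable_cst|exact: measurable_funP].
rewrite [RHS]mulrC /Rintegral.
under eq_integral do rewrite mulrC.
rewrite (independent_integralM hind mf mh f0 h0) fE fineM//.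
exact: (integrable_fin_num _ (integrable_hit k)).
Qed.

End LimitLaw.

Lemma refuel_denom_gt0 (R : realType) (N : enat) (M : nat) (r : R) :
  0 < r < 1 -> 0 < refuel_denom N M r.
Proof.
move=> /andP[r0 r1]; rewrite /refuel_denom ltr_pwDl//.
  by rewrite mulr_gt0 ?subr_gt0// ltr_pwDl// mulr_ge0 ?survsum_ge0// ltW.
by rewrite mulr_ge0 ?surv_ge0// exprn_ge0// ltW.
Qed.

Lemma cvg_truncn_div (R : realType) (r : R) : 0 <= r ->
  ((Num.truncn (r * M%:R))%:R / M%:R : R) @[M --> \oo] --> r.
Proof.
move=> r0; apply: (@squeeze_cvgr _ _ _ _ (fun M => r - 1 / M%:R) (fun=> r)).
- near=> M; have M0 : (0 : R) < M%:R by rewrite ltr0n; near: M; exists 1%N.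
  have rM : 0 <= r * M%:R by rewrite mulr_ge0// ltW.
  have t1 : (Num.truncn (r * M%:R))%:R <= r * M%:R by rewrite truncn_le.
  have t2 := truncnS_gt (r * M%:R).
  rewrite ler_pdivrMr// t1 andbT ler_pdivlMr// mulrBl divfK ?gt_eqF//.
  by rewrite lerBlDr natr1 ltW.
- by rewrite -[X in _ --> X]subr0; apply: cvgB; [exact: cvg_cst|exact: cvg_natr_div].
- exact: cvg_cst.
Unshelve. all: by end_near. Qed.

(** * Passage from the extended-valued hypotheses to the limits of survival probability and mean *)

Section Lifetimes.
Variables (R : realType) (N : nat -> enat) (x y : nat -> nat) (a : \bar R) (u : R).
Hypothesis hN : forall M, (0 < M)%N -> if N M is Some n then (2 <= n)%N else true.
Hypothesis hx : forall M, (0 < M)%N -> site (N M) (x M).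
Hypothesis hy : forall M, (0 < M)%N -> (y M <= M)%N.
Hypothesis a0 : (0 <= a)%E.
Hypothesis u0 : 0 < u.
Hypothesis lim_x : (Order.min ((x M)%:R%:E ^+ 2)
             ((enat2ereal (N M) - (x M)%:R%:E) ^+ 2) / M%:R%:E
           @[M --> \oo] --> a)%E.
Hypothesis lim_y : ((y M)%:R / M%:R : R) @[M --> \oo] --> u.
Hypothesis lim_N : (M%:R%:E / enat2ereal (N M) ^+ 2 : \bar R)%E @[M --> \oo] --> 0%E.
Context {d} {U : measurableType d} (Q : probability U R).
Variables xi tau : {RV Q >-> R}.
Hypothesis hxi : darling_mandelbrot xi.
Hypothesis htau : levy_distributed tau.
Hypothesis hind : independent xi tau.

Let near_pos : \forall M \near \oo, (0 < M)%N. Proof. by exists 1%N. Qed.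

Let rlim_N : (if N M is Some n then M%:R / n%:R ^+ 2 else 0) @[M --> \oo] --> (0 : R).
Proof.
pose f M : R := if N M is Some n then M%:R / n%:R ^+ 2 else 0.
suff h : (f M)%:E @[M --> \oo] --> (0 : R)%:E by exact: (fine_cvg h).
apply: cvg_trans lim_N; apply: near_eq_cvg; rewrite /f.
apply: filterS near_pos => M M0; have := hN M0; case: (N M) => [n n2|_]; rewrite [enat2ereal _]/=.
  by rewrite -EFin_expe inver sqrf_eq0 pnatr_eq0 gtn_eqF// (leq_trans _ n2).
by rewrite expe2 mulyy invey mule0.
Qed.

Let m M := if N M is Some n then minn (x M) (n - x M) else x M.

Let rlim_x : (((m M)%:R ^+ 2 / M%:R : R)%:E @[M --> \oo] --> a)%E.
Proof.
apply: cvg_trans lim_x; apply: near_eq_cvg.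
apply: filterS near_pos => M M0; have := hx M0; rewrite /m inver pnatr_eq0 gtn_eqF//.
case: (N M) => [n|_]; rewrite [enat2ereal _]/=.
  rewrite /site => xn.
  rewrite -EFinB -!EFin_expe -EFin_min -EFinM -natrB//; congr (_ / _)%:E.
  have [h|h] := leqP (x M) (n - x M).
    by rewrite min_l// ler_pXn2r ?nnegrE// ler_nat.
  by rewrite min_r// ler_pXn2r ?nnegrE// ler_nat ltnW.
by rewrite addye// [(+oo ^+ 2)%E]expe2 mulyy min_l ?leey// -EFin_expe -EFinM.
Qed.

Let cvg_harmonic_discount k : (0 < k)%N ->
  harmonic (N M) (decay (disc R k M)) (x M) @[M --> \oo] -->
  \int[Q]_w (discount a (tau w) ^+ k).
Proof.
move=> k0; case: a a0 rlim_x => [r r0 h|_ h|//].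
  rewrite discount_power_integral//; apply: cvg_harmonic_fin => //.
  exact: (fine_cvg h).
rewrite (_ : \int[Q]_w _ = 0).
  by apply: cvg_harmonic_y => //; apply/cvgeryP.
under eq_Rintegral do rewrite /= expr0n gtn_eqF//.
by rewrite Rintegral_cst// mul0r.
Qed.

Let mZ : measurable_fun setT (fun w => discount a (tau w)).
Proof. by apply: measurableT_comp; [exact: measurable_discount|exact: measurable_funP]. Qed.

Let Z01 w : 0 <= discount a (tau w) <= 1. Proof. exact: discount01. Qed.

Let Zu : Q ((fun w => discount a (tau w)) @^-1` [set expR (- u)]) = 0%E.
Proof. exact: discount_atom. Qed.

Lemma cvg_mean_life : lifesum (N M) M 1 (x M) (y M) / M%:R @[M --> \oo] --> g a u.
Proof.
rewrite -(mean_g htau a0 u0).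
exact: (cvg_lifesum_mean hN hx rlim_N (ltW u0) lim_y mZ Z01 Zu cvg_harmonic_discount).
Qed.

Lemma near_refuel_denom1 : \forall M \near \oo, 0 < refuel_denom (N M) M (1 : R).
Proof.
have := @near_refuel_denom R N hN rlim_N 0.
by apply: filterS => M; rewrite disc0.
Qed.

Let W := discounted_life xi tau a u.

(** Karamata's theorem for the mass function of the lifetime, with the constant test function 1, the
    cut at the integer part of [r * M] and the limit variable [W]; the resulting sum is one minus
    the survival probability. *)
Lemma cvg_alive (r : R) : 0 <= r -> Q (W @^-1` [set expR (- r)]) = 0%E ->
  alive R (N M) M (Num.truncn (r * M%:R)) (x M) (y M) @[M --> \oo] -->
  1 - \int[Q]_w (expR (- r) <= W w)%R%:R.
Proof.
move=> r0 Wr.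
pose tail M n := alive R (N M) M n (x M) (y M).
pose S k M : R := 1 - (1 - disc R k M) * lifesum (N M) M (disc R k M) (x M) (y M).
have tail1 M n : 0 <= tail M n <= 1.
  rewrite alive_ge0/=; elim: n => [|n]; last exact/le_trans/alive_nincr.
  by rewrite /tail /=; case: ifP => // _; case: (y M).
have w0 M n : 0 <= tail_pmf (tail M) n.
  by apply: tail_pmf_ge0 => [k|]; [exact: alive_nincr|have /andP[] := tail1 M 0%N].
have wS k M : (0 < k)%N -> (0 < M)%N ->
    series (fun n => tail_pmf (tail M) n * expR (- (n%:R / M%:R)) ^+ k) @ \oo --> S k M.
  move=> k0 M0; have d01 : 0 < disc R k M < 1 by rewrite disc_gt0 disc_lt1.
  under eq_fun do rewrite discX.
  apply: tail_pmf_laplace => //.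
  apply: alivesum_lifesum; [exact: hN| |exact: refuel_denom_gt0|exact: hx|exact: hy].
  by rewrite disc_gt0 disc_le1.
have SW k : (0 < k)%N -> S k M @[M --> \oo] --> \int[Q]_w (W w ^+ k).
  move=> k0; rewrite (discounted_life_moment hxi hind a0 u0 k0).
  exact: (@cvg_lifesum_laplace _ _ _ _ _ hN hx rlim_N lim_y _ _ _ _ mZ Z01 Zu cvg_harmonic_discount k).
have mW := measurable_discounted_life xi tau a u.
have W01 w : 0 <= W w <= 1 by exact: discounted_life01.
have iW : Q.-integrable setT (EFin \o W).
  apply: (@integrable_bounded _ _ _ _ _ 1) => // w.
  by have /andP[z0 z1] := W01 w; rewrite ger0_norm.
have psi0 (z : R) : 0 <= z <= 1 -> 0 <= (fun=> 1 : R) z by [].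
have h := karamata mW W01 iW w0 wS SW (cvg_truncn_div r0) Wr
  (fun=> cvg_cst (1 : R)) psi0.
have h' : 1 - \sum_(n < (Num.truncn (r * M%:R)).+1) tail_pmf (tail M) n * 1 @[M --> \oo] -->
    1 - \int[Q]_w (1 * (expR (- r) <= W w)%R%:R).
  by apply: cvgB; [exact: cvg_cst|exact: h].
have -> : \int[Q]_w (expR (- r) <= W w)%R%:R = \int[Q]_w (1 * (expR (- r) <= W w)%R%:R).
  by apply: eq_Rintegral => w _; rewrite mul1r.
apply: (cvg_near_eqn _ h'); apply: nearW => M.
have := sum_tail_pmf (tail M) 1 (Num.truncn (r * M%:R)).
under eq_bigr do rewrite expr1n.
by move=> ->; rewrite subrr mul0r subr0 expr1n mul1r opprB addrC subrK.
Qed.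

End Lifetimes.

(** * The limit theorem *)

Local Open Scope ereal_scope.

Theorem theorem2p3 (R : realType)
  (N : nat -> enat) (x y : nat -> nat) (a : \bar R) (u : R)
  (hN : forall M, (0 < M)%N -> if N M is Some n then (2 <= n)%N else true)
  (hx : forall M, (0 < M)%N -> site (N M) (x M))
  (hy : forall M, (0 < M)%N -> (y M <= M)%N)
  (ha : 0 <= a) (hu : (0 < u <= 1)%R)
  (lim_x : Order.min ((x M)%:R%:E ^+ 2)
             ((enat2ereal (N M) - (x M)%:R%:E) ^+ 2) / M%:R%:E
           @[M --> \oo] --> a)
  (lim_y : ((y M)%:R / M%:R : R)%R @[M --> \oo] --> u)
  (lim_N : (M%:R%:E / enat2ereal (N M) ^+ 2 : \bar R) @[M --> \oo] --> 0)

  (d : nat -> measure_display) (T : forall M, measurableType (d M))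
  (P : forall M, probability (T M) R)
  (zeta : forall M, nat -> {RV (P M) >-> (nat * nat)%type})
  (hzeta : forall M, (0 < M)%N ->
     is_chain (N M) M (x M, y M) (zeta M))
  (d' : measure_display) (U : measurableType d') (Q : probability U R)
  (xi tau : {RV Q >-> R})
  (hxi : darling_mandelbrot xi) (htau : levy_distributed tau)
  (hind : independent xi tau) :
  cvg_in_distribution P
    (fun M w => lifetime (N M) (zeta M) w / M%:R%:E)
    Q (fun w => limit_lifetime a u (xi w) (tau w)) /\
  (\int[P M]_w lifetime (N M) (zeta M) w) / M%:R%:E @[M --> \oo]
    --> (g a u)%:E /\
  (a = 0 ->
     [/\ {ae Q, forall w, limit_lifetime a u (xi w) (tau w) = 1 + (xi w)%:E},
         g a u = 2%R & 2%:E = 1 + 'E_Q[xi]]) /\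
  (a = +oo ->
     {ae Q, forall w, limit_lifetime a u (xi w) (tau w) = u%:E} /\
     g a u = u).
Proof.
have /andP[u0 _] := hu.
have near_pos : \forall M \near \oo, (0 < M)%N by exists 1%N.
split; last split; last split.
- move=> r cr.
  have [r0|r0] := leP 0%R r; last first.
    (* For [r < 0] both distribution functions vanish, the lifetime being nonnegative. *)
    rewrite limit_lifetime_neg//; apply: cvg_near_cst.
    apply: filterS near_pos => M M0; rewrite (_ : [set w | _] = set0) ?measure0//.
    apply/seteqP; split => w //=; apply/negP; rewrite -ltNge.
    apply: (@lt_le_trans _ _ 0); first by rewrite lte_fin.
    by rewrite mule_ge0 ?lifetime_ge0// inve_ge0 lee_fin.
  have mle : measurable [set w | (expR (- r) <= discounted_life xi tau a u w)%R].
    rewrite -[X in measurable X]setTI; apply: measurable_fun_le => //.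
    exact: measurable_discounted_life.
  rewrite limit_lifetime_cdf//.
  (* The double complement matches the limit of [1 - alive], the form in which the distribution
     function of the lifetime is known. *)
  have -> : Q [set w | (expR (- r) <= discounted_life xi tau a u w)%R] =
      (1 - (1 - (\int[Q]_w (expR (- r) <= discounted_life xi tau a u w)%R%:R)%R))%R%:E.
    rewrite opprB addrC subrK -[LHS]fineK; last exact: fin_num_measure.
    rewrite -[X in Q X]setIT -integral_indic//; congr (fine _)%:E.
    by apply: eq_integral => w _; rewrite indicE mem_setE.
  have h : (1 - alive R (N M) M (Num.truncn (r * M%:R)) (x M) (y M))%R @[M --> \oo] -->
      (1 - (1 - (\int[Q]_w (expR (- r) <= discounted_life xi tau a u w)%R%:R)%R))%R.
    apply: cvgB; first exact: cvg_cst.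
    apply: (cvg_alive hN hx hy ha u0 lim_x lim_y lim_N hxi htau hind r0).
    exact: (discounted_life_atom hxi htau ha u0 cr).
  have hE : (1 - alive R (N M) M (Num.truncn (r * M%:R)) (x M) (y M))%R%:E @[M --> \oo] -->
      (1 - (1 - (\int[Q]_w (expR (- r) <= discounted_life xi tau a u w)%R%:R)%R))%R%:E.
    by apply: cvg_EFin; [exact: nearW|exact: h].
  apply: cvg_trans hE; apply: near_eq_cvg; apply: filterS near_pos => M M0.
  by rewrite /= (lifetime_cdf (hN M M0) (hzeta M M0) (hx M M0)).
- have h := cvg_mean_life hN hx ha u0 lim_x lim_y lim_N htau.
  have hE : (lifesum (N M) M 1 (x M) (y M) / M%:R)%R%:E @[M --> \oo] --> (g a u)%:E.
    by apply: cvg_EFin; [exact: nearW|exact: h].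
  apply: cvg_trans hE; apply: near_eq_cvg; near=> M.
  have M0 : (0 < M)%N by near: M.
  (* The exact mean at [r = 1] needs a nonzero denominator, which holds for all large [M]. *)
  have d0 : (0 < refuel_denom (N M) M (1 : R))%R.
    by near: M; exact: near_refuel_denom1 hN lim_N.
  rewrite /= (lifetime_mean (hN M M0) (hzeta M M0) (hx M M0)
    (alivesum_lifesum (hN M M0) _ d0 (hx M M0) (hy M M0))) ?ltr01 ?lexx//.
  by rewrite inver pnatr_eq0 gtn_eqF// -EFinM.
- move=> a0; rewrite a0; split; last 2 first.
  + exact: g_zero.
  + by rewrite (dm_expectation hxi) -EFinD.
  + apply: aeW => w; rewrite /limit_lifetime mul0e lte_fin u0 min_r ?add0e//.
    by rewrite lee_fin ltW.
- move=> ->; split; last exact: (g_infty htau u0).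
  apply: filterS (levy_gt0 htau) => w t0.
  by rewrite /limit_lifetime gt0_mulye ?lte_fin//= min_l ?leey// adde0.
Unshelve. all: by end_near. Qed.
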